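(* Let $\beta>1$ and let $\nu$ be a symmetric Lévy measure on $\mathbb{R}^d$ such that $$\nu(dx)\asymp|x|^{-d-2}\left[\log\left(\frac{2}{|x|}\right)\right]^{-\beta}dx,\qquad |x|<1$$ (with no further assumption on $\nu$ outside $B(0,1)$). Then there exist positive constants $c_7,c_8$ such that $$p_t(x)\ge c_8\min\left\{t^{-d/2}\left(\log\frac2t\right)^{d(\beta-1)/2},\ \frac{t}{|x|^{d+2}\left(\log\frac{2}{|x|}\right)^{\beta}}+h(t)^{-d}e^{-c_7(|x|/h(t))^2}\right\}$$ for all $t\in(0,1)$ and $|x|<1$ (for $x=0$ the second entry of the minimum is read as $+\infty$).
   Context: $d\in\{1,2,\dots\}$; $B(x,r)$ is the ball with center $x$ and radius $r$. A symmetric Lévy measure on $\mathbb{R}^d$ is a Borel measure $\nu$ with $\nu(\{0\})=0$, $\int(1\wedge|y|^2)\,\nu(dy)<\infty$ and $\nu(-D)=\nu(D)$ for all Borel $D\subset\mathbb{R}^d$. The hypothesis on $\nu$ means that on $\{0<|x|<1\}$ the measure $\nu$ has a density bounded above and below by positive constant multiples of $|x|^{-d-2}[\log(2/|x|)]^{-\beta}$. Put $\Phi(\xi)=\int_{\mathbb{R}^d}(1-\cos(\xi\cdot y))\,\nu(dy)$. $\{P_t\}_{t\ge0}$ is the convolution semigroup of probability measures on $\mathbb{R}^d$ with $\int e^{i\xi\cdot y}P_t(dy)=e^{-t\Phi(\xi)}$; under the hypothesis each $P_t$, $t>0$, has a continuous density, denoted $p_t$. Put $\Psi(r)=\sup_{|\xi|\le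 r}\Phi(\xi)$ for $r>0$ (continuous, nondecreasing, unbounded), $\Psi^{-1}(s)=\sup\{r>0:\Psi(r)=s\}$ for $s>0$ and $h(t)=1/\Psi^{-1}(1/t)$ for $t>0$. *)

(* Defs.v *)
From HB Require Import structures.
From mathcomp Require Import all_boot all_order all_algebra.
From mathcomp Require Import complex.
From mathcomp Require Import all_classical all_reals all_analysis.

Set Implicit Arguments.
Unset Strict Implicit.
Unset Printing Implicit Defensive.

Import Order.TTheory GRing.Theory Num.Theory.
Import numFieldNormedType.Exports.

Local Open Scope classical_set_scope.
Local Open Scope ring_scope.

Section borel_mx.
Variables (R : realType) (m n : nat).

Definition measurable_mx : set (set 'M[R]_(m, n)) := <<s @open 'M[R]_(m, n) >>.

Let measurable_mx0 : measurable_mx set0.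
Proof. exact: sigma_algebra0. Qed.

Let measurable_mxC A : measurable_mx A -> measurable_mx (~` A).
Proof. exact: sigma_algebraC. Qed.

Let measurable_mx_bigcup (F : (set 'M[R]_(m, n))^nat) :
  (forall k, measurable_mx (F k)) -> measurable_mx (\bigcup_k F k).
Proof. exact: sigma_algebra_bigcup. Qed.

HB.instance Definition _ := @isMeasurable.Build default_measure_display
  'M[R]_(m, n) measurable_mx measurable_mx0 measurable_mxC measurable_mx_bigcup.

End borel_mx.

Section measurable_mx_theory.
Variables (R : realType) (m n : nat).

Lemma measurable_fun_coord (i : 'I_m) (j : 'I_n) :
  measurable_fun [set: 'M[R]_(m, n)] (fun M => M i j).
Proof.
apply: (measurability _ (measurable_realfun.RGenOpens.measurableE R)).
move=> _ [_ [a [b ->]] <-].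
rewrite setTI; apply: sub_sigma_algebra.
by apply: open_comp => [M _|]; [exact: coord_continuous|exact: interval_open].
Qed.

Lemma measurable_fun_mx d (T : measurableType d) (f : T -> 'M[R]_(m, n)) :
  (forall i j, measurable_fun [set: T] (fun x => f x i j)) ->
  measurable_fun [set: T] f.
Proof.
move=> mf; apply: (measurability (@open 'M[R]_(m, n)) erefl) => _ [U oU <-].
rewrite setTI.
pose B (k : 'M[rat]_(m, n) * nat) : set 'M[R]_(m, n) :=
  [set N | forall i j, ball (ratr (k.1 i j) : R) k.2.+1%:R^-1 (N i j)].
pose F k : set 'M[R]_(m, n) := [set N | B k `<=` U /\ B k N].
have -> : f @^-1` U = \bigcup_k (f @^-1` F k).
  rewrite -preimage_bigcup; congr (_ @^-1` _).
  apply/seteqP; split => [M UM|M [k _ [kU /kU//]]].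
  have /nbhs_ballP[e /= e0 eU] : nbhs M U by exact: open_nbhs_nbhs.
  have [k ke] : exists k, k.+1%:R^-1 < e / 2.
    have [k _ /(_ k (leqnn k))] := near_infty_natSinv_lt (PosNum (divr_gt0 e0 (ltr0n R 2))).
    by exists k.
  have k0 : 0 < k.+1%:R^-1 :> R by rewrite invr_gt0.
  have /choice[q qP] : forall ij : 'I_m * 'I_n,
      exists q : rat, `|M ij.1 ij.2 - ratr q| < k.+1%:R^-1.
    move=> [i j]/=.
    have /rat_in_itvoo[q] : M i j - k.+1%:R^-1 < M i j + k.+1%:R^-1.
      by rewrite ltrBlDr -addrA ltrDl addr_gt0.
    rewrite in_itv/= => /andP[Mq qM]; exists q.
    by rewrite distrC ltr_distl Mq.
  pose Q : 'M[rat]_(m, n) := \matrix_(i, j) q (i, j).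
  exists (Q, k) => //; split; last first.
    by move=> i j; rewrite !mxE /ball/= distrC; exact: (qP (i, j)).
  move=> N QN; apply: eU; split => // i j.
  have QMij : ball (M i j) k.+1%:R^-1 (ratr (Q i j)).
    by rewrite mxE /ball/=; exact: (qP (i, j)).
  apply: (@le_ball _ _ _ (k.+1%:R^-1 + k.+1%:R^-1)).
    by rewrite [leRHS]splitr lerD// ltW.
  exact: ball_triangle QMij (QN i j).
apply: countable_bigcupT_measurable => [|k]; first exact: countableP.
have [kU|kU] := pselect (B k `<=` U); last first.
  by rewrite [X in measurable X](_ : _ = set0)// -subset0 => x [].
rewrite [X in measurable X](_ : _ = \bigcap_(ij : 'I_m * 'I_n)
    ((fun x => f x ij.1 ij.2) @^-1`
      ball (ratr (k.1 ij.1 ij.2) : R) k.2.+1%:R^-1)).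
  apply: fin_bigcap_measurable => [|[i j] _]; first exact: finite_finset.
  rewrite -[X in measurable X]setTI.
  by apply: mf => //; rewrite ball_itv; exact: measurable_itv.
apply/seteqP; split => [x [_ Bx] [i j] _|x Bx]; first exact: Bx.
by split => // i j; exact: (Bx (i, j)).
Qed.

End measurable_mx_theory.

Section lebesgue_rV.
Variable R : realType.

Definition row_cons n (z : measurableTypeR R * 'rV[R]_n) : 'rV[R]_n.+1 :=
  row_mx (z.1%:M : 'rV[R]_1) z.2.

Lemma row_cons0 n (z : measurableTypeR R * 'rV[R]_n) : row_cons z 0 ord0 = z.1.
Proof.
rewrite /row_cons mxE; case: splitP => [j _|k] /=; last by [].
by rewrite !mxE ord1.
Qed.

Lemma row_consS n (z : measurableTypeR R * 'rV[R]_n) (i : 'I_n) :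
  row_cons z 0 (lift ord0 i) = z.2 0 i.
Proof.
rewrite /row_cons mxE; case: splitP => [j|k] /=.
  by move=> ji; have := ltn_ord j; rewrite -ji.
by rewrite /bump/= => -[ik]; congr (_ 0 _); apply: val_inj.
Qed.

Lemma measurable_row_cons n : measurable_fun setT (@row_cons n).
Proof.
apply: measurable_fun_mx => i j; rewrite ord1.
have [k ->|->] := unliftP ord0 j.
  under eq_fun do rewrite row_consS.
  apply: (measurableT_comp (f := fun v : 'rV[R]_n => v 0 k)) measurable_snd.
  exact: measurable_fun_coord.
under eq_fun do rewrite row_cons0.
exact: measurable_fst.
Qed.

Section step.
Variables (n : nat) (mu : {sigma_finite_measure set 'rV[R]_n -> \bar R}).

Local Notation prod_mu := (@lebesgue_measure R \x mu)%E.

Definition lebesgue_step : set 'rV[R]_n.+1 -> \bar R :=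
  pushforward prod_mu (@row_cons n).

Let measurable_preimage A : measurable A -> measurable (@row_cons n @^-1` A).
Proof.
by move=> mA; rewrite -[X in measurable X]setTI; exact: measurable_row_cons.
Qed.

Let lebesgue_step0 : lebesgue_step set0 = 0%E.
Proof. by rewrite /lebesgue_step /pushforward preimage_set0 measure0. Qed.

Let lebesgue_step_ge0 A : (0 <= lebesgue_step A)%E.
Proof. by rewrite /lebesgue_step /pushforward measure_ge0. Qed.

Let lebesgue_step_sigma_additive : semi_sigma_additive lebesgue_step.
Proof.
move=> F mF tF mUF; rewrite /lebesgue_step /pushforward preimage_bigcup.
apply: measure_semi_sigma_additive.
- by move=> k; exact: measurable_preimage.
- apply/trivIsetP => i j _ _ ij; rewrite -preimage_setI.
  by move/trivIsetP : tF => /(_ _ _ _ _ ij) ->//; rewrite preimage_set0.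
- by rewrite -preimage_bigcup; exact: measurable_preimage.
Qed.

HB.instance Definition _ := isMeasure.Build _ _ _ lebesgue_step
  lebesgue_step0 lebesgue_step_ge0 lebesgue_step_sigma_additive.

Definition row_uncons (v : 'rV[R]_n.+1) : measurableTypeR R * 'rV[R]_n :=
  (v 0 ord0, \row_i v 0 (lift ord0 i)).

Lemma row_consK : cancel (@row_cons n) row_uncons.
Proof.
move=> [x v]; rewrite /row_uncons row_cons0; congr pair.
by apply/rowP => i; rewrite mxE row_consS.
Qed.

Lemma measurable_row_uncons : measurable_fun setT row_uncons.
Proof.
apply/measurable_fun_pairP; split; first exact: measurable_fun_coord.
apply: measurable_fun_mx => i j.
under eq_fun do rewrite /= mxE.
exact: measurable_fun_coord.
Qed.

Let lebesgue_step_sigma_finite : sigma_finite setT lebesgue_step.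
Proof.
have /sigma_finiteP[F [TF ndF Foo]] := sigma_finiteT (@lebesgue_measure R).
have /sigma_finiteP[G [TG ndG Goo]] := sigma_finiteT mu.
exists (fun k => row_uncons @^-1` (F k `*` G k)).
  apply/esym; rewrite -subTset => v _.
  have [k _ Fk] : (\bigcup_k F k) (row_uncons v).1 by rewrite -TF.
  have [l _ Gl] : (\bigcup_k G k) (row_uncons v).2 by rewrite -TG.
  exists (maxn k l) => //; split.
    by move: Fk; exact/subsetPset/ndF/leq_maxl.
  by move: Gl; exact/subsetPset/ndG/leq_maxr.
move=> k; have [mF Fkoo] := Foo k; have [mG Gkoo] := Goo k; split.
  rewrite -[X in measurable X]setTI; apply: measurable_row_uncons => //.
  exact: measurableX.
rewrite /lebesgue_step /pushforward -comp_preimage.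
rewrite (_ : row_uncons \o _ = id); last first.
  by apply/funext => z; exact: row_consK.
by rewrite preimage_id product_measure1E// lte_mul_pinfty// ge0_fin_numE.
Qed.

HB.instance Definition _ := Measure_isSigmaFinite.Build _ _ _ lebesgue_step
  lebesgue_step_sigma_finite.

End step.

(* n-dimensional Lebesgue measure as an iterated product, transported along
   R x R^n ~ R^(n+1). *)
Fixpoint lebesgue_rV n : {sigma_finite_measure set 'rV[R]_n -> \bar R} :=
  if n is n'.+1 then lebesgue_step (lebesgue_rV n') else \d_(0 : 'rV[R]_0).

Lemma lebesgue_rV_box n (a b : 'rV[R]_n) : (forall i, a 0 i <= b 0 i) ->
  lebesgue_rV n [set x | forall i, x 0 i \in `[a 0 i, b 0 i]] =
  (\prod_(i < n) (b 0 i - a 0 i))%:E.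
Proof.
elim: n a b => [|n IHn] a b ab.
  rewrite big_ord0 /= diracE mem_set//= => -[].
  by [].
rewrite big_ord_recl /= /lebesgue_step /pushforward.
pose a' := \row_i a 0 (lift ord0 i); pose b' := \row_i b 0 (lift ord0 i).
pose box : set 'rV[R]_n := [set x | forall i, x 0 i \in `[a' 0 i, b' 0 i]].
rewrite [X in product_measure1 _ _ X](_ : _ =
    `[a 0 ord0, b 0 ord0]%classic `*` box); last first.
  apply/seteqP; split => [[x v]/= xv|[x v]/= [xab vab] i].
    split; first by have := xv ord0; rewrite row_cons0.
    by move=> i; have := xv (lift ord0 i); rewrite row_consS !mxE.
  have [k ->|->] := unliftP ord0 i; last by rewrite row_cons0.
  by rewrite row_consS; have := vab k; rewrite !mxE.
rewrite product_measure1E//=; last first.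
  rewrite [X in measurable X](_ : _ = \bigcap_(i : 'I_n)
      ((fun x : 'rV[R]_n => x 0 i) @^-1` [set` `[a' 0 i, b' 0 i]])).
    apply: fin_bigcap_measurable => [|i _]; first exact: finite_finset.
    by rewrite -[X in measurable X]setTI; exact: measurable_fun_coord.
  by apply/seteqP; split => [x xi i _|x xi i]; [exact: xi|exact: (xi i I)].
rewrite IHn => [|i]; last by rewrite !mxE.
rewrite EFinM; congr (_ * _)%E; last first.
  by congr EFin; apply: eq_bigr => i _; rewrite !mxE.
rewrite lebesgue_measure_itv/= lte_fin; case: ltgtP (ab ord0) => // -> _.
by rewrite subrr.
Qed.

End lebesgue_rV.
Arguments lebesgue_rV {R} n.

Section levy.
Local Open Scope complex_scope.
Variables (R : realType) (d : nat).
Implicit Types (x y xi : 'rV[R]_d) (r s t beta : R).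

Definition dotv x y : R := \sum_(i < d) x 0 i * y 0 i.

(* The Euclidean norm; the library norm `|x| on row vectors is the sup norm. *)
Definition enorm x : R := Num.sqrt (dotv x x).

Definition symmetric_levy_measure (nu : {measure set 'rV[R]_d -> \bar R}) :=
  [/\ nu [set 0] = 0%E,
      (\int[nu]_y (Num.min 1 (enorm y ^+ 2))%:E < +oo)%E &
      forall D : set 'rV[R]_d, measurable D ->
        nu [set - y | y in D] = nu D].

(* nu(dx) \asymp g(x) dx on D *)
Definition comparable_density (nu : {measure set 'rV[R]_d -> \bar R})
    (D : set 'rV[R]_d) (g : 'rV[R]_d -> R) :=
  exists f : 'rV[R]_d -> R,
  [/\ measurable_fun D f,
      forall A : set 'rV[R]_d, measurable A -> A `<=` D ->
        nu A = (\int[lebesgue_rV d]_(x in A) (f x)%:E)%E &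
      exists c C : R, [/\ 0 < c, 0 < C &
        forall x, D x -> c * g x <= f x <= C * g x]].

Definition levy_profile beta x : R :=
  (enorm x ^+ (d + 2))^-1 * ln (2 / enorm x) `^ (- beta).

Definition levy_exponent (nu : {measure set 'rV[R]_d -> \bar R}) xi : R :=
  \int[nu]_y (1 - cos (dotv xi y)).

Definition char_fun (P : probability 'rV[R]_d R) xi : R[i] :=
  (\int[P]_y cos (dotv xi y)) +i* (\int[P]_y sin (dotv xi y)).

(* The second clause is P_(s+t) = P_s * P_t, the convolution being the image of
   the product measure under addition; the third is weak continuity at 0. *)
Definition convolution_semigroup (P : R -> probability 'rV[R]_d R) :=
  [/\ forall A : set 'rV[R]_d, measurable A ->
        P 0 A = \d_(0 : 'rV[R]_d) A,
      forall s t, 0 <= s -> 0 <= t ->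
        forall A : set 'rV[R]_d, measurable A ->
          P (s + t) A = (P s \x P t)%E [set z | A (z.1 + z.2)] &
      forall f : 'rV[R]_d -> R, continuous f ->
        (exists M, forall y, `|f y| <= M) ->
        \int[P t]_y f y @[t --> 0^'+] --> f 0].

Definition levy_semigroup (nu : {measure set 'rV[R]_d -> \bar R})
    (P : R -> probability 'rV[R]_d R) :=
  convolution_semigroup P /\
  forall t xi, 0 <= t ->
    char_fun (P t) xi = (expR (- (t * levy_exponent nu xi)))%:C.

Definition continuous_densities (P : R -> probability 'rV[R]_d R)
    (p : R -> 'rV[R]_d -> R) :=
  forall t, 0 < t ->
  [/\ continuous (p t), forall x, 0 <= p t x &
      forall A : set 'rV[R]_d, measurable A ->
        P t A = (\int[lebesgue_rV d]_(x in A) (p t x)%:E)%E].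

Variable nu : {measure set 'rV[R]_d -> \bar R}.

Definition Psi r : R :=
  sup [set levy_exponent nu xi | xi in [set xi | enorm xi <= r]].

Definition Psi_inv s : R := sup [set r | 0 < r /\ Psi r = s].

Definition hscale t : R := 1 / Psi_inv (1 / t).

End levy.

(* Main.v *)
From HB Require Import structures.
Require Import Defs.
From mathcomp Require Import all_boot all_order all_algebra.
From mathcomp Require Import all_classical all_reals all_analysis.
From mathcomp Require Import complex measurable_realfun.
From mathcomp Require Import ring lra zify.

Set Implicit Arguments.
Unset Strict Implicit.
Unset Printing Implicit Defensive.

Import Order.TTheory GRing.Theory Num.Theory.
Import numFieldNormedType.Exports.

Local Open Scope classical_set_scope.
Local Open Scope ring_scope.

(** Write [rate m = 4^m (m+1)^(1-beta)]; up to constants this is the Levy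
exponent [Phi] at frequencies of size [2^m], so that a time [t < 1] lives on
the spatial scale [2^-m] where [1 <= t * rate m <= 4].

Near the diagonal, [p_t] is compared with the mean of [P_t] against a
product of rescaled cubic B-splines, whose Fourier transform is the
integrable nonnegative kernel [((1 - cos x)^2 / x^4)]: on [|xi| <~ 2^m] the
integrand is positive, and the frequencies beyond [2^(m+A)] contribute little.
This gives [p_t >= c 2^(md)] on [|x| <= c0 2^-m].  The Gaussian factor follows
by chaining through about [1 + 4^m |x|^2] points.

For the jump term, let [u(s)] be the mean under [P_s] of the B-spline bump of
width [eps ~ 2^-m] centred at [x].  Then [u 0 = 0], and [u'(s)] is the mean of
the generator applied to the bump, which is bounded below by
[-C rate m] on the support of the bump, is nonnegative off it, and is at least
of order [levy_profile x * eps^d] near the origin, where [P_s] has half its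
mass for [s <= eta * t].  By the mean value theorem [P_s] charges the
[eps]-ball at [x] by at least [c t levy_profile x eps^d] for some [s <= t / 2],
and the near-diagonal bound at time [t - s] concludes. *)

(** * Trigonometric bounds *)

Section cos_bounds.
Variable R : realType.
Implicit Types x y a : R.

(** The annulus |y| ~ 2^-k has Lévy mass of order 4^k (k+1)^(-beta), hence second moment of order
    (k+1)^(-beta), and the second moments of the annuli beyond m add up to order (m+1)^(1-beta). So
    no single annulus accounts for the exponent at frequency 2^m, which exceeds the mass of the
    jumps of size 2^-m by a factor of order m: lower bounds on the exponent have to collect of order
    m annuli. The kernel must integrate an exponent that is quadratic up to logarithms. The Fejér
    kernel decays only like x^-2; its square has a finite second moment, and its transform, a
    convolution of two triangles, is still nonnegative with compact support. The density is reached
    only through [P t] of cubes shrinking to a point, by continuity, with bounds uniform in their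
    size; no inversion formula for [p t] itself is used. The mean value theorem gives no control of
    its time s beyond s < eta t. This is harmless, since the near-diagonal bound holds at t - s for
    every s <= t / 2 with the same constants. *)

Lemma ge0_from_derive (f f' : R -> R) :
  (forall x, is_derive x 1 f (f' x)) -> f 0 = 0 ->
  (forall x, 0 <= x -> 0 <= f' x) -> forall x, 0 <= x -> 0 <= f x.
Proof.
move=> df f0 f'0 x x0.
have := @ger0_derive1_ndecry R f 0 _ _ _ 0 x (lexx 0) x0; rewrite f0; apply.
- by move=> y _; exact: (@ex_derive _ _ _ _ _ _ _ (df y)).
- move=> y; rewrite in_itv/= andbT => y0.
  by rewrite derive1E (@derive_val _ _ _ _ _ _ _ (df y)) f'0// ltW.
- apply: continuous_subspaceT => y; apply: differentiable_continuous.
  by apply/derivable1_diffP; exact: (@ex_derive _ _ _ _ _ _ _ (df y)).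
Qed.

(** Removing the quadratic Taylor part makes the quotient by x^4 integrable at 0, and a fourth
    difference does not see the removed part. *)
Definition cos_rem x : R := cos x - 1 + x ^+ 2 / 2.

Lemma sin_le_id x : 0 <= x -> sin x <= x.
Proof.
move=> x0; rewrite -subr_ge0.
apply: (@ge0_from_derive (fun x => x - sin x) (fun x => 1 - cos x)) => //.
- by rewrite sin0 subr0.
Qed.

Lemma cos_remN x : cos_rem (- x) = cos_rem x.
Proof. by rewrite /cos_rem cosN sqrrN. Qed.

Lemma cos_rem_ge0 x : 0 <= cos_rem x.
Proof.
wlog x0 : x / 0 <= x.
  move=> H; have [/H//|x0] := leP 0 x.
  by rewrite -cos_remN H// oppr_ge0 ltW.
apply: (@ge0_from_derive cos_rem (fun x => x - sin x)) => //.
- move=> y; rewrite /cos_rem; apply: is_derive_eq.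
  by rewrite /GRing.scale/= !mulr1; field.
- by rewrite /cos_rem cos0 expr0n/= mul0r addr0 subrr.
- by move=> y y0; rewrite subr_ge0 sin_le_id.
Qed.

Lemma cos_rem_le x : cos_rem x <= x ^+ 4 / 24.
Proof.
wlog x0 : x / 0 <= x.
  move=> H; have [/H//|x0] := leP 0 x.
  by have := H (- x); rewrite cos_remN oppr_ge0 exprNn -signr_odd mul1r => ->//; exact: ltW.
have sin3 y : 0 <= y -> 0 <= sin y - y + y ^+ 3 / 6.
  apply: (@ge0_from_derive (fun y => sin y - y + y ^+ 3 / 6) cos_rem).
  - move=> z; rewrite /cos_rem; apply: is_derive_eq.
    by rewrite /GRing.scale/= !mulr1; field.
  - by rewrite sin0 expr0n/= mul0r addr0 subrr.
  - by move=> z _; exact: cos_rem_ge0.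
rewrite -subr_ge0.
apply: (@ge0_from_derive (fun x => x ^+ 4 / 24 - cos_rem x)
   (fun y => sin y - y + y ^+ 3 / 6)) => //.
- move=> y; rewrite /cos_rem; apply: is_derive_eq.
  by rewrite /GRing.scale/= !mulr1; field.
- by rewrite /cos_rem cos0 !expr0n/= !mul0r addr0 !subrr.
Qed.

Lemma cosB1_ge0 x : 0 <= 1 - cos x.
Proof. by rewrite subr_ge0 cos_le1. Qed.

Lemma cosB1_le2 x : 1 - cos x <= 2.
Proof. by have := cos_geN1 x; lra. Qed.

Lemma cosB1_le x : 1 - cos x <= x ^+ 2 / 2.
Proof. by have := cos_rem_ge0 x; rewrite /cos_rem; lra. Qed.

Lemma cosB1_ge x : `|x| <= 1 -> x ^+ 2 / 4 <= 1 - cos x.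
Proof.
move=> x1; have := cos_rem_le x; rewrite /cos_rem.
have : x ^+ 2 <= 1 by rewrite -real_normK ?num_real// expr_le1.
have := sqr_ge0 x; rewrite (_ : x ^+ 4 = x ^+ 2 * x ^+ 2); last by rewrite -exprD.
by nra.
Qed.

End cos_bounds.

(** * Dilations of Lebesgue measure and the dominating function 1 / (1 + x^2) *)

Section scaling.
Variable R : realType.
Local Notation mu := (@lebesgue_measure R).

(** Lebesgue measure is a times its image under x -> a x, because the two agree on intervals; the
    rest is integration against an image measure. *)
Lemma integralT_scale (a : R) (f : R -> \bar R) : 0 < a ->
  measurable_fun setT f -> (forall x, 0 <= f x)%E ->
  (a%:E * \int[mu]_x f (a * x)%R = \int[mu]_x f x)%E.
Proof.
move=> a0 mf f0.
have ma : measurable_fun setT (fun x : measurableTypeR R => a * x : measurableTypeR R).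
  exact: measurable_funM.
pose nu : {measure set (measurableTypeR R) -> \bar R} :=
  mscale (NngNum (ltW a0)) (pushforward mu (fun x : measurableTypeR R => a * x : measurableTypeR R)).
have E A : measurable A -> mu A = nu ma A.
  apply: lebesgue_measure_unique => _ [[u v] _ <-].
  rewrite /nu /mscale/= /pushforward.
  rewrite [X in mu X](_ : _ = `]u, v]%classic) //.
  rewrite /mscale/= [X in (_ * mu X)%E](_ : _ = `](u / a), (v / a)]%classic); last first.
    apply/seteqP; split=> x/=; rewrite !in_itv/=.
      by rewrite ltr_pdivrMr// ler_pdivlMr// mulrC.
    by rewrite ltr_pdivrMr// ler_pdivlMr// mulrC.
  rewrite !lebesgue_measure_itv/= !lte_fin ltr_pM2r ?invr_gt0//.
  case: ifPn => uv; last by rewrite mule0.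
  by rewrite -!EFinB -EFinM -mulrBl mulrC divfK// gt_eqF.
rewrite [RHS](eq_measure_integral (nu ma))//; last by move=> A mA _; exact: E.
rewrite [RHS]ge0_integral_mscale//=; congr (_ * _)%E.
by rewrite ge0_integral_pushforward//=.
Qed.

End scaling.

Section kernel1.
Variable R : realType.
Local Notation mu := (@lebesgue_measure R).

Lemma integrable_oneDsqrV : mu.-integrable setT (EFin \o (fun x : R => (oneDsqr x)^-1)).
Proof.
apply/integrableP; split.
  by apply/measurable_EFinP; apply: continuous_measurable_fun; exact: continuous_oneDsqrV.
rewrite [ltLHS](_ : _ = \int[mu]_x ((oneDsqr x)^-1)%:E)%E; last first.
  by apply: eq_integral => x _ /=; rewrite ger0_norm// invr_ge0; have := oneDsqr_ge1 x; lra.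
rewrite ge0_symfun_integralT//=; last 2 first.
- exact: continuous_oneDsqrV.
- by move=> x; rewrite /oneDsqr/= sqrrN.
rewrite (_ : [set x | _] = `[0, +oo[%classic); last first.
  by apply/seteqP; split=> x/=; rewrite in_itv/= andbT.
by rewrite integral0y_oneDsqr -EFinM ltry.
Qed.

End kernel1.

(** * The Jackson kernel and the cubic B-spline *)

Section Rintegral_extra.
Context d (T : measurableType d) (R : realType) (mu : {measure set T -> \bar R}).
Implicit Types f g : T -> R.

Lemma integrable_le f g : measurable_fun setT f ->
  mu.-integrable setT (EFin \o g) -> (forall x, `|f x| <= g x) ->
  mu.-integrable setT (EFin \o f).
Proof.
move=> mf ig fg; apply: (le_integrable _ _ _ ig) => //.
  exact/measurable_EFinP.
by move=> x _ /=; rewrite lee_fin (le_trans (fg x))// ler_norm.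
Qed.

Lemma integrable_meas f : mu.-integrable setT (EFin \o f) -> measurable_fun setT f.
Proof. by move=> /measurable_int /measurable_EFinP. Qed.

Lemma integrableM_bounded f g (C : R) : mu.-integrable setT (EFin \o f) ->
  measurable_fun setT g -> (forall x, `|g x| <= C) ->
  mu.-integrable setT (EFin \o (fun x => f x * g x)).
Proof.
move=> itf mg gC; have mf := integrable_meas itf.
apply: (@integrable_le _ (fun x => C * `|f x|)).
- exact: measurable_funM.
- by apply: (@integrableZl _ _ _ _ _ measurableT C (fun x => `|f x|%:E)); exact: integrable_norm itf.
- by move=> x; rewrite normrM mulrC ler_wpM2r.
Qed.

Lemma integrableD_R f g : mu.-integrable setT (EFin \o f) ->
  mu.-integrable setT (EFin \o g) ->
  mu.-integrable setT (EFin \o (fun x => f x + g x)).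
Proof. by move=> itf itg; apply: (integrableD measurableT itf itg). Qed.

Lemma integrableB_R f g : mu.-integrable setT (EFin \o f) ->
  mu.-integrable setT (EFin \o g) ->
  mu.-integrable setT (EFin \o (fun x => f x - g x)).
Proof. by move=> itf itg; apply: (integrableB measurableT itf itg). Qed.

Lemma integrableZ_R f (k : R) : mu.-integrable setT (EFin \o f) ->
  mu.-integrable setT (EFin \o (fun x => k * f x)).
Proof. by move=> itf; apply: (integrableZl measurableT k itf). Qed.

Lemma integrable_EFin_Rintegral f : mu.-integrable setT (EFin \o f) ->
  (\int[mu]_x (f x)%:E = (\int[mu]_x f x)%:E)%E.
Proof. by move=> itf; rewrite fineK//; exact: integrable_fin_num. Qed.

Lemma ge0_integrable f : measurable_fun setT f -> (forall x, 0 <= f x) ->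
  (\int[mu]_x (f x)%:E < +oo)%E -> mu.-integrable setT (EFin \o f).
Proof.
move=> mf f0 foo; apply/integrableP; split; first exact/measurable_EFinP.
by under eq_integral => x _ do rewrite /= ger0_norm//.
Qed.

End Rintegral_extra.

Section kernel.
Variable R : realType.
Local Notation mu := (@lebesgue_measure R).
Implicit Types (x y a : R).

(** Inversion is not continuous at 0, so it is written with a real power of x^2; the identity
    survives at 0 because 0^-1 = 0. *)
Lemma measurable_invr : measurable_fun setT (fun x : R => x^-1).
Proof.
rewrite [X in measurable_fun _ X](_ : _ = fun x => x * (x ^+ 2) `^ (-1)).
  apply: measurable_funM => //.
  apply: (@measurableT_comp _ _ _ _ _ _ (fun x => x `^ (-1))).
    exact: measurable_powR.
  exact: measurable_funX.
apply/funext => x; rewrite powR_inv1 ?sqr_ge0//.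
have [->|x0] := eqVneq x 0; first by rewrite mul0r invr0.
by rewrite expr2 invfM mulrA divff// mul1r.
Qed.

Lemma measurable_cos : measurable_fun setT (@cos R).
Proof. by apply: continuous_measurable_fun; exact: continuous_cos. Qed.

Lemma measurable_sin : measurable_fun setT (@sin R).
Proof. by apply: continuous_measurable_fun; exact: continuous_sin. Qed.

(** The square of the Fejér kernel. At 0 the division convention gives 0 instead of the limit 1/4,
    which is why the lower bounds below avoid 0. *)
Definition jackson1 x : R := (1 - cos x) ^+ 2 / x ^+ 4.

Lemma measurable_jackson1 : measurable_fun setT jackson1.
Proof.
apply: measurable_funM.
  apply: measurable_funX; apply: measurable_funB => //; exact: measurable_cos.
apply: (@measurableT_comp _ _ _ _ _ _ (fun x : R => x^-1)).
  exact: measurable_invr.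
exact: measurable_funX.
Qed.

Lemma jackson1_ge0 x : 0 <= jackson1 x.
Proof. by rewrite divr_ge0 ?sqr_ge0// -[4%N]/(2 * 2)%N exprM sqr_ge0. Qed.

Lemma exp4_sqr x : x ^+ 4 = (x ^+ 2) ^+ 2.
Proof. by rewrite -exprM. Qed.

Lemma jackson1_le4V x : jackson1 x <= 4^-1.
Proof.
rewrite /jackson1; have [->|x0] := eqVneq x 0; first by rewrite expr0n/= invr0 mulr0 invr_ge0.
rewrite ler_pdivrMr; last by rewrite exp4_sqr exprn_gt0// exprn_even_gt0.
have := cosB1_le x; have := cosB1_ge0 x.
rewrite exp4_sqr; set u := 1 - cos x; set v := x ^+ 2; nra.
Qed.

Lemma jackson1_ge x : x != 0 -> `|x| <= 1 -> 16^-1 <= jackson1 x.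
Proof.
move=> x0 x1; rewrite /jackson1 ler_pdivlMr; last by rewrite exp4_sqr exprn_gt0// exprn_even_gt0.
have := cosB1_ge x1; have := sqr_ge0 x.
rewrite exp4_sqr; set u := 1 - cos x; set v := x ^+ 2; nra.
Qed.

(** For |x| <= 1 the bound 1/4 on the kernel suffices; beyond, (1 + x^2)^2 <= 4 x^4 and (1 - cos
    x)^2 <= 4 multiply to 16. *)
Lemma jackson1D_le x : jackson1 x * (1 + x ^+ 2) <= 16 * (oneDsqr x)^-1.
Proof.
have [->|x0] := eqVneq x 0.
  by rewrite /jackson1 /oneDsqr expr0n/= invr0 mulr0 mul0r expr0n/= addr0 invr1; lra.
rewrite ler_pdivlMr; last by have := oneDsqr_ge1 x; lra.
rewrite /oneDsqr -mulrA -expr2.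
have x2 : 0 < x ^+ 2 by rewrite exprn_even_gt0.
have k0 := jackson1_ge0 x.
have [x1|x1] := leP (x ^+ 2) 1.
  have := jackson1_le4V x => k4.
  apply: (@le_trans _ _ (4^-1 * 4)); last by lra.
  by apply: ler_pM => //; [exact: sqr_ge0| nra].
have : jackson1 x * (x ^+ 4) <= 4.
  rewrite /jackson1 divfK; last by rewrite expf_neq0.
  by have := cosB1_le2 x; have := cosB1_ge0 x; nra.
rewrite exp4_sqr; move: (jackson1 x) (x ^+ 2) k0 x1 {x2} => k v k0 v1 kv.
have : (1 + v) ^+ 2 <= 4 * v ^+ 2 by nra.
move=> /(ler_wpM2l k0); lra.
Qed.

Lemma integrable_jackson1_sqr : mu.-integrable setT (EFin \o (fun x => jackson1 x * (1 + x ^+ 2))).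
Proof.
apply: (integrable_le _ (integrableZ_R 16 (integrable_oneDsqrV R))).
  by apply: measurable_funM; [exact: measurable_jackson1|exact: measurable_funD].
move=> x; rewrite ger0_norm; first exact: jackson1D_le.
by rewrite mulr_ge0 ?jackson1_ge0// addr_ge0 ?sqr_ge0.
Qed.

Lemma integrable_jackson1 : mu.-integrable setT (EFin \o jackson1).
Proof.
apply: (integrable_le _ integrable_jackson1_sqr); first exact: measurable_jackson1.
move=> x; rewrite ger0_norm ?jackson1_ge0// ler_peMr ?jackson1_ge0//.
by have := sqr_ge0 x; lra.
Qed.

Lemma integrable_x2jackson1 : mu.-integrable setT (EFin \o (fun x => x ^+ 2 * jackson1 x)).
Proof.
apply: (integrable_le _ integrable_jackson1_sqr).
  by apply: measurable_funM; [exact: measurable_funX|exact: measurable_jackson1].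
move=> x; have k0 := jackson1_ge0 x; have x20 := sqr_ge0 x.
rewrite ger0_norm; last by rewrite mulr_ge0.
by rewrite mulrC mulrDr mulr1 lerDr.
Qed.

(** In the product of [cos_rem (a * x)] with 1 + x^2, the summand 1 is paired with the quartic
    bound, good near 0, and x^2 with the quadratic bound, good at infinity. *)
Lemma cos_rem4_bound a x :
  `|cos_rem (a * x) / x ^+ 4| <= (a ^+ 2 + a ^+ 4) * (oneDsqr x)^-1.
Proof.
have x40 : 0 <= x ^+ 4 by rewrite exp4_sqr sqr_ge0.
rewrite ger0_norm; last by rewrite divr_ge0// cos_rem_ge0.
rewrite ler_pdivlMr; last by have := oneDsqr_ge1 x; lra.
have [->|x0] := eqVneq x 0.
  rewrite mulr0 expr0n/= invr0 mulr0 mul0r addr_ge0// ?sqr_ge0// exp4_sqr sqr_ge0//.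
have x4p : 0 < x ^+ 4 by rewrite lt_neqAle x40 andbT eq_sym expf_neq0.
rewrite mulrAC ler_pdivrMr//.
have h1 := cos_rem_le (a * x); have h2 := cos_rem_ge0 (a * x).
have h3 : cos_rem (a * x) <= (a * x) ^+ 2 / 2.
  by rewrite /cos_rem; have := cos_le1 (a * x); lra.
rewrite /oneDsqr.
have -> : cos_rem (a * x) * (1 + x ^+ 2) = cos_rem (a * x) * x ^+ 2 + cos_rem (a * x) by ring.
rewrite [leRHS]mulrDl; apply: lerD.
  apply: (@le_trans _ _ ((a * x) ^+ 2 / 2 * x ^+ 2)).
    by rewrite ler_wpM2r ?sqr_ge0.
  have -> : (a * x) ^+ 2 / 2 * x ^+ 2 = a ^+ 2 * x ^+ 4 / 2 by field.
  have : 0 <= a ^+ 2 * x ^+ 4 by rewrite mulr_ge0// sqr_ge0.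
  lra.
apply: (le_trans h1); rewrite exprMn.
have : 0 <= a ^+ 4 * x ^+ 4 by rewrite mulr_ge0// exp4_sqr sqr_ge0.
by lra.
Qed.

Lemma integrable_cos_rem4 a : mu.-integrable setT (EFin \o (fun x => cos_rem (a * x) / x ^+ 4)).
Proof.
apply: (integrable_le _ (integrableZ_R (a ^+ 2 + a ^+ 4) (integrable_oneDsqrV R)));
  last exact: cos_rem4_bound.
apply: measurable_funM.
  apply: (@measurableT_comp _ _ _ _ _ _ (@cos_rem R)); last exact: measurable_funM.
  apply: measurable_funD.
    by apply: measurable_funB => //; exact: measurable_cos.
  by apply: measurable_funM => //; exact: measurable_funX.
apply: (@measurableT_comp _ _ _ _ _ _ (fun x : R => x^-1)).
  exact: measurable_invr.
exact: measurable_funX.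
Qed.

Lemma cos_rem4_scaleE a x : 0 < a ->
  cos_rem (a * x) / x ^+ 4 = a ^+ 4 * (cos_rem (a * x) / (a * x) ^+ 4).
Proof.
move=> a0; have [->|x0] := eqVneq x 0.
  by rewrite mulr0 expr0n/= invr0 !mulr0.
by field; rewrite x0 gt_eqF.
Qed.

Definition cos_rem_integral : R := \int[mu]_x (cos_rem x / x ^+ 4).

(** The integrand is a^4 times a function of a x, and the substitution consumes one factor a. This
    is the origin of the cubes in [delta4]. *)
Lemma cos_rem4_scale a : \int[mu]_x (cos_rem (a * x) / x ^+ 4) = `|a| ^+ 3 * cos_rem_integral.
Proof.
wlog a0 : a / 0 <= a.
  move=> H; have [/H//|a0] := leP 0 a.
  have := H (- a); rewrite normrN oppr_ge0 => <-; last exact: ltW.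
  by apply: eq_Rintegral => x _; rewrite mulNr cos_remN.
move: a0; rewrite le_eqVlt => /predU1P[<-|a0].
  rewrite normr0 expr0n/= mul0r.
  rewrite (_ : (fun x => _) = cst 0) ?Rintegral_cst// ?mul0r//.
  by apply/funext => x; rewrite mul0r /cos_rem cos0 expr0n/= mul0r addr0 subrr mul0r.
rewrite gtr0_norm//.
have i1 : mu.-integrable setT (EFin \o (fun x => cos_rem x / x ^+ 4)).
  by have := integrable_cos_rem4 1; under [X in EFin \o X]eq_fun do rewrite mul1r.
have := @integralT_scale R a (EFin \o (fun x => cos_rem x / x ^+ 4)) a0.
have -> : \int[mu]_x (cos_rem (a * x) / x ^+ 4) =
    \int[mu]_x (a ^+ 4 * (cos_rem (a * x) / (a * x) ^+ 4)).
  by apply: eq_Rintegral => x _; exact: cos_rem4_scaleE.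
have i2 : mu.-integrable setT (EFin \o (fun x => cos_rem (a * x) / (a * x) ^+ 4)).
  have := integrableZ_R (a ^- 4) (integrable_cos_rem4 a).
  apply: eq_integrable => // x _ /=; congr EFin.
  by rewrite (@cos_rem4_scaleE a x a0) mulKf// expf_neq0// gt_eqF.
rewrite RintegralZl//= (integrable_EFin_Rintegral i1) /= (integrable_EFin_Rintegral i2).
move=> H.
have f0 x : (0 <= (cos_rem x / x ^+ 4)%:E)%E.
  by rewrite lee_fin divr_ge0 ?cos_rem_ge0// exp4_sqr sqr_ge0.
have [E] := H (measurable_int _ i1) f0.
by rewrite exprSr -mulrA E.
Qed.

Definition bspline y : R := \int[mu]_x (jackson1 x * cos (x * y)).

Lemma integrable_jackson1cos y : mu.-integrable setT (EFin \o (fun x => jackson1 x * cos (x * y))).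
Proof.
apply: (integrableM_bounded integrable_jackson1); last by move=> x; exact: cos_max.
apply: (@measurableT_comp _ _ _ _ _ _ (@cos R)); first exact: measurable_cos.
exact: measurable_funM.
Qed.

(* Up to a factor, [delta4] is the Fourier transform of [jackson1]: as a fourth
   difference of a piecewise cubic it vanishes outside [-2, 2]. *)
Definition delta4 y : R := `|y + 2| ^+ 3 - 4 * `|y + 1| ^+ 3 + 6 * `|y| ^+ 3
  - 4 * `|y - 1| ^+ 3 + `|y - 2| ^+ 3.

(** The fourth difference with unit step of y -> cos (x y) is 4 (1 - cos x)^2 cos (x y), and the
    terms subtracted in [cos_rem] have degree 2 in y, so it annihilates them. *)
Lemma jackson1_cos_delta4 x y : jackson1 x * cos (x * y) =
  4^-1 * (cos_rem ((y + 2) * x) / x ^+ 4) + - 1 * (cos_rem ((y + 1) * x) / x ^+ 4)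
  + 6 / 4 * (cos_rem (y * x) / x ^+ 4) + - 1 * (cos_rem ((y - 1) * x) / x ^+ 4)
  + 4^-1 * (cos_rem ((y - 2) * x) / x ^+ 4).
Proof.
have c2 : cos (2 * x) = 2 * cos x ^+ 2 - 1 by rewrite mulr_natl cos_mulr2n mulr_natl.
have E1 : cos ((y + 1) * x) + cos ((y - 1) * x) = 2 * (cos (y * x) * cos x).
  by rewrite mulrDl mulrBl mul1r cosD cosB; ring.
have E2 : cos ((y + 2) * x) + cos ((y - 2) * x) = 2 * (cos (y * x) * (2 * cos x ^+ 2 - 1)).
  by rewrite mulrDl mulrBl cosD cosB c2; ring.
rewrite /jackson1 /cos_rem [x * y]mulrC; set i := (x ^+ 4)^-1.
set c := cos (y * x) in E1 E2 *; set e := cos x in E1 E2 *.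
have -> : cos ((y + 2) * x) = 2 * (c * (2 * e ^+ 2 - 1)) - cos ((y - 2) * x).
  by rewrite -E2 addrK.
have -> : cos ((y + 1) * x) = 2 * (c * e) - cos ((y - 1) * x) by rewrite -E1 addrK.
by field.
Qed.

Lemma bspline_delta4 y : bspline y = cos_rem_integral / 4 * delta4 y.
Proof.
rewrite /bspline.
under eq_Rintegral do rewrite jackson1_cos_delta4.
have I k a := integrableZ_R k (integrable_cos_rem4 a).
have i2 := integrableD_R (I 4^-1 (y + 2)) (I (- 1) (y + 1)).
have i3 := integrableD_R i2 (I (6 / 4) y).
have i4 := integrableD_R i3 (I (- 1) (y - 1)).
rewrite (RintegralD measurableT i4 (I _ _)) (RintegralD measurableT i3 (I _ _)).
rewrite (RintegralD measurableT i2 (I _ _)) (RintegralD measurableT (I _ _) (I _ _)).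
rewrite !RintegralZl//; try exact: integrable_cos_rem4.
by rewrite !cos_rem4_scale /delta4; field.
Qed.

Lemma bspline0 : bspline 0 = 2 * cos_rem_integral.
Proof.
by rewrite bspline_delta4 /delta4 !add0r !normrN normr0 normr1 ger0_norm//; field.
Qed.

(** The kernel is nonnegative and at least 1/16 on [1/2, 1], an interval kept away from 0, where
    [jackson1] vanishes by convention. This also settles the sign of the constant
    [cos_rem_integral], which is never evaluated. *)
Lemma bspline0_gt0 : 0 < bspline 0.
Proof.
rewrite /bspline.
have i16 : mu.-integrable `[2^-1, 1] (EFin \o cst (16^-1 : R)).
  apply: measurable_bounded_integrable => //.
    by rewrite /= lebesgue_measure_itv/= lte_fin; case: ifPn => // _; rewrite -EFinB ltry.
  by exists 1; split=> // M M1 x _ /=; rewrite ger0_norm ?invr_ge0//; lra.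
have ik : mu.-integrable `[2^-1, 1] (EFin \o jackson1).
  exact: integrableS integrable_jackson1.
apply: (@lt_le_trans _ _ (\int[mu]_(x in `[2^-1, 1]) (16^-1))).
  rewrite Rintegral_cst//= lebesgue_measure_itv/= lte_fin.
  by rewrite ifT/=; lra.
apply: (@le_trans _ _ (\int[mu]_(x in `[2^-1, 1]) jackson1 x)).
  apply: le_Rintegral => // x/=; rewrite in_itv/= => /andP[x1 x2].
  by apply: jackson1_ge; [rewrite gt_eqF//; lra|rewrite ger0_norm//; lra].
rewrite (_ : (fun x => jackson1 x * cos (x * 0)) = jackson1); last first.
  by apply/funext => x; rewrite mulr0 cos0 mulr1.
rewrite fine_le//.
- by apply: integrable_fin_num.
- by apply: integrable_fin_num => //; exact: integrable_jackson1.
- apply: ge0_subset_integral => //.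
    by apply/measurable_EFinP; exact: measurable_jackson1.
  by move=> x _; rewrite lee_fin jackson1_ge0.
Qed.

Lemma bspline_E y : bspline y = bspline 0 / 8 * delta4 y.
Proof. by rewrite bspline_delta4 bspline0; field. Qed.

Lemma delta4N y : delta4 (- y) = delta4 y.
Proof.
rewrite /delta4.
have h b : `|- y + b| = `|y - b| by rewrite -normrN opprD opprK.
by rewrite !h !opprK normrN; ring.
Qed.

Lemma delta4_ge2 y : 2 <= `|y| -> delta4 y = 0.
Proof.
wlog y0 : y / 0 <= y.
  move=> H; have [/H//|y0] := leP 0 y.
  by rewrite -delta4N -normrN; apply: H; rewrite oppr_ge0 ltW.
rewrite ger0_norm// => y2.
by rewrite /delta4 !ger0_norm//; try lra; ring.
Qed.

Lemma delta4_ge0 y : 0 <= delta4 y.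
Proof.
wlog y0 : y / 0 <= y.
  move=> H; have [/H//|y0] := leP 0 y.
  by rewrite -delta4N H// oppr_ge0 ltW.
have [y2|y2] := leP 2 y; first by rewrite delta4_ge2// ger0_norm.
have [y1|y1] := leP 1 y.
  rewrite /delta4 (ger0_norm y0) (ler0_norm (_ : y - 2 <= 0)) ?ger0_norm; try lra.
  have -> : (y + 2) ^+ 3 - 4 * (y + 1) ^+ 3 + 6 * y ^+ 3 - 4 * (y - 1) ^+ 3 +
    (- (y - 2)) ^+ 3 = 2 * (2 - y) ^+ 3 by ring.
  by rewrite mulr_ge0// exprn_ge0//; lra.
rewrite /delta4 (ger0_norm y0) (ler0_norm (_ : y - 2 <= 0)) ?(ler0_norm (_ : y - 1 <= 0)) ?ger0_norm; try lra.
nra.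
Qed.

(** The minimum 2 on [-1, 1] is taken at the ends, against 8 at 0; hence the quarter in
    [bspline_ge]. *)
Lemma delta4_ge y : `|y| <= 1 -> 2 <= delta4 y.
Proof.
wlog y0 : y / 0 <= y.
  move=> H; have [/H//|y0] := leP 0 y.
  by rewrite -delta4N -normrN => ?; apply: H => //; rewrite oppr_ge0 ltW.
rewrite ger0_norm// => y1.
rewrite /delta4 (ger0_norm y0) (ler0_norm (_ : y - 2 <= 0)) ?(ler0_norm (_ : y - 1 <= 0)) ?ger0_norm; try lra.
have -> : (y + 2) ^+ 3 - 4 * (y + 1) ^+ 3 + 6 * y ^+ 3 - 4 * (- (y - 1)) ^+ 3 +
  (- (y - 2)) ^+ 3 = 2 + 6 * ((1 - y) * (1 + y * (1 - y))) by ring.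
have y10 : 0 <= 1 - y by rewrite subr_ge0.
by rewrite lerDl mulr_ge0// mulr_ge0// addr_ge0// mulr_ge0.
Qed.

Lemma bspline_ge0 y : 0 <= bspline y.
Proof. by rewrite bspline_E mulr_ge0 ?delta4_ge0// divr_ge0// ltW// bspline0_gt0. Qed.

Lemma bspline_eq0 y : 2 <= `|y| -> bspline y = 0.
Proof. by move=> y2; rewrite bspline_E delta4_ge2// mulr0. Qed.

Lemma bspline_ge y : `|y| <= 1 -> bspline 0 / 4 <= bspline y.
Proof. move=> /delta4_ge y1; rewrite [leRHS]bspline_E (_ : bspline 0 / 4 = bspline 0 / 8 * 2); last by field.
by rewrite ler_wpM2l// divr_ge0// ltW// bspline0_gt0. Qed.

Lemma bspline_le y : bspline y <= bspline 0.
Proof.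
apply: le_Rintegral => //; [exact: integrable_jackson1cos..|] => x _.
by rewrite mulr0 cos0 ler_wpM2l ?jackson1_ge0// cos_le1.
Qed.

End kernel.

(** * Product formula and Fubini for real-valued integrals *)

Section product_integral.
Context d1 d2 (T1 : measurableType d1) (T2 : measurableType d2) (R : realType).
Variables (m1 : {sigma_finite_measure set T1 -> \bar R})
  (m2 : {sigma_finite_measure set T2 -> \bar R}).

Lemma integrable_prodM (g : T1 -> R) (h : T2 -> R) :
  m1.-integrable setT (EFin \o g) -> m2.-integrable setT (EFin \o h) ->
  (m1 \x m2)%E.-integrable setT (EFin \o (fun z => g z.1 * h z.2)).
Proof.
move=> ig ih.
have mg := integrable_meas ig; have mh := integrable_meas ih.
apply/integrable12ltyP.
  apply/measurable_EFinP; apply: measurable_funM.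
    exact: measurableT_comp mg measurable_fst.
  exact: measurableT_comp mh measurable_snd.
rewrite (eq_integral (fun x => (`|g x|%:E * (\int[m2]_y `|h y|)%:E)%E)); last first.
  move=> x _.
  rewrite -(integrable_EFin_Rintegral (integrable_norm ih)) -integralZl//; last exact: integrable_norm ih.
  by apply: eq_integral => y _; rewrite /= normrM EFinM.
have /integrableP[_] := integrableZ_R (\int[m2]_y `|h y|) (integrable_norm ig).
rewrite (eq_integral (fun x => (`|g x|%:E * (\int[m2]_y `|h y|)%:E)%E))//.
move=> x _ /=.
rewrite normrM normr_id mulrC EFinM ger0_norm//.
by apply: Rintegral_ge0 => y _.
Qed.

Lemma Rintegral_prodM (g : T1 -> R) (h : T2 -> R) :
  m1.-integrable setT (EFin \o g) -> m2.-integrable setT (EFin \o h) ->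
  \int[(m1 \x m2)%E]_z (g z.1 * h z.2) = (\int[m1]_x g x) * (\int[m2]_y h y).
Proof.
move=> ig ih.
rewrite /Rintegral -integral12_prod_meas1/=; last exact: integrable_prodM.
transitivity (fine (\int[m1]_x ((\int[m2]_y h y)%:E * (g x)%:E))%E).
  congr fine; apply: eq_integral => x _.
  rewrite muleC -(integrable_EFin_Rintegral ih) -integralZl//.
rewrite integralZl// (integrable_EFin_Rintegral ig).
by rewrite -EFinM /= mulrC.
Qed.

End product_integral.

Section RFubini.
Context d1 d2 (T1 : measurableType d1) (T2 : measurableType d2) (R : realType).
Variables (m1 : {sigma_finite_measure set T1 -> \bar R})
  (m2 : {sigma_finite_measure set T2 -> \bar R}).

Lemma RFubini (f : T1 -> T2 -> R) :
  (m1 \x m2)%E.-integrable setT (EFin \o (fun z => f z.1 z.2)) ->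
  (forall x, m2.-integrable setT (EFin \o f x)) ->
  (forall y, m1.-integrable setT (EFin \o f ^~ y)) ->
  \int[m1]_x \int[m2]_y f x y = \int[m2]_y \int[m1]_x f x y.
Proof.
move=> itf i1 i2; rewrite /Rintegral.
have := Fubini itf; rewrite /= => E.
transitivity (fine (\int[m1]_x \int[m2]_y (f x y)%:E)%E).
  by congr fine; apply: eq_integral => x _; exact/esym/integrable_EFin_Rintegral.
rewrite E; congr fine; apply: eq_integral => y _.
exact/integrable_EFin_Rintegral.
Qed.

End RFubini.

(** * Reflection and dilation of real-valued integrals on the line *)

Section reflection_scaling.
Variable R : realType.
Local Notation mu := (@lebesgue_measure R).

Lemma Rintegral_reflect (f : R -> R) : mu.-integrable setT (EFin \o f) ->
  mu.-integrable setT (EFin \o (fun x => f (- x))) ->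
  \int[mu]_x f (- x) = \int[mu]_x f x.
Proof.
move=> itf itfN.
have mN : measurable_fun setT (-%R : measurableTypeR R -> measurableTypeR R).
  exact: measurable_funN.
rewrite /Rintegral; congr fine.
transitivity (\int[pushforward mu (-%R : measurableTypeR R -> measurableTypeR R)]_x (f x)%:E)%E.
  by rewrite [RHS](@integral_pushforward _ _ _ _ _ _ mN)//; exact: measurable_int itf.
by apply: eq_measure_integral => //= A mA AS; exact: lebesgue_measureN.
Qed.

Lemma Rintegral_odd (f : R -> R) : mu.-integrable setT (EFin \o f) ->
  (forall x, f (- x) = - f x) -> \int[mu]_x f x = 0.
Proof.
move=> itf fN.
have itN : mu.-integrable setT (EFin \o (fun x => f (- x))).
  by apply: eq_integrable (integrableZ_R (-1) itf) => // x _ /=; rewrite fN mulN1r.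
have := Rintegral_reflect itf itN; under eq_Rintegral do rewrite fN -mulN1r.
by rewrite RintegralZl// mulN1r; lra.
Qed.

Lemma integrable_scale (a : R) (f : R -> R) : 0 < a ->
  mu.-integrable setT (EFin \o f) ->
  mu.-integrable setT (EFin \o (fun x => f (a * x))).
Proof.
move=> a0 itf; have mf := integrable_meas itf; apply/integrableP; split.
  apply/measurable_EFinP.
  by apply: (@measurableT_comp _ _ _ _ _ _ f) => //; exact: measurable_funM.
have /integrableP[_] := itf; rewrite -(integralT_scale a0).
- by rewrite ltey => aoo; rewrite ltey; apply: contra aoo => /eqP ->; rewrite gt0_muley// lte_fin.
- by apply/measurable_EFinP; exact: measurableT_comp.
- by move=> x; rewrite abse_ge0.
Qed.

Lemma Rintegral_scale (a : R) (f : R -> R) : 0 < a ->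
  mu.-integrable setT (EFin \o f) ->
  \int[mu]_x (a * f (a * x)) = \int[mu]_x f x.
Proof.
move=> a0 itf; have itn := integrable_norm itf.
(* [integralT_scale] covers nonnegative functions only, so f is recovered from |f| + f and |f| -
   f. *)
have iD := integrableD_R itn itf; have iB := integrableB_R itn itf.
have pos (g : R -> R) : mu.-integrable setT (EFin \o g) -> (forall x, 0 <= g x) ->
    a * \int[mu]_x g (a * x) = \int[mu]_x g x.
  move=> ig g0; have := @integralT_scale R a (EFin \o g) a0 (measurable_int _ ig).
  rewrite (integrable_EFin_Rintegral ig) (integrable_EFin_Rintegral (integrable_scale a0 ig)).
  by move=> /(_ g0)[].
have E1 := pos _ iD; have E2 := pos _ iB.
rewrite RintegralZl//; last exact: integrable_scale.
have /E1 {}E1 : forall x, 0 <= `|f x| + f x by move=> x; have := ler_norm (- f x); rewrite normrN; lra.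
have /E2 {}E2 : forall x, 0 <= `|f x| - f x by move=> x; have := ler_norm (f x); lra.
move: E1 E2; rewrite (RintegralD measurableT itn itf) (RintegralB measurableT itn itf).
have s1 := integrable_scale a0 itn; have s2 := integrable_scale a0 itf.
rewrite (RintegralD measurableT s1 s2) (RintegralB measurableT s1 s2) /=; lra.
Qed.

End reflection_scaling.

(** * Coordinatewise integration over row vectors *)

Section rV_integral.
Variable R : realType.
Local Notation mu := (@lebesgue_measure R).

Section step.
Variables (n : nat) (nu : {sigma_finite_measure set 'rV[R]_n -> \bar R}).
Local Notation prod_nu := (mu \x nu)%E.

Lemma integrable_step (f : 'rV[R]_n.+1 -> R) : measurable_fun setT f ->
  prod_nu.-integrable setT (EFin \o (f \o @row_cons R n)) ->
  (lebesgue_step nu).-integrable setT (EFin \o f).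
Proof.
move=> mf itf; apply: integrable_pushforward => //.
  exact: measurable_row_cons.
exact/measurable_EFinP.
Qed.

Lemma Rintegral_step (f : 'rV[R]_n.+1 -> R) : measurable_fun setT f ->
  prod_nu.-integrable setT (EFin \o (f \o @row_cons R n)) ->
  \int[lebesgue_step nu]_x f x = \int[prod_nu]_z f (row_cons z).
Proof.
move=> mf itf; rewrite /Rintegral; congr fine.
rewrite [LHS](@integral_pushforward _ _ _ _ _ _ (@measurable_row_cons R n))//.
exact/measurable_EFinP.
Qed.

End step.

Lemma measurable_prod_coord n (k : 'I_n -> R -> R) :
  (forall i, measurable_fun setT (k i)) ->
  measurable_fun setT (fun xi : 'rV[R]_n => \prod_(i < n) k i (xi 0 i)).
Proof.
move=> mk; apply: measurable_prod => i _.
by apply: (measurableT_comp (mk i)); exact: measurable_fun_coord.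
Qed.

(** Induction on the dimension by splitting off the first coordinate. Integrability and value go
    together, since the product formula in the next dimension needs the integrability in this
    one. *)
Lemma integrable_prod_coord n (k : 'I_n -> R -> R) :
  (forall i, mu.-integrable setT (EFin \o k i)) ->
  (lebesgue_rV n).-integrable setT (EFin \o (fun xi : 'rV[R]_n => \prod_(i < n) k i (xi 0 i))) /\
  \int[lebesgue_rV n]_xi (\prod_(i < n) k i (xi 0 i)) = \prod_(i < n) \int[mu]_x k i x.
Proof.
elim: n k => [|n IH] k ik.
  split.
    apply: measurable_bounded_integrable => //=.
    - by rewrite diracT ltry.
    - by apply: measurable_prod_coord; case.
    - by exists 1; split=> // M M1 x _ /=; rewrite big_ord0 normr1 ltW.
  rewrite big_ord0 (_ : (fun _ => _) = cst 1); last first.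
    by apply/funext => x; rewrite big_ord0.
  by rewrite Rintegral_cst// mul1r [X in fine X]diracT.
have [ih Eh] := IH (fun i => k (lift ord0 i)) (fun i => ik (lift ord0 i)).
have mk i := integrable_meas (ik i).
have E (z : measurableTypeR R * 'rV[R]_n) : \prod_(i < n.+1) k i (row_cons z 0 i) =
    k ord0 z.1 * \prod_(i < n) k (lift ord0 i) (z.2 0 i).
  rewrite big_ord_recl row_cons0; congr (_ * _).
  by apply: eq_bigr => i _; rewrite row_consS.
have ip := integrable_prodM (ik ord0) ih.
have ip' : (mu \x lebesgue_rV n)%E.-integrable setT
    (EFin \o ((fun xi : 'rV[R]_n.+1 => \prod_(i < n.+1) k i (xi 0 i)) \o @row_cons R n)).
  by apply: eq_integrable ip => // z _ /=; rewrite E.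
split; first by apply: integrable_step => //; exact: measurable_prod_coord.
rewrite Rintegral_step//; last exact: measurable_prod_coord.
rewrite big_ord_recl -Eh -(Rintegral_prodM (ik ord0) ih).
by apply: eq_Rintegral => z _; rewrite E.
Qed.

Lemma measurable_dotv n (y : 'rV[R]_n) : measurable_fun setT (fun xi => dotv xi y).
Proof.
apply: measurable_sum => i; apply: measurable_funM => //.
exact: measurable_fun_coord.
Qed.

Lemma dotvC n (x y : 'rV[R]_n) : dotv x y = dotv y x.
Proof. by apply: eq_bigr => i _; rewrite mulrC. Qed.

Lemma measurable_dotv2 n : measurable_fun setT (fun z : 'rV[R]_n * 'rV[R]_n => dotv z.1 z.2).
Proof.
apply: measurable_sum => i; apply: measurable_funM.
  by apply: (measurableT_comp (f := fun v : 'rV[R]_n => v 0 i)) measurable_fst; exact: measurable_fun_coord.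
by apply: (measurableT_comp (f := fun v : 'rV[R]_n => v 0 i)) measurable_snd; exact: measurable_fun_coord.
Qed.

(** The addition formulas mix cosine and sine transforms, so both are carried through the induction;
    the vanishing sine transform kills the cross terms. *)
Lemma fourier_prod_coord n (k : R -> R) (C : R -> R) :
  mu.-integrable setT (EFin \o k) ->
  (forall y, \int[mu]_x (k x * cos (x * y)) = C y) ->
  (forall y, \int[mu]_x (k x * sin (x * y)) = 0) ->
  forall y : 'rV[R]_n,
  \int[lebesgue_rV n]_xi ((\prod_(i < n) k (xi 0 i)) * cos (dotv xi y)) = \prod_(i < n) C (y 0 i) /\
  \int[lebesgue_rV n]_xi ((\prod_(i < n) k (xi 0 i)) * sin (dotv xi y)) = 0.
Proof.
move=> ik kC kS; elim: n => [|n IH] y.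
  split.
    rewrite big_ord0 (_ : (fun _ => _) = cst 1); last first.
      by apply/funext => x; rewrite /dotv !big_ord0 cos0 mulr1.
    by rewrite Rintegral_cst// mul1r [X in fine X]diracT.
  rewrite (_ : (fun _ => _) = cst 0) ?Rintegral_cst// ?mul0r//.
  by apply/funext => x; rewrite /dotv !big_ord0 sin0 mulr0.
pose y' := \row_i y 0 (lift ord0 i).
have [IHc IHs] := IH y'.
have [ih _] := @integrable_prod_coord n (fun=> k) (fun=> ik).
have mk := integrable_meas ik.
have E (z : measurableTypeR R * 'rV[R]_n) : \prod_(i < n.+1) k (row_cons z 0 i) =
    k z.1 * \prod_(i < n) k (z.2 0 i).
  rewrite big_ord_recl row_cons0; congr (_ * _).
  by apply: eq_bigr => i _; rewrite row_consS.
have E2 (z : measurableTypeR R * 'rV[R]_n) : dotv (row_cons z) y = z.1 * y 0 ord0 + dotv z.2 y'.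
  rewrite /dotv big_ord_recl row_cons0; congr (_ + _).
  by apply: eq_bigr => i _; rewrite row_consS mxE.
have mc (f : R -> R) : continuous f -> (forall x, `|f x| <= 1) ->
    mu.-integrable setT (EFin \o (fun x => k x * f (x * y 0 ord0))) /\
    (lebesgue_rV n).-integrable setT
      (EFin \o (fun xi : 'rV[R]_n => (\prod_(i < n) k (xi 0 i)) * f (dotv xi y'))).
  move=> cf f1; have mf := continuous_measurable_fun cf; split.
    apply: (integrableM_bounded ik) (fun x => f1 _).
    by apply: (measurableT_comp mf); exact: measurable_funM.
  apply: (integrableM_bounded ih) (fun x => f1 _).
  by apply: (measurableT_comp mf); exact: measurable_dotv.
have [ic1 ic2] := mc _ (@continuous_cos R) (@cos_max R).
have [is1 is2] := mc _ (@continuous_sin R) (@sin_max R).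
have mK : measurable_fun setT (fun xi : 'rV[R]_n.+1 => \prod_(i < n.+1) k (xi 0 i)).
  exact: (@measurable_prod_coord _ (fun=> k)).
have mD := measurable_dotv y.
have icc := integrable_prodM ic1 ic2.
have iss := integrable_prodM is1 is2.
have isc := integrable_prodM is1 ic2.
have ics := integrable_prodM ic1 is2.
have Ec (z : measurableTypeR R * 'rV[R]_n) :
    (\prod_(i < n.+1) k (row_cons z 0 i)) * cos (dotv (row_cons z) y) =
    (k z.1 * cos (z.1 * y 0 ord0)) * ((\prod_(i < n) k (z.2 0 i)) * cos (dotv z.2 y')) -
    (k z.1 * sin (z.1 * y 0 ord0)) * ((\prod_(i < n) k (z.2 0 i)) * sin (dotv z.2 y')).
  by rewrite E E2 cosD; ring.
have Es (z : measurableTypeR R * 'rV[R]_n) :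
    (\prod_(i < n.+1) k (row_cons z 0 i)) * sin (dotv (row_cons z) y) =
    (k z.1 * sin (z.1 * y 0 ord0)) * ((\prod_(i < n) k (z.2 0 i)) * cos (dotv z.2 y')) +
    (k z.1 * cos (z.1 * y 0 ord0)) * ((\prod_(i < n) k (z.2 0 i)) * sin (dotv z.2 y')).
  by rewrite E E2 sinD; ring.
split.
  rewrite Rintegral_step.
  - under eq_Rintegral do rewrite Ec.
    rewrite (RintegralB measurableT icc iss) (Rintegral_prodM ic1 ic2) (Rintegral_prodM is1 is2) kC kS IHc mul0r subr0 big_ord_recl.
    by congr (_ * _); apply: eq_bigr => i _; rewrite mxE.
  - apply: measurable_funM => //.
    by apply: (measurableT_comp (@measurable_cos R)).
  - apply: eq_integrable (integrableB_R icc iss) => // z _ /=; by rewrite Ec.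
rewrite Rintegral_step.
- under eq_Rintegral do rewrite Es.
  by rewrite (RintegralD measurableT isc ics) (Rintegral_prodM is1 ic2) (Rintegral_prodM ic1 is2) kC kS IHs mul0r mulr0 addr0.
- apply: measurable_funM => //.
  by apply: (measurableT_comp (@measurable_sin R)).
- by apply: eq_integrable (integrableD_R isc ics) => // z _ /=; rewrite Es.
Qed.

End rV_integral.

(** * The product kernel and its bump in dimension d *)

Section kernel_rV.
Variables (R : realType) (d : nat).
Local Notation mu := (@lebesgue_measure R).
Local Notation lam := (@lebesgue_rV R d).
Implicit Types (xi y : 'rV[R]_d) (e : R).

(** The dilation that preserves the integral: frequencies up to 1 / e correspond to a bump of width
    e. *)
Definition jackson1s e (x : R) : R := e * jackson1 (e * x).

Lemma integrable_jackson1s e : 0 < e -> mu.-integrable setT (EFin \o jackson1s e).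
Proof. by move=> e0; apply: integrableZ_R; exact: integrable_scale (integrable_jackson1 R). Qed.

Lemma Rintegral_jackson1s_cos e (y : R) : 0 < e ->
  \int[mu]_x (jackson1s e x * cos (x * y)) = bspline (y / e).
Proof.
move=> e0; rewrite /bspline -(Rintegral_scale e0 (integrable_jackson1cos _)).
apply: eq_Rintegral => x _; rewrite /jackson1s mulrA; congr (_ * cos _).
by rewrite [y / e]mulrC mulrACA divff ?mul1r// gt_eqF.
Qed.

Lemma integrable_jackson1s_bd e (f : R -> R) : 0 < e -> measurable_fun setT f ->
  (forall x, `|f x| <= 1) -> mu.-integrable setT (EFin \o (fun x => jackson1s e x * f x)).
Proof. by move=> e0 mf f1; exact: (integrableM_bounded (integrable_jackson1s e0) mf f1). Qed.

Lemma Rintegral_jackson1s_sin e (y : R) : 0 < e ->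
  \int[mu]_x (jackson1s e x * sin (x * y)) = 0.
Proof.
move=> e0; apply: Rintegral_odd => [|x].
  apply: integrable_jackson1s_bd => //; last by move=> x; exact: sin_max.
  by apply: (measurableT_comp (@measurable_sin R)); exact: measurable_funM.
by rewrite mulNr sinN mulrN /jackson1s /jackson1 mulrN cosN exp4_sqr sqrrN -exp4_sqr.
Qed.

Lemma Rintegral_jackson1s e : 0 < e -> \int[mu]_x jackson1s e x = bspline 0.
Proof.
move=> e0; have := Rintegral_jackson1s_cos 0 e0; rewrite mul0r => <-.
by apply: eq_Rintegral => x _; rewrite mulr0 cos0 mulr1.
Qed.

Definition jackson1_mom2 : R := \int[mu]_x (x ^+ 2 * jackson1 x).

Lemma integrable_sqr_jackson1s e : 0 < e ->
  mu.-integrable setT (EFin \o (fun x => e ^+ 2 * x ^+ 2 * jackson1s e x)) /\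
  \int[mu]_x (e ^+ 2 * x ^+ 2 * jackson1s e x) = jackson1_mom2.
Proof.
move=> e0; have i2 := integrable_x2jackson1 R.
have E x : e ^+ 2 * x ^+ 2 * jackson1s e x = e * ((e * x) ^+ 2 * jackson1 (e * x)).
  by rewrite /jackson1s exprMn mulrCA.
split.
  by apply: eq_integrable (integrableZ_R e (integrable_scale e0 i2)) => // x _ /=; rewrite E.
rewrite /jackson1_mom2 -(Rintegral_scale e0 i2); apply: eq_Rintegral => x _; exact: E.
Qed.

Definition jackson e xi : R := \prod_(i < d) jackson1s e (xi 0 i).
Definition bump e y : R := \prod_(i < d) bspline (y 0 i / e).

Lemma jackson1s_ge0 e x : 0 <= e -> 0 <= jackson1s e x.
Proof. by move=> e0; rewrite mulr_ge0// jackson1_ge0. Qed.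

Lemma jackson_ge0 e xi : 0 <= e -> 0 <= jackson e xi.
Proof. by move=> e0; apply: prodr_ge0 => i _; exact: jackson1s_ge0. Qed.

Lemma integrable_jackson e : 0 < e -> lam.-integrable setT (EFin \o jackson e).
Proof.
by move=> e0; have [] := @integrable_prod_coord R d (fun=> jackson1s e) (fun=> integrable_jackson1s e0).
Qed.

Lemma Rintegral_jackson_cos e y : 0 < e ->
  \int[lam]_xi (jackson e xi * cos (dotv xi y)) = bump e y.
Proof.
move=> e0.
by have [] := @fourier_prod_coord R d (jackson1s e) (fun u => bspline (u / e)) (integrable_jackson1s e0)
  (fun u => Rintegral_jackson1s_cos u e0) (fun u => Rintegral_jackson1s_sin u e0) y.
Qed.

Lemma Rintegral_jackson e : 0 < e -> \int[lam]_xi jackson e xi = bspline 0 ^+ d.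
Proof.
move=> e0.
have [_ ->] := @integrable_prod_coord R d (fun=> jackson1s e) (fun=> integrable_jackson1s e0).
by rewrite prodr_const card_ord Rintegral_jackson1s.
Qed.

Lemma integrable_sqr_jackson e i : 0 < e ->
  lam.-integrable setT (EFin \o (fun xi => e ^+ 2 * xi 0 i ^+ 2 * jackson e xi)) /\
  \int[lam]_xi (e ^+ 2 * xi 0 i ^+ 2 * jackson e xi) = jackson1_mom2 * bspline 0 ^+ d.-1.
Proof.
move=> e0.
pose k (j : 'I_d) (x : R) := if j == i then e ^+ 2 * x ^+ 2 * jackson1s e x else jackson1s e x.
have ik j : mu.-integrable setT (EFin \o k j).
  rewrite /k; case: eqP => _; first by have [] := integrable_sqr_jackson1s e0.
  exact: integrable_jackson1s.
have E xi : e ^+ 2 * xi 0 i ^+ 2 * jackson e xi = \prod_(j < d) k j (xi 0 j).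
  rewrite /jackson (bigD1 i)//= [RHS](bigD1 i)//= mulrA /k eqxx; congr (_ * _).
  by apply: eq_bigr => j /negbTE ->.
have [ip Ep] := integrable_prod_coord ik.
split; first by apply: eq_integrable ip => // xi _ /=; rewrite E.
under eq_Rintegral do rewrite E.
rewrite Ep (bigD1 i)//= {1}/k eqxx; have [_ ->] := integrable_sqr_jackson1s e0.
congr (_ * _).
rewrite (eq_bigr (fun=> bspline 0)); last first.
  by move=> j /negbTE ji; rewrite /k ji Rintegral_jackson1s.
rewrite prodr_const; congr (_ ^+ _).
by rewrite cardC1 card_ord.
Qed.

(** The weight 1 + e^2 |xi|^2 is dilated together with the kernel, so its integral does not depend
    on e. This is what makes the estimates against the exponent uniform in the scale. *)
Definition jackson_mom_bound : R := bspline 0 ^+ d + d%:R * (jackson1_mom2 * bspline 0 ^+ d.-1).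

Lemma integrable_jackson_mom_bound e : 0 < e ->
  lam.-integrable setT (EFin \o (fun xi => (1 + e ^+ 2 * dotv xi xi) * jackson e xi)) /\
  \int[lam]_xi ((1 + e ^+ 2 * dotv xi xi) * jackson e xi) = jackson_mom_bound.
Proof.
move=> e0.
have E xi : (1 + e ^+ 2 * dotv xi xi) * jackson e xi =
    jackson e xi + \sum_(i < d) (e ^+ 2 * xi 0 i ^+ 2 * jackson e xi).
  rewrite mulrDl mul1r /dotv mulr_sumr mulr_suml; congr (_ + _).
have is_ : lam.-integrable setT (EFin \o (fun xi => \sum_(i < d) (e ^+ 2 * xi 0 i ^+ 2 * jackson e xi))) /\
   \int[lam]_xi (\sum_(i < d) (e ^+ 2 * xi 0 i ^+ 2 * jackson e xi)) = \sum_(i < d) (jackson1_mom2 * bspline 0 ^+ d.-1).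
  elim: (index_enum _) => [|i s [IH1 IH2]].
    rewrite big_nil; split.
      apply: eq_integrable (integrable0 lam setT) => // xi _ /=; by rewrite big_nil.
    rewrite (_ : (fun=> _) = cst 0); last by apply/funext => xi; rewrite big_nil.
    by rewrite /Rintegral integral0.
  have [i1 i2] := integrable_sqr_jackson i e0.
  split.
    by apply: eq_integrable (integrableD_R i1 IH1) => // xi _ /=; rewrite big_cons.
  rewrite [RHS]big_cons -[X in _ = _ + X]IH2 -[X in _ = X + _]i2 -(RintegralD measurableT i1 IH1).
  by apply: eq_Rintegral => xi _; rewrite big_cons.
have [is1 is2] := is_.
split.
  by apply: eq_integrable (integrableD_R (integrable_jackson e0) is1) => // xi _ /=; rewrite E.
under eq_Rintegral do rewrite E.
rewrite (RintegralD measurableT (integrable_jackson e0) is1) is2 Rintegral_jackson//.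
by rewrite sumr_const card_ord /jackson_mom_bound mulr_natl.
Qed.

Lemma jackson_mom_bound_ge0 : 0 <= jackson_mom_bound.
Proof.
have [_ <-] := integrable_jackson_mom_bound (@ltr01 R).
apply: Rintegral_ge0 => xi _; rewrite mulr_ge0 ?jackson_ge0// addr_ge0// mulr_ge0 ?sqr_ge0//.
by apply: sumr_ge0 => i _; rewrite -expr2 sqr_ge0.
Qed.

Lemma bump_ge0 e y : 0 <= bump e y.
Proof. by apply: prodr_ge0 => i _; exact: bspline_ge0. Qed.

Lemma bump_le e y : bump e y <= bspline 0 ^+ d.
Proof.
rewrite -[d in leRHS]card_ord -prodr_const; apply: ler_prod => i _.
by rewrite bspline_ge0 bspline_le.
Qed.

Lemma bump_eq0 e y i : 0 < e -> 2 * e <= `|y 0 i| -> bump e y = 0.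
Proof.
move=> e0 yi; rewrite /bump (bigD1 i)//= bspline_eq0 ?mul0r//.
by rewrite normrM normfV (gtr0_norm e0) ler_pdivlMr.
Qed.

Lemma bump_ge e y : 0 < e -> (forall i, `|y 0 i| <= e) -> (bspline 0 / 4) ^+ d <= bump e y.
Proof.
move=> e0 ye; rewrite -[d in leLHS]card_ord -prodr_const; apply: ler_prod => i _.
rewrite divr_ge0 ?bspline_ge0//= bspline_ge// normrM normfV (gtr0_norm e0) ler_pdivrMr// mul1r; exact: ye.
Qed.

Lemma jackson_le e xi : 0 <= e -> jackson e xi <= (e / 4) ^+ d.
Proof.
move=> e0; rewrite -[d in leRHS]card_ord -prodr_const; apply: ler_prod => i _.
by rewrite jackson1s_ge0//= ler_wpM2l// jackson1_le4V.
Qed.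

(** Together with [jackson_le], the kernel is of order e^d for frequencies up to 1 / e and never
    larger. Zero coordinates are excluded because [jackson1] vanishes at 0. *)
Lemma jackson_ge e xi : 0 < e -> (forall i, 0 < `|xi 0 i| <= e^-1) -> (e / 16) ^+ d <= jackson e xi.
Proof.
move=> e0 xe; rewrite -[d in leLHS]card_ord -prodr_const; apply: ler_prod => i _.
have e1 : 0 <= e by exact: ltW.
rewrite divr_ge0//= ler_wpM2l//.
have /andP[x0 x1] := xe i; apply: jackson1_ge; first by rewrite mulf_neq0 ?(gt_eqF e0)// -normr_gt0.
by rewrite normrM gtr0_norm// mulrC -ler_pdivlMr// mul1r.
Qed.

Lemma measurable_bump e : measurable_fun setT (bump e).
Proof.
apply: (@measurable_prod_coord R d (fun=> fun x => bspline (x / e))) => _.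
apply: (@measurableT_comp _ _ _ _ _ _ (@bspline R)); last exact: measurable_funM.
rewrite (_ : @bspline R = (fun u : R => bspline 0 / 8 * delta4 u)); last by apply/funext => u; exact: bspline_E.
have mn (c : R) : measurable_fun setT (fun u : R => `|u + c| ^+ 3).
  apply: measurable_funX; apply: (@measurableT_comp _ _ _ _ _ _ (fun u : R => `|u|)) => //.
  exact: measurable_funD.
apply: measurable_funM => //; rewrite /delta4.
apply: measurable_funD; last exact: mn.
apply: measurable_funB; last by apply: measurable_funM.
apply: measurable_funD; last first.
  apply: measurable_funM => //.
  by rewrite (_ : (fun x => _) = (fun u : R => `|u + 0| ^+ 3))//; apply/funext => u; rewrite addr0.
by apply: measurable_funB => //; apply: measurable_funM.
Qed.

End kernel_rV.

(** * Euclidean norm and dyadic growth *)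

Section euclidean.
Variables (R : realType) (d : nat).
Implicit Types (x y z : 'rV[R]_d) (a : R).

Lemma dotvDl x y z : dotv (x + y) z = dotv x z + dotv y z.
Proof. by rewrite /dotv -big_split; apply: eq_bigr => i _; rewrite mxE mulrDl. Qed.

Lemma dotvZl a x y : dotv (a *: x) y = a * dotv x y.
Proof. by rewrite /dotv mulr_sumr; apply: eq_bigr => i _; rewrite mxE mulrA. Qed.

Lemma dotvNl x y : dotv (- x) y = - dotv x y.
Proof. by rewrite -scaleN1r dotvZl mulN1r. Qed.

Lemma dotvDr x y z : dotv x (y + z) = dotv x y + dotv x z.
Proof. by rewrite dotvC dotvDl !(dotvC _ x). Qed.

Lemma dotvZr a x y : dotv x (a *: y) = a * dotv x y.
Proof. by rewrite dotvC dotvZl dotvC. Qed.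

Lemma dotvNr x y : dotv x (- y) = - dotv x y.
Proof. by rewrite dotvC dotvNl dotvC. Qed.

Lemma dotv_ge0 x : 0 <= dotv x x.
Proof. by apply: sumr_ge0 => i _; rewrite -expr2 sqr_ge0. Qed.

Lemma enorm_ge0 x : 0 <= enorm x.
Proof. exact: sqrtr_ge0. Qed.

Lemma enorm_sqr x : enorm x ^+ 2 = dotv x x.
Proof. by rewrite sqr_sqrtr// dotv_ge0. Qed.

Lemma coord_le_enorm x i : `|x 0 i| <= enorm x.
Proof.
rewrite -(@ler_pXn2r _ 2%N)// ?nnegrE ?enorm_ge0// enorm_sqr real_normK ?num_real//.
by rewrite /dotv (bigD1 i)//= -expr2 lerDl; apply: sumr_ge0 => j _; rewrite -expr2 sqr_ge0.
Qed.

Lemma enorm_eq0 x : (enorm x == 0) = (x == 0).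
Proof.
apply/eqP/eqP => [x0|->]; last by rewrite /enorm /dotv big1 ?sqrtr0// => i _; rewrite mxE mul0r.
apply/rowP => i; rewrite mxE; apply/eqP; rewrite -normr_le0 -x0; exact: coord_le_enorm.
Qed.

Lemma enorm_gt0 x : (0 < enorm x) = (x != 0).
Proof. by rewrite lt_neqAle enorm_ge0 andbT eq_sym enorm_eq0. Qed.

Lemma dotv_CS x y : dotv x y ^+ 2 <= dotv x x * dotv y y.
Proof.
have [y0|yn0] := eqVneq y 0.
  have -> : dotv x y = 0 by rewrite y0 /dotv big1// => i _; rewrite mxE mulr0.
  by rewrite expr0n mulr_ge0// dotv_ge0.
have b0 : 0 < dotv y y by rewrite -enorm_sqr exprn_gt0// enorm_gt0.
have := dotv_ge0 (dotv y y *: x - dotv x y *: y).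
rewrite dotvDl dotvNl !dotvDr !dotvNr !dotvZl !dotvZr (dotvC y x).
set a := dotv x x; set b := dotv y y in b0 *; set c := dotv x y => H.
rewrite -(ler_pM2l b0) -subr_ge0; apply: le_trans H _.
by rewrite le_eqVlt; apply/orP; left; apply/eqP; ring.
Qed.

Lemma dotv_le x y : `|dotv x y| <= enorm x * enorm y.
Proof.
rewrite -(@ler_pXn2r _ 2%N)// ?nnegrE ?mulr_ge0 ?enorm_ge0//.
by rewrite real_normK ?num_real// exprMn !enorm_sqr dotv_CS.
Qed.

Lemma enormD x y : enorm (x + y) <= enorm x + enorm y.
Proof.
rewrite -(@ler_pXn2r _ 2%N)// ?nnegrE ?addr_ge0 ?enorm_ge0//.
rewrite sqrrD !enorm_sqr dotvDl !dotvDr (dotvC y x).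
have := le_trans (ler_norm _) (dotv_le x y).
by rewrite -mulr_natr; lra.
Qed.

Lemma enormN x : enorm (- x) = enorm x.
Proof. by rewrite /enorm dotvNl dotvNr opprK. Qed.

Lemma enormZ a x : enorm (a *: x) = `|a| * enorm x.
Proof. by rewrite /enorm dotvZl dotvZr mulrA -expr2 sqrtrM ?sqr_ge0// sqrtr_sqr. Qed.

Lemma enorm_le_sup x a : 0 <= a -> (forall i, `|x 0 i| <= a) ->
  enorm x <= Num.sqrt d%:R * a.
Proof.
move=> a0 xa; rewrite -[a in leRHS](ger0_norm a0) -sqrtr_sqr -sqrtrM//.
rewrite ler_sqrt ?mulr_ge0 ?sqr_ge0//.
rewrite -[d in leRHS]card_ord -sumr_const mulr_suml; apply: ler_sum => i _.
by rewrite mul1r -expr2 -real_normK ?num_real// ler_pXn2r ?nnegrE.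
Qed.

Lemma enorm_ge_inf x a : 0 <= a -> (forall i, a <= `|x 0 i|) ->
  Num.sqrt d%:R * a <= enorm x.
Proof.
move=> a0 xa; rewrite -[a in leLHS](ger0_norm a0) -sqrtr_sqr -sqrtrM//.
rewrite ler_sqrt ?dotv_ge0//.
rewrite -[d in leLHS]card_ord -sumr_const mulr_suml; apply: ler_sum => i _.
by rewrite mul1r -expr2 -(real_normK (num_real (x 0 i))) ler_pXn2r ?nnegrE.
Qed.

Lemma enorm_le_l1 x : enorm x <= \sum_(i < d) `|x 0 i|.
Proof.
rewrite -(@ler_pXn2r _ 2%N)// ?nnegrE ?enorm_ge0//; last by apply: sumr_ge0.
rewrite enorm_sqr expr2 mulr_suml /dotv; apply: ler_sum => i _.
rewrite -expr2 -real_normK ?num_real// expr2 ler_wpM2l//.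
by rewrite (bigD1 i)//= lerDl sumr_ge0.
Qed.

Lemma measurable_enorm : measurable_fun setT (@enorm R d).
Proof.
apply: (@measurableT_comp _ _ _ _ _ _ (@Num.sqrt R)).
  by apply: continuous_measurable_fun; exact: sqrt_continuous.
by apply: measurable_sum => i; apply: measurable_funM; exact: measurable_fun_coord.
Qed.

End euclidean.

Section growth.
Variable R : realType.
Implicit Types (p : R) (m k j : nat).

(** With c = min (1, ln 2 / p), c (j + 1) <= 1 + j ln 2 / p <= exp (j ln 2 / p); the p-th power of
    this is the claim. *)
Lemma powR_le_exp2 p : 0 < p -> exists2 C : R, 0 < C &
  forall j, j.+1%:R `^ p <= C * 2 ^+ j.
Proof.
move=> p0; have l2 : 0 < ln 2 :> R by rewrite ln_gt0// ltr1n.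
have lp : 0 < ln 2 / p by rewrite divr_gt0.
pose c : R := Num.min 1 (ln 2 / p); have c0 : 0 < c by rewrite lt_min ltr01.
exists (c `^ p)^-1; first by rewrite invr_gt0 powR_gt0.
move=> j; rewrite ler_pdivlMl ?powR_gt0//.
rewrite -powRM// ?(ltW c0)//.
have -> : 2 ^+ j = expR (j%:R * (ln 2 / p)) `^ p :> R.
  have -> : expR (j%:R * (ln 2 / p)) `^ p = expR (j%:R * ln 2).
    rewrite /powR gt_eqF ?expR_gt0// expRK; congr expR.
    by field; rewrite gt_eqF.
  by rewrite expRM_natl lnK// posrE.
rewrite ge0_ler_powR ?nnegrE ?expR_ge0 ?mulr_ge0 ?(ltW p0) ?(ltW c0)//.
apply: (le_trans _ (expR_ge1Dx _)).
rewrite -natr1 mulrDr mulr1 addrC; apply: lerD; first by rewrite ge_min lexx.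
by rewrite mulrC ler_wpM2l// ge_min lexx orbT.
Qed.

Definition logpow p k : R := k.+1%:R `^ p.
Definition rate p m : R := 4 ^+ m / logpow p m.
(** For p = beta - 1 this is (k+1)^(-beta), up to constants the second moment of the Lévy measure on
    the annulus |y| ~ 2^-k. *)
Definition zeta_term p k : R := (k.+1%:R * logpow p k)^-1.

Lemma logpowE p k : logpow p k = k.+1%:R `^ p. Proof. by []. Qed.
Lemma rateE p m : rate p m = 4 ^+ m / logpow p m. Proof. by []. Qed.

Lemma logpow_gt0 p k : 0 < logpow p k. Proof. by rewrite powR_gt0. Qed.
Lemma rate_gt0 p k : 0 < rate p k. Proof. by rewrite divr_gt0 ?logpow_gt0// exprn_gt0. Qed.
Lemma zeta_term_ge0 p k : 0 <= zeta_term p k. Proof. by rewrite invr_ge0 mulr_ge0// ltW// logpow_gt0. Qed.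

Lemma logpow_ge1 p k : 0 <= p -> 1 <= logpow p k.
Proof. by move=> p0; rewrite -(powRr0 k.+1%:R) /logpow; apply: ler_powR => //; rewrite ler1n. Qed.

Lemma rate_le4 p m : 0 <= p -> rate p m <= 4 ^+ m.
Proof. by move=> p0; rewrite ler_pdivrMr ?logpow_gt0// ler_peMr ?exprn_ge0// logpow_ge1. Qed.

Lemma rate0 p : rate p 0 = 1. Proof. by rewrite /rate /logpow expr0 powR1 divr1. Qed.

(** Since m + j + 1 <= (m + 1)(j + 1), the logarithmic factor grows at most by (j + 1)^p, hence by a
    multiple of 2^j; this costs one of the two factors 2^j in 4^j. *)
Lemma rate_growth p : 0 < p -> exists2 c : R, 0 < c &
  forall m j, c * 2 ^+ j * rate p m <= rate p (m + j).
Proof.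
move=> p0; have [C C0 HC] := powR_le_exp2 p0.
exists C^-1; first by rewrite invr_gt0.
move=> m j; rewrite /rate ler_pdivlMr ?logpow_gt0// mulrAC -mulrA.
have H : logpow p (m + j) <= logpow p m * (C * 2 ^+ j).
  apply: (@le_trans _ _ (logpow p m * logpow p j)).
    rewrite /logpow -powRM// ge0_ler_powR ?nnegrE ?(ltW p0)// -natrM ler_nat; lia.
  by rewrite ler_wpM2l ?(ltW (logpow_gt0 _ _))//; exact: HC.
apply: (@le_trans _ _ (C^-1 * 2 ^+ j * (logpow p m * (C * 2 ^+ j) * (4 ^+ m / logpow p m)))).
  by rewrite ler_wpM2l ?mulr_ge0 ?invr_ge0 ?(ltW C0) ?exprn_ge0// ler_wpM2r// ltW// rate_gt0.
have E4 : (4 : R) ^+ j = 2 ^+ j * 2 ^+ j by rewrite -exprMn; congr (_ ^+ _); lra.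
rewrite exprD E4 le_eqVlt; apply/orP; left; apply/eqP.
by field; rewrite !gt_eqF ?logpow_gt0.
Qed.

Lemma logpow_homo p k l : 0 <= p -> (k <= l)%N -> logpow p k <= logpow p l.
Proof. by move=> p0 kl; rewrite /logpow ge0_ler_powR ?nnegrE// ler_nat. Qed.

Lemma rate_double p m : 0 <= p -> rate p m.+1 <= 4 * rate p m.
Proof.
move=> p0; rewrite /rate exprS -mulrA ler_pM2l// ler_wpM2l ?exprn_ge0//.
by rewrite lef_pV2 ?posrE ?logpow_gt0// logpow_homo.
Qed.

(** A discrete form of the integral comparison: the decrement of x^(-p) over a unit step is at least
    of order p x^(-p-1). It makes the tail sums telescope. *)
Lemma zeta_term_le_diff p : 0 < p -> forall k,
  zeta_term p k <= 2 * 2 `^ p / p * ((logpow p k)^-1 - (logpow p k.+1)^-1).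
Proof.
move=> p0 k; have x0 : 0 < k.+1%:R :> R by [].
set x : R := k.+1%:R in x0 *.
have x1 : 1 <= x by rewrite ler1n.
have q0 := logpow_gt0 p k; have q0' := logpow_gt0 p k.+1.
have Ek : logpow p k.+1 = logpow p k * ((x + 1) / x) `^ p.
  rewrite /logpow -powRM ?divr_ge0 ?addr_ge0 ?(ltW x0)// -/x mulrC divfK ?gt_eqF//.
  by rewrite /x natr1.
have u0 : 0 < (x + 1) / x by rewrite divr_gt0// addr_gt0.
have lb : 1 + p / (x + 1) <= ((x + 1) / x) `^ p.
  rewrite /powR gt_eqF//; apply: le_trans _ (expR_ge1Dx _).
  rewrite lerD2l ler_wpM2l ?(ltW p0)//.
  have : ln (1 + - (x + 1)^-1) <= - (x + 1)^-1.
    by apply: le_ln1Dx; rewrite ltrN2 invf_lt1 ?addr_gt0// ltrDr.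
  have -> : 1 + - (x + 1)^-1 = ((x + 1) / x)^-1.
    by field; rewrite !gt_eqF// addr_gt0.
  by rewrite lnV ?posrE// lerN2.
have ub : ((x + 1) / x) `^ p <= 2 `^ p.
  rewrite ge0_ler_powR ?nnegrE ?(ltW p0)// ?(ltW u0)// ler_pdivrMr//; lra.
have L : logpow p k * (p / (x + 1)) <= logpow p k.+1 - logpow p k.
  by rewrite Ek -[X in _ - X]mulr1 -mulrBr ler_pM2l// lerBrDl.
have U : logpow p k.+1 <= 2 `^ p * logpow p k by rewrite Ek mulrC ler_pM2r.
have tp : 0 < 2 `^ p :> R by rewrite powR_gt0.
rewrite /zeta_term -/x.
move: (logpow p k) (logpow p k.+1) (2 `^ p) q0 q0' L U tp => q q' t q0 q0' L U t0.
have -> : q^-1 - q'^-1 = (q' - q) / (q * q') by field; rewrite !gt_eqF.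
apply: (@le_trans _ _ (2 * t / p * ((q * (p / (x + 1))) / (q * q')))); last first.
  rewrite ler_wpM2l ?divr_ge0 ?mulr_ge0 ?(ltW t0) ?(ltW p0)//.
  by rewrite ler_wpM2r// invr_ge0 mulr_ge0// ltW.
have -> : 2 * t / p * ((q * (p / (x + 1))) / (q * q')) = 2 * t / ((x + 1) * q').
  by field; rewrite !gt_eqF// addr_gt0.
rewrite ler_pdivlMr ?mulr_gt0 ?addr_gt0// mulrC ler_pdivrMr ?mulr_gt0//.
have : (x + 1) * q' <= (2 * x) * (t * q).
  apply: ler_pM => //; [by rewrite addr_ge0// ltW|exact: ltW|lra].
by rewrite (_ : 2 * x * (t * q) = 2 * t * (x * q))//; ring.
Qed.

Lemma sum_zeta_term p : 0 < p -> forall m n,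
  \sum_(m <= k < n) zeta_term p k <= 2 * 2 `^ p / p / logpow p m.
Proof.
move=> p0 m n; set C := 2 * 2 `^ p / p.
have C0 : 0 <= C by rewrite divr_ge0 ?mulr_ge0 ?powR_ge0// ltW.
have [nm|mn] := leqP n m.
  by rewrite big_geq// divr_ge0// ltW// logpow_gt0.
apply: (@le_trans _ _ (\sum_(m <= k < n) C * ((logpow p k)^-1 - (logpow p k.+1)^-1))).
  by apply: ler_sum => k _; exact: zeta_term_le_diff.
rewrite -mulr_sumr ler_wpM2l//.
under eq_bigr do rewrite -opprB.
rewrite sumrN telescope_sumr 1?ltnW// opprB lerBlDr lerDl invr_ge0.
by rewrite ltW// logpow_gt0.
Qed.

(** Below m the terms are at most [rate p k], which decays geometrically away from m; from m on, 4^m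
    factors out of a tail of order 1 / [logpow p m]. The minimum arises as the mass 4^k
    [zeta_term p k] of annulus k times the size of 1 /\ |2^m y|^2 there. *)
Lemma sum_min4_zeta_term p : 0 < p -> exists2 C : R, 0 < C & forall m n,
  \sum_(0 <= k < n) Num.min (4 ^+ k) (4 ^+ m) * zeta_term p k <= C * rate p m.
Proof.
move=> p0; have [c c0 Hc] := rate_growth p0.
pose C := 2 * 2 `^ p / p.
have C0 : 0 < C by rewrite divr_gt0// mulr_gt0// powR_gt0.
exists (2 / c + C); first by rewrite addr_gt0// divr_gt0.
move=> m n.
have H1 k : (k < m)%N -> Num.min (4 ^+ k) (4 ^+ m) * zeta_term p k <= c^-1 * 2 * (2^-1 ^+ (m - k)) * rate p m / 2.
  move=> km; apply: (@le_trans _ _ (rate p k)).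
    rewrite /rate; apply: ler_pM; first by rewrite le_min !exprn_ge0.
    - exact: zeta_term_ge0.
    - by rewrite ge_min lexx.
    rewrite lef_pV2 ?posrE ?mulr_gt0 ?logpow_gt0//.
    by rewrite ler_peMl ?ler1n// ltW// logpow_gt0.
  have := Hc k (m - k)%N; rewrite (subnKC (ltnW km)) => H.
  have -> : c^-1 * 2 * 2^-1 ^+ (m - k) * rate p m / 2 = (c * 2 ^+ (m - k))^-1 * rate p m.
    by rewrite invfM exprVn; field; rewrite !gt_eqF ?exprn_gt0.
  by rewrite ler_pdivlMl ?mulr_gt0 ?exprn_gt0.
have S1 M : (M <= m)%N -> \sum_(0 <= k < M) Num.min (4 ^+ k) (4 ^+ m) * zeta_term p k <= 2 / c * rate p m.
  move=> Mm.
  (* The bound depends on M so that the induction closes: the new term equals the old bound and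
     doubles it. *)
  have G : \sum_(0 <= k < M) (2^-1 : R) ^+ (m - k) <= 2^-1 ^+ (m - M).
    elim: M Mm => [|M IH] Mm; first by rewrite big_geq// exprn_ge0// invr_ge0.
    rewrite big_nat_recr//= (le_trans (lerD (IH (ltnW Mm)) (lexx _)))//.
    have -> : (m - M = (m - M.+1).+1)%N by lia.
    rewrite exprS; lra.
  apply: (@le_trans _ _ (\sum_(0 <= k < M) (c^-1 * rate p m) * 2^-1 ^+ (m - k))).
    rewrite big_nat_cond [leRHS]big_nat_cond; apply: ler_sum => k; rewrite andbT => /andP[_ kM].
    apply: (le_trans (H1 k _)); first exact: leq_trans kM Mm.
    by rewrite le_eqVlt; apply/orP; left; apply/eqP; field; rewrite gt_eqF.
  rewrite -mulr_sumr (_ : 2 / c * rate p m = c^-1 * rate p m * 2); last by ring.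
  apply: ler_wpM2l; first by apply: mulr_ge0; [rewrite invr_ge0 ltW|rewrite ltW// rate_gt0].
  have : (2^-1 : R) ^+ (m - M) <= 1 by rewrite exprn_ile1// ?invr_ge0// invf_le1// ler1n.
  by move: G; lra.
have S2 N : \sum_(m <= k < N) Num.min (4 ^+ k) (4 ^+ m) * zeta_term p k <= C * rate p m.
  apply: (@le_trans _ _ (\sum_(m <= k < N) 4 ^+ m * zeta_term p k)).
    by apply: ler_sum => k _; rewrite ler_wpM2r ?zeta_term_ge0// ge_min lexx orbT.
  rewrite -mulr_sumr /rate mulrCA ler_wpM2l ?exprn_ge0//.
  exact: sum_zeta_term.
rewrite mulrDl; have w0 := rate_gt0 p m.
have [nm|mn] := leqP n m.
  by rewrite (le_trans (S1 _ nm))// lerDl mulr_ge0 ?(ltW C0) ?(ltW w0).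
rewrite (big_cat_nat (leq0n m) (ltnW mn))/=.
by apply: lerD; [exact: S1|exact: S2].
Qed.

End growth.

(** * The Levy measure on dyadic annuli *)

Section boxes.
Variables (R : realType) (d : nat).
Implicit Types (a b x y : 'rV[R]_d) (r : R).

Definition box a b : set 'rV[R]_d := [set x | forall i, x 0 i \in `[a 0 i, b 0 i]].

Lemma measurable_box a b : measurable (box a b).
Proof.
rewrite [X in measurable X](_ : _ = \bigcap_(i : 'I_d)
    ((fun x : 'rV[R]_d => x 0 i) @^-1` [set` `[a 0 i, b 0 i]])).
  apply: fin_bigcap_measurable => [|i _]; first exact: finite_finset.
  by rewrite -[X in measurable X]setTI; exact: measurable_fun_coord.
by apply/seteqP; split => [x xi i _|x xi i]; [exact: xi|exact: (xi i I)].
Qed.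

Definition cube x r : set 'rV[R]_d := [set y | forall i, `|y 0 i - x 0 i| <= r].

Lemma cubeE x r : cube x r = box (x - const_mx r) (x + const_mx r).
Proof.
by apply/seteqP; split => y yx i; have := yx i;
  rewrite /= in_itv/= ler_norml !mxE => /andP[? ?]; apply/andP; split; lra.
Qed.

Lemma measurable_cube x r : measurable (cube x r).
Proof. by rewrite cubeE; exact: measurable_box. Qed.

Lemma lebesgue_cube x r : 0 <= r -> lebesgue_rV d (cube x r) = ((2 * r) ^+ d)%:E.
Proof.
move=> r0; rewrite cubeE lebesgue_rV_box; last by move=> i; rewrite !mxE; lra.
congr EFin; rewrite -[d in RHS]card_ord -prodr_const; apply: eq_bigr => i _.
by rewrite !mxE; ring.
Qed.

End boxes.

Section levy_measure.
Variables (R : realType) (d : nat) (beta : R) (nu : {measure set 'rV[R]_d -> \bar R}).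
Hypotheses (hbeta : 1 < beta) (hnu : symmetric_levy_measure nu)
  (hnu1 : comparable_density nu [set x | 0 < enorm x < 1] (levy_profile beta)).
Local Notation p := (beta - 1).
Local Notation lam := (@lebesgue_rV R d).
Local Notation D := [set x : 'rV[R]_d | 0 < enorm x < 1].
Implicit Types (xi x y : 'rV[R]_d).

Let p0 : 0 < p. Proof. by rewrite subr_gt0. Qed.
Let beta0 : 0 < beta. Proof. exact: lt_trans hbeta. Qed.

Lemma levy_profile_ge0 x : 0 <= levy_profile beta x.
Proof. by rewrite mulr_ge0 ?powR_ge0// invr_ge0 exprn_ge0// enorm_ge0. Qed.

(** The density of [nu] enters the proof only here: where the profile is bounded by a constant, [nu]
    is compared with a multiple of Lebesgue measure. *)
Lemma nu_density_bounds : exists2 cC : R * R, 0 < cC.1 /\ 0 < cC.2 &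
  forall A M, measurable A -> A `<=` D -> 0 <= M ->
  ((forall x, A x -> levy_profile beta x <= M) -> (nu A <= (cC.2 * M)%:E * lam A)%E) /\
  ((forall x, A x -> M <= levy_profile beta x) -> ((cC.1 * M)%:E * lam A <= nu A)%E).
Proof.
have [f [mf nuf [c [C [c0 C0 fb]]]]] := hnu1; exists (c, C) => // A M mA AD M0.
have mfA : measurable_fun A (fun x => (f x)%:E).
  apply/measurable_EFinP; apply: (measurable_funS _ AD mf).
  rewrite -[X in measurable X]setTI.
  rewrite (_ : D = @enorm R d @^-1` `]0, 1[%classic); last first.
    by apply/seteqP; split => x /=; rewrite in_itv.
  exact: measurable_enorm.
have f0 x : A x -> (0 <= (f x)%:E)%E.
  move=> /AD /fb /andP[h _]; rewrite lee_fin (le_trans _ h)// mulr_ge0 ?(ltW c0)//.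
  exact: levy_profile_ge0.
split => H; rewrite nuf//= -integral_cst//; apply: ge0_le_integral => //.
- move=> x Ax; rewrite lee_fin; have /andP[_ h] := fb _ (AD _ Ax).
  by rewrite (le_trans h)// ler_pM2l// H.
- by move=> x _; rewrite lee_fin mulr_ge0// ltW.
- move=> x Ax; rewrite lee_fin; have /andP[h _] := fb _ (AD _ Ax).
  by rewrite (le_trans _ h)// ler_pM2l// H.
Qed.

Definition annulus k : set 'rV[R]_d := [set y | 2^-1 ^+ k.+1 <= enorm y < 2^-1 ^+ k].

Lemma measurable_annulus k : measurable (annulus k).
Proof.
rewrite -[X in measurable X]setTI.
rewrite (_ : annulus k = @enorm R d @^-1` `[2^-1 ^+ k.+1, 2^-1 ^+ k[%classic); last first.
  by apply/seteqP; split => x /=; rewrite in_itv.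
exact: measurable_enorm.
Qed.

Lemma annulus_sub k : annulus k `<=` D.
Proof.
move=> y /andP[y1 y2]/=; rewrite (lt_le_trans _ y1) ?exprn_gt0 ?invr_gt0//=.
by rewrite (lt_le_trans y2)// exprn_ile1 ?invr_ge0// invf_le1// ler1n.
Qed.

Lemma powRN_beta k : k.+1%:R `^ (- beta) = zeta_term p k.
Proof.
rewrite /zeta_term /logpow powRN; congr (_^-1).
by rewrite -(@mulr_powRB1 _ k.+1%:R beta).
Qed.

Lemma exp2V_gt0 k : 0 < 2^-1 ^+ k :> R.
Proof. by rewrite exprn_gt0// invr_gt0. Qed.

Lemma ln2_gt0 : 0 < ln 2 :> R.
Proof. by rewrite ln_gt0// ltr1n. Qed.

Lemma ln2V k : ln (2 / 2^-1 ^+ k) = k.+1%:R * ln 2 :> R.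
Proof.
rewrite exprVn invrK -exprS lnXn// mulr_natl//.
Qed.

Lemma nu_annulus : exists2 C : R, 0 < C &
  forall k, (nu (annulus k) <= (C * (4 ^+ k * zeta_term p k))%:E)%E.
Proof.
have [[c C] [/= c0 C0] H] := nu_density_bounds.
exists (C * (2 ^+ (d + 2) * 2 ^+ d * ln 2 `^ (- beta))).
  by rewrite !mulr_gt0 ?exprn_gt0 ?powR_gt0 ?ln2_gt0.
move=> k.
(* The power of |y| is bounded at the inner radius 2^-(k+1), the logarithm at the outer radius,
   where it equals (k + 1) ln 2. *)
pose M : R := 2 ^+ (k.+1 * (d + 2)) * (ln 2 `^ (- beta) * zeta_term p k).
have M0 : 0 <= M by rewrite !mulr_ge0 ?exprn_ge0 ?powR_ge0 ?zeta_term_ge0.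
have [+ _] := H _ _ (measurable_annulus k) (@annulus_sub k) M0.
have HM x : annulus k x -> levy_profile beta x <= M.
  move=> /andP[x1 x2]; have x0 := lt_le_trans (exp2V_gt0 _) x1.
  apply: ler_pM; rewrite ?invr_ge0 ?exprn_ge0 ?powR_ge0 ?enorm_ge0//.
    have -> : 2 ^+ (k.+1 * (d + 2)) = ((2^-1 ^+ k.+1) ^+ (d + 2))^-1 :> R.
      by rewrite exprM -exprVn -exprVn invrK.
    rewrite lef_pV2 ?posrE ?exprn_gt0 ?exp2V_gt0//.
    by rewrite ler_pXn2r ?addn_gt0 ?orbT// nnegrE ltW// exp2V_gt0.
  rewrite -powRN_beta -powRM ?(ltW ln2_gt0)// !powRN.
  have e0 : 0 < ln 2 * k.+1%:R :> R by rewrite mulr_gt0 ?ln2_gt0.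
  have le : ln 2 * k.+1%:R <= ln (2 / enorm x).
    rewrite mulrC -ln2V ler_ln ?posrE ?divr_gt0 ?exp2V_gt0//.
    by rewrite ler_pM2l// lef_pV2 ?posrE ?exp2V_gt0// ltW.
  rewrite lef_pV2 ?posrE ?powR_gt0//; last exact: lt_le_trans le.
  by rewrite ge0_ler_powR ?nnegrE ?(ltW beta0) ?(ltW e0)// (le_trans (ltW e0)).
move=> /(_ HM) /le_trans; apply.
have la : (lam (annulus k) <= ((2 * 2^-1 ^+ k) ^+ d)%:E)%E.
  rewrite -(@lebesgue_cube R d 0) ?(ltW (exp2V_gt0 _))//.
  apply: le_measure; rewrite ?inE; [exact: measurable_annulus|exact: measurable_cube|].
  move=> x /andP[_ x2] i; rewrite mxE subr0 (le_trans _ (ltW x2))//.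
  exact: coord_le_enorm.
apply: (le_trans (lee_wpmul2l _ la)); first by rewrite lee_fin mulr_ge0// ltW.
rewrite -EFinM lee_fin /M le_eqVlt; apply/orP; left; apply/eqP.
have E4 : (4 : R) ^+ k = 2 ^+ k * 2 ^+ k by rewrite -exprMn; congr (_ ^+ _); lra.
rewrite E4 exprMn -exprM exprVn.
have -> : (k.+1 * (d + 2) = k * d + k + k + (d + 2))%N by lia.
rewrite !exprD; have : (2 : R) ^+ (k * d) != 0 by rewrite expf_neq0.
by move=> h; field.
Qed.

Definition far : set 'rV[R]_d := [set y | 1 <= enorm y].

Lemma measurable_far : measurable far.
Proof.
rewrite -[X in measurable X]setTI (_ : far = @enorm R d @^-1` `[1, +oo[%classic).
  exact: measurable_enorm.
by apply/seteqP; split => x /=; rewrite in_itv/= andbT.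
Qed.

Lemma nu_far : (nu far < +oo)%E.
Proof.
have [_ h _] := hnu; apply: le_lt_trans h.
have mF := measurable_far.
rewrite -[leLHS]mul1e -integral_cst//.
apply: (@le_trans _ _ (\int[nu]_(y in far) (Num.min 1 (enorm y ^+ 2))%:E)%E).
  apply: ge0_le_integral => //.
  - apply/measurable_EFinP; apply: measurable_funTS; apply: measurable_minr => //.
    by apply: measurable_funX; exact: measurable_enorm.
  - by move=> x /= x1; rewrite lee_fin le_min lexx/= expr_ge1 ?enorm_ge0.
apply: ge0_subset_integral => //.
- apply/measurable_EFinP; apply: measurable_minr => //.
  by apply: measurable_funX; exact: measurable_enorm.
- by move=> x _; rewrite lee_fin le_min ler01 sqr_ge0.
Qed.

Lemma annulus_cover y : 0 < enorm y < 1 -> exists k, annulus k y.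
Proof.
move=> /andP[y0 y1].
have ex : exists k, 2^-1 ^+ k <= enorm y.
  have [k _ /(_ k (leqnn k))] : \forall k \near \oo, (2^-1 : R) ^+ k < enorm y.
    have := @cvg_expr R 2^-1; rewrite ger0_norm ?invr_ge0// invf_lt1// ltr1n.
    by move=> /(_ isT)/cvgrPdist_lt/(_ _ y0); apply: filterS => k; rewrite sub0r normrN ger0_norm// ltW// exp2V_gt0.
  by move=> /ltW ?; exists k.
case: (ex_minnP ex) => -[|k] k1 kmin; first by move: k1; rewrite expr0 leNgt y1.
exists k; rewrite /annulus/= k1 ltNge/=; apply/negP => /kmin; rewrite ltnn//.
Qed.

(** The common majorant, up to constants, of 1 - cos (xi . y) over all frequencies of size at most
    2^m. *)
Definition trunc_sqr m y : R := Num.min 1 (4 ^+ m * dotv y y).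

Lemma trunc_sqr_ge0 m y : 0 <= trunc_sqr m y.
Proof. by rewrite le_min ler01 mulr_ge0 ?exprn_ge0 ?dotv_ge0. Qed.

Lemma measurable_trunc_sqr m : measurable_fun setT (trunc_sqr m).
Proof.
apply: measurable_minr => //; apply: measurable_funM => //.
by apply: measurable_sum => i; apply: measurable_funM; exact: measurable_fun_coord.
Qed.

(** Inside the unit ball the integral is summed over annuli. Outside only the finiteness of the mass
    is known, and this is absorbed because [rate p m] is bounded below. *)
Lemma nu_trunc_sqr : exists2 C : R, 0 < C & forall m,
  (\int[nu]_y (trunc_sqr m y)%:E <= (C * rate p m)%:E)%E.
Proof.
have [C1 C10 H1] := nu_annulus.
have [C2 C20 H2] := sum_min4_zeta_term p0.
have [c c0 Hc] := rate_growth p0.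
pose F := far; have mF := measurable_far.
have nF : nu F = (fine (nu F))%:E by rewrite fineK// ge0_fin_numE//; exact: nu_far.
have fF0 : 0 <= fine (nu F) by rewrite fine_ge0.
(* The three terms are the far mass over the lower bound c of the rate, the annuli, and 1 to keep
   the constant positive. *)
exists (fine (nu F) / c + C1 * C2 + 1); first by rewrite ltr_wpDl ?addr_ge0 ?divr_ge0 ?mulr_ge0 ?(ltW c0) ?(ltW C10) ?(ltW C20).
move=> m.
pose b k : R := Num.min 1 (4 ^+ m / 4 ^+ k).
have b0 k : 0 <= b k by rewrite le_min ler01 divr_ge0 ?exprn_ge0.
pose g y : \bar R := ((\1_F y)%:E + \sum_(0 <= k <oo) (b k)%:E * (\1_(annulus k) y)%:E)%E.
have t0 k y : (0 <= (b k)%:E * (\1_(annulus k) y)%:E)%E.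
  by rewrite mule_ge0// lee_fin.
have mt k : measurable_fun setT (fun y : 'rV[R]_d => (b k)%:E * (\1_(annulus k) y)%:E)%E.
  apply: emeasurable_funM => //; apply/measurable_EFinP.
  by apply: measurable_indic; exact: measurable_annulus.
have ms : measurable_fun setT (fun y : 'rV[R]_d => (\sum_(0 <= k <oo) (b k)%:E * (\1_(annulus k) y)%:E)%E).
  by apply: ge0_emeasurable_sum => // k y _ _.
have s0 y : (0 <= \sum_(0 <= k <oo) (b k)%:E * (\1_(annulus k) y)%:E)%E.
  by apply: nneseries_ge0 => k _ _.
have gt y : ((trunc_sqr m y)%:E <= g y)%E.
  have [yF|yF] := leP 1 (enorm y).
    rewrite /g indicE mem_set//= (@le_trans _ _ 1%E)//.
      by rewrite lee_fin ge_min lexx.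
    by rewrite leeDl.
  have [->|yn0] := eqVneq y 0.
    rewrite /trunc_sqr /dotv big1 ?mulr0; last by move=> i _; rewrite mxE mul0r.
    by rewrite min_r// adde_ge0// lee_fin.
  have [k ky] : exists k, annulus k y by apply: annulus_cover; rewrite enorm_gt0 yn0.
  apply: (@le_trans _ _ (b k)%:E).
    rewrite lee_fin le_min !ge_min lexx/=; apply/orP; right.
    rewrite -enorm_sqr ler_wpM2l ?exprn_ge0//.
    have /andP[_ ky2] := ky.
    have -> : (4 ^+ k)^-1 = (2^-1 ^+ k) ^+ 2 :> R.
      by rewrite -exprVn -exprM mulnC exprM; congr (_ ^+ _); field.
    by rewrite ler_pXn2r ?nnegrE ?enorm_ge0 ?(ltW (exp2V_gt0 _))// ltW.
  rewrite /g -[leLHS]add0e leeD ?lee_fin//.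
  apply: le_trans (nneseries_lim_ge k.+1 (fun i _ _ => t0 i y)).
  rewrite big_nat_recr//= indicE mem_set// mule1 leeDr// sume_ge0//.
apply: (@le_trans _ _ (\int[nu]_y g y)%E).
  apply: ge0_le_integral => //.
  - by move=> y _; rewrite lee_fin trunc_sqr_ge0.
  - by apply/measurable_EFinP; exact: measurable_trunc_sqr.
  - by apply: emeasurable_funD => //; apply/measurable_EFinP; exact: measurable_indic.
rewrite ge0_integralD//; last by apply/measurable_EFinP; exact: measurable_indic.
rewrite integral_indic// setIT integral_nneseries//.
have w0 := rate_gt0 p m.
have cw : c <= rate p m.
  have := Hc 0%N m; rewrite rate0 mulr1 add0n; apply: le_trans.
  by rewrite ler_peMr ?(ltW c0)// exprn_ege1// ler1n.
apply: (@le_trans _ _ ((fine (nu F) / c * rate p m)%:E + (C1 * C2 * rate p m)%:E)%E); last first.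
  by rewrite -EFinD lee_fin -mulrDl ler_pM2r// lerDl.
apply: leeD.
  rewrite nF lee_fin -mulrA ler_peMr// mulrC ler_pdivlMr// mul1r//.
apply: lime_le; first by apply: is_cvg_nneseries => k _ _; exact: integral_ge0.
apply: nearW => n.
apply: (@le_trans _ _ (\sum_(0 <= k < n) (C1 * (Num.min (4 ^+ k) (4 ^+ m) * zeta_term p k))%:E)%E).
  apply: lee_sum => k _.
  rewrite ge0_integralZl; [|by []|by apply/measurable_EFinP; apply: measurable_indic; exact: measurable_annulus|by move=> y _; rewrite lee_fin|by rewrite lee_fin].
  rewrite integral_indic//; last exact: measurable_annulus.
  have bE : (0 <= (b k)%:E)%E by rewrite lee_fin.
  rewrite setIT; apply: (le_trans (lee_wpmul2l bE (H1 k))); rewrite -EFinM lee_fin.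
  rewrite mulrCA ler_pM2l// mulrA ler_wpM2r ?zeta_term_ge0//.
  rewrite /b minr_pMl ?exprn_ge0// mul1r divfK// expf_neq0//.
by rewrite sumEFin lee_fin -mulr_sumr -mulrA ler_pM2l//; exact: H2.
Qed.

End levy_measure.

(** * Two-sided bounds for the Levy exponent *)

Section levy_exponent_bounds.
Variables (R : realType) (d : nat) (beta : R) (nu : {measure set 'rV[R]_d -> \bar R}).
Hypotheses (hd : (0 < d)%N) (hbeta : 1 < beta) (hnu : symmetric_levy_measure nu)
  (hnu1 : comparable_density nu [set x | 0 < enorm x < 1] (levy_profile beta)).
Local Notation p := (beta - 1).
Local Notation lam := (@lebesgue_rV R d).
Local Notation Phi := (levy_exponent nu).
Implicit Types (xi x y : 'rV[R]_d).

Let p0 : 0 < p. Proof. by rewrite subr_gt0. Qed.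

Lemma cosB1_trunc_sqr m xi y : 1 - cos (dotv xi y) <=
  2 * (1 + 4 ^- m * dotv xi xi) * trunc_sqr m y.
Proof.
have x0 := dotv_ge0 xi; have y0 := dotv_ge0 y.
have a0 : 0 < 4 ^+ m :> R by rewrite exprn_gt0.
have b0 : 0 < 4 ^- m :> R by rewrite invr_gt0.
have xb : 0 <= 4 ^- m * dotv xi xi by rewrite mulr_ge0 ?(ltW b0).
rewrite /trunc_sqr; case: (leP 1 (4 ^+ m * dotv y y)) => h.
  by have := cosB1_le2 (dotv xi y); lra.
apply: (le_trans (cosB1_le _)).
have := dotv_CS xi y => cs.
have -> : 2 * (1 + 4 ^- m * dotv xi xi) * (4 ^+ m * dotv y y) =
  2 * (4 ^+ m * dotv y y) + 2 * (dotv xi xi * dotv y y).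
  by field; rewrite gt_eqF.
have : 0 <= 4 ^+ m * dotv y y by rewrite mulr_ge0// ltW.
have : 0 <= dotv xi xi * dotv y y by rewrite mulr_ge0.
lra.
Qed.

Lemma measurable_cos_dotv xi : measurable_fun setT (fun y => cos (dotv xi y)).
Proof.
apply: (measurableT_comp (@measurable_cos R)).
rewrite (_ : dotv xi = fun y => dotv y xi); first exact: measurable_dotv.
by apply/funext => y; rewrite dotvC.
Qed.

Lemma integrable_trunc_sqr m : nu.-integrable setT (EFin \o @trunc_sqr R d m).
Proof.
have [C C0 H] := nu_trunc_sqr hbeta hnu hnu1.
apply: ge0_integrable; [exact: measurable_trunc_sqr|exact: trunc_sqr_ge0|].
by apply: (le_lt_trans (H m)); rewrite ltry.
Qed.

Lemma integrable_cosB1 xi : nu.-integrable setT (EFin \o (fun y => 1 - cos (dotv xi y))).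
Proof.
apply: (integrable_le _ (integrableZ_R (2 * (1 + 4 ^- 0 * dotv xi xi)) (integrable_trunc_sqr 0))).
  by apply: measurable_funB => //; exact: measurable_cos_dotv.
by move=> y; rewrite ger0_norm ?cosB1_ge0// cosB1_trunc_sqr.
Qed.

Lemma levy_exponent_ge0 xi : 0 <= Phi xi.
Proof. by apply: Rintegral_ge0 => y _; exact: cosB1_ge0. Qed.

(** The factor 1 + 4^-m |xi|^2 makes the bound at level m valid at every frequency, so that it can
    be integrated against a kernel of scale 2^-m. *)
Lemma levy_exponent_le : exists2 C : R, 0 < C & forall m xi,
  Phi xi <= C * rate p m * (1 + 4 ^- m * dotv xi xi).
Proof.
have [C C0 H] := nu_trunc_sqr hbeta hnu hnu1.
exists (2 * C); first by rewrite mulr_gt0.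
move=> m xi.
have c0 : 0 <= 1 + 4 ^- m * dotv xi xi by rewrite addr_ge0// mulr_ge0 ?dotv_ge0// invr_ge0 exprn_ge0.
apply: (@le_trans _ _ (2 * (1 + 4 ^- m * dotv xi xi) * \int[nu]_y trunc_sqr m y)).
  rewrite -RintegralZl//; last exact: integrable_trunc_sqr.
  apply: le_Rintegral => //; [exact: integrable_cosB1| |].
    by apply: integrableZ_R; exact: integrable_trunc_sqr.
  by move=> y _; exact: cosB1_trunc_sqr.
have : \int[nu]_y trunc_sqr m y <= C * rate p m.
  by rewrite -lee_fin -integrable_EFin_Rintegral ?H//; exact: integrable_trunc_sqr.
move=> /(ler_wpM2l (mulr_ge0 (ler0n R 2) c0)) /le_trans; apply.
by rewrite le_eqVlt; apply/orP; left; apply/eqP; ring.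
Qed.

Let sd : R := Num.sqrt d%:R.
Let sd0 : 0 < sd. Proof. by rewrite sqrtr_gt0 ltr0n. Qed.

Definition cone_side j : R := 2^-1 ^+ j.+1 / sd.

(** A box in the orthant of [xi]: coordinates of equal sign exclude cancellation in [dotv xi y].
    With sides from s to 3 s / 2, for s = [cone_side j], it fits inside annulus j. *)
Definition cone_box xi j : set 'rV[R]_d :=
  box (\row_i (if 0 <= xi 0 i then cone_side j else - (3 / 2 * cone_side j)))
      (\row_i (if 0 <= xi 0 i then 3 / 2 * cone_side j else - cone_side j)).

Let side0 j : 0 < cone_side j. Proof. by rewrite divr_gt0// exp2V_gt0. Qed.

Lemma cone_boxP xi j y : cone_box xi j y -> forall i,
  cone_side j <= `|y 0 i| <= 3 / 2 * cone_side j /\ xi 0 i * y 0 i = `|xi 0 i| * `|y 0 i|.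
Proof.
move=> H i; have := H i; rewrite !mxE in_itv/=; have s0 := side0 j.
case: (leP 0 (xi 0 i)) => x0 /andP[h1 h2].
  by rewrite (ger0_norm x0) ger0_norm; [rewrite h1 h2|lra].
by rewrite (ltr0_norm x0) ler0_norm ?mulrNN; [split=> //; apply/andP; split; lra|lra].
Qed.

Lemma cone_box_annulus xi j : cone_box xi j `<=` annulus j.
Proof.
move=> y /cone_boxP H; rewrite /annulus/=.
have Es : sd * cone_side j = 2^-1 ^+ j.+1 by rewrite /cone_side mulrC divfK// gt_eqF.
apply/andP; split.
  rewrite -Es; apply: enorm_ge_inf; first exact: ltW.
  by move=> i; have [/andP[]] := H i.
apply: (@le_lt_trans _ _ (sd * (3 / 2 * cone_side j))).
  apply: enorm_le_sup; first by rewrite mulr_ge0// ltW.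
  by move=> i; have [/andP[]] := H i.
rewrite mulrCA Es exprS; have := exp2V_gt0 R j; lra.
Qed.

Lemma lebesgue_cone_box xi j : lam (cone_box xi j) = ((cone_side j / 2) ^+ d)%:E.
Proof.
rewrite /cone_box lebesgue_rV_box; last first.
  by move=> i; rewrite !mxE; have := side0 j; case: ifP => _; lra.
congr EFin; rewrite -[d in RHS]card_ord -prodr_const; apply: eq_bigr => i _.
by rewrite !mxE; case: ifP => _; field.
Qed.

Lemma nu_cone_box : exists2 c : R, 0 < c & forall xi j,
  ((c * (4 ^+ j * zeta_term p j.+1))%:E <= nu (cone_box xi j))%E.
Proof.
have [[c C] [/= c0 C0] H] := nu_density_bounds hnu1.
exists (c * (ln 2 `^ (- beta) * ((4 * sd)^-1) ^+ d)).
  by rewrite !mulr_gt0 ?exprn_gt0 ?powR_gt0 ?ln2_gt0 ?invr_gt0 ?mulr_gt0.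
move=> xi j.
(* For a lower bound the radii swap roles: the power is taken at the outer radius and the logarithm
   at the inner one, where it is (j + 2) ln 2; hence the index j + 1. *)
pose M : R := 2 ^+ (j * (d + 2)) * (ln 2 `^ (- beta) * zeta_term p j.+1).
have M0 : 0 <= M by rewrite !mulr_ge0 ?exprn_ge0 ?powR_ge0 ?zeta_term_ge0.
have [_] := H _ _ (measurable_box _ _) (subset_trans (@cone_box_annulus xi j) (@annulus_sub R d j)) M0.
rewrite lebesgue_cone_box => /(_ _)/(le_trans _); apply.
  rewrite -EFinM lee_fin /M le_eqVlt; apply/orP; left; apply/eqP.
  have E4 : (4 : R) ^+ j = 2 ^+ j * 2 ^+ j by rewrite -exprMn; congr (_ ^+ _); lra.
  rewrite /cone_side E4 mulnDr exprD exprM muln2 -addnn exprD.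
  have -> : 2^-1 ^+ j.+1 / sd / 2 = (2 ^+ j)^-1 * (4 * sd)^-1.
    by rewrite exprS exprVn; field; rewrite gt_eqF// gt_eqF ?exprn_gt0.
  rewrite [in RHS]exprMn exprVn.
  have -> : (2 ^- j) ^+ d = ((2 ^+ j) ^+ d)^-1 :> R by rewrite exprVn.
  have h : ((2 : R) ^+ j) ^+ d != 0 by rewrite !expf_neq0.
  move: ((2 ^+ j) ^+ d) h (((4 * sd) ^+ d)^-1) => u h z.
  by field.
move=> x /cone_box_annulus /andP[x1 x2]; have x0 := lt_le_trans (exp2V_gt0 _ _) x1.
apply: ler_pM; rewrite ?exprn_ge0 ?mulr_ge0 ?zeta_term_ge0 ?powR_ge0 ?enorm_ge0//.
  have -> : 2 ^+ (j * (d + 2)) = ((2^-1 ^+ j) ^+ (d + 2))^-1 :> R.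
    by rewrite exprM -exprVn -exprVn invrK.
  rewrite lef_pV2 ?posrE ?exprn_gt0 ?exp2V_gt0//.
  by rewrite ler_pXn2r ?addn_gt0 ?orbT ?nnegrE ?ltW ?exp2V_gt0.
rewrite -(powRN_beta hbeta j.+1) -powRM ?(ltW (ln2_gt0 R))// !powRN.
have e0 : 0 < ln 2 * j.+2%:R :> R by rewrite mulr_gt0 ?ln2_gt0.
have le : ln (2 / enorm x) <= ln 2 * j.+2%:R.
  rewrite [leRHS]mulrC -ln2V ler_ln ?posrE ?divr_gt0 ?exp2V_gt0//.
  by rewrite ler_pM2l// lef_pV2 ?posrE ?exp2V_gt0.
have l0 : 0 < ln (2 / enorm x).
  rewrite ln_gt0// ltr_pdivlMr// mul1r (lt_trans x2)// (@le_lt_trans _ _ 1) ?ltr1n//.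
  by rewrite exprn_ile1// ?invr_ge0// invf_le1// ler1n.
have b0 : 0 <= beta by apply: ltW; exact: lt_trans hbeta.
rewrite lef_pV2 ?posrE ?powR_gt0//.
by rewrite ge0_ler_powR ?nnegrE// ltW.
Qed.

Lemma annulus_inj j k y : annulus j y -> annulus k y -> j = k.
Proof.
have H a b : annulus a y -> annulus b y -> (a <= b)%N.
  move=> /andP[_ a2] /andP[b1 _]; rewrite leqNgt; apply/negP => ba.
  have : (2^-1 : R) ^+ a <= 2^-1 ^+ b.+1.
    by rewrite ler_wiXn2l// ?invr_ge0// invf_le1// ler1n.
  by rewrite leNgt (le_lt_trans b1 a2).
by move=> jy ky; apply/eqP; rewrite eqn_leq !H.
Qed.

(** The boxes lie in disjoint annuli, so at most one term is nonzero at each y. *)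
Lemma sum_cone_indic (xi y : 'rV[R]_d) (c : nat -> R) (g : R) m n :
  0 <= g -> (forall j, (m <= j)%N -> cone_box xi j y -> c j <= g) ->
  \sum_(m <= j < n) c j * \1_(cone_box xi j) y <= g.
Proof.
move=> g0 cg; have [[j0 yj0]|none] := pselect (exists j, cone_box xi j y); last first.
  rewrite big1// => j _; rewrite indicE memNset ?mulr0// => yj.
  by apply: none; exists j.
have zero j : j != j0 -> c j * \1_(cone_box xi j) y = 0.
  move=> jj0; rewrite indicE memNset ?mulr0// => yj; move/eqP: jj0; apply.
  exact: annulus_inj (cone_box_annulus yj) (cone_box_annulus yj0).
have [jin|jnin] := boolP (j0 \in index_iota m n).
  rewrite (bigD1_seq j0)//= ?iota_uniq// big1 ?addr0// indicE mem_set// mulr1 cg//.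
  by move: jin; rewrite mem_index_iota => /andP[].
rewrite big1_seq// => j /= jin; apply: zero; apply: contra jnin => /eqP <-//.
Qed.

(** One annulus yields only order 4^k (k+1)^(-beta), short of [rate p k] by a factor k. For every j
    > k the phase xi . y is at most 1 on annulus j, so 1 - cos is quadratic there, and each of the
    next k + 2 annuli contributes that same order. *)
Lemma levy_exponent_ge : exists2 c : R, 0 < c & forall k xi,
  2 ^+ k <= enorm xi < 2 ^+ k.+1 -> c * rate p k <= Phi xi.
Proof.
have [c c0 Hc] := nu_cone_box.
exists (c / (d%:R * 16 * (2 * 4 `^ p))).
  by rewrite divr_gt0// !mulr_gt0 ?ltr0n// powR_gt0.
move=> k xi /andP[xk kx].
pose g j : R := (cone_side j * 2 ^+ k) ^+ 2 / 4.
have g0 j : 0 <= g j by rewrite divr_ge0// sqr_ge0.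
(* There are n - (k + 1) = k + 2 annuli, and n + 1 = 2 (k + 2) makes the logarithmic factor at the
   last of them comparable to the one at k. *)
pose n := (2 * k + 3)%N.
pose S y := \sum_(k.+1 <= j < n) g j * \1_(cone_box xi j) y.
have SE y : (S y)%:E = (\sum_(k.+1 <= j < n) (g j)%:E * (\1_(cone_box xi j) y)%:E)%E.
  by rewrite -sumEFin; apply: eq_bigr => j _; rewrite EFinM.
have Sle y : S y <= 1 - cos (dotv xi y).
  apply: sum_cone_indic; first exact: cosB1_ge0.
  move=> j kj yj; have H := cone_boxP yj.
  have y2 : enorm y < 2^-1 ^+ j by have /andP[] := cone_box_annulus yj.
  have d1 : `|dotv xi y| <= 1.
    apply: (le_trans (dotv_le _ _)).
    apply: (@le_trans _ _ (2 ^+ k.+1 * 2^-1 ^+ j)).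
      by rewrite ler_pM ?enorm_ge0// ltW.
    rewrite exprVn ler_pdivrMr ?exprn_gt0// mul1r.
    by rewrite ler_weXn2l// ler1n.
  have d2 : cone_side j * 2 ^+ k <= dotv xi y.
    apply: (@le_trans _ _ (cone_side j * \sum_(i < d) `|xi 0 i|)).
      by rewrite ler_pM2l// (le_trans xk)// enorm_le_l1.
    rewrite mulr_sumr; apply: ler_sum => i _; have [/andP[h _] ->] := H i.
    by rewrite mulrC ler_wpM2l.
  apply: le_trans (cosB1_ge d1).
  have ge : 0 <= cone_side j * 2 ^+ k.
    by apply: mulr_ge0; [exact: ltW|exact: exprn_ge0].
  by rewrite ler_pM2r ?invr_gt0// ler_pXn2r// nnegrE (le_trans ge d2).
have H1 : ((c / (d%:R * 16 * (2 * 4 `^ p)) * rate p k)%:E <= \int[nu]_y (S y)%:E)%E.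
  under eq_integral do rewrite SE.
  rewrite ge0_integral_sum//; last 2 first.
  - move=> j; apply: emeasurable_funM => //; apply/measurable_EFinP.
    by apply: measurable_indic; exact: measurable_box.
  - by move=> j y _; rewrite mule_ge0// lee_fin.
  apply: (@le_trans _ _ (\sum_(k.+1 <= j < n) (c / (d%:R * 16) * 4 ^+ k * zeta_term p n)%:E)%E); last first.
    rewrite big_nat_cond [leRHS]big_nat_cond; apply: lee_sum => j; rewrite andbT => /andP[kj jn].
    rewrite ge0_integralZl; [|by []|by apply/measurable_EFinP; apply: measurable_indic; exact: measurable_box|by move=> y _; rewrite lee_fin|by rewrite lee_fin].
    rewrite integral_indic//; last exact: measurable_box.
    have gE : (0 <= (g j)%:E)%E by rewrite lee_fin.
    rewrite setIT; apply: (le_trans _ (lee_wpmul2l gE (Hc xi j))); rewrite -EFinM lee_fin.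
    have -> : g j * (c * (4 ^+ j * zeta_term p j.+1)) = c / (d%:R * 16) * 4 ^+ k * zeta_term p j.+1.
      have sd2 : d%:R = sd ^+ 2 by rewrite sqr_sqrtr.
      have E4 i : (4 : R) ^+ i = (2 ^+ i) ^+ 2.
        by rewrite -exprM mulnC exprM; congr (_ ^+ _); rewrite expr2; lra.
      rewrite /g /cone_side sd2 !E4 exprVn (exprS 2 j).
      by field; rewrite !gt_eqF ?exprn_gt0.
    rewrite ler_wpM2l ?mulr_ge0 ?divr_ge0 ?exprn_ge0 ?(ltW c0)//.
    rewrite /zeta_term lef_pV2 ?posrE ?mulr_gt0 ?logpow_gt0// ler_pM ?(ltW (logpow_gt0 _ _))//.
      by rewrite ler_nat.
    by apply: logpow_homo; [exact: ltW|].
  rewrite sumEFin lee_fin big_const_nat iter_addr_0.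
  have -> : (n - k.+1 = k.+2)%N by rewrite /n; clear; lia.
  have qn : logpow p n <= 4 `^ p * logpow p k.
    rewrite /logpow -powRM// ge0_ler_powR ?nnegrE ?mulr_ge0 ?(ltW p0)//.
    by rewrite -natrM ler_nat /n; clear; lia.
  have q0 := logpow_gt0 p k; have q1 := logpow_gt0 p n.
  have t0 : 0 < 4 `^ p :> R by rewrite powR_gt0.
  have d0 : 0 < d%:R :> R by rewrite ltr0n.
  have nk : n.+1 = (2 * k.+2)%N by rewrite /n; clear; lia.
  have -> : zeta_term p n = (2 * k.+2%:R * logpow p n)^-1 by rewrite /zeta_term nk natrM.
  rewrite -[leRHS]mulr_natr.
  have -> : c / (d%:R * 16) * 4 ^+ k * (2 * k.+2%:R * logpow p n)^-1 * k.+2%:R =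
    c / (d%:R * 16) * 4 ^+ k / 2 * (logpow p n)^-1.
    have : k.+2%:R != 0 :> R by rewrite pnatr_eq0.
    by move: (k.+2%:R : R) => u u0; field; rewrite u0 !gt_eqF.
  have -> : c / (d%:R * 16 * (2 * 4 `^ p)) * rate p k =
    c / (d%:R * 16) * 4 ^+ k / 2 * (4 `^ p * logpow p k)^-1.
    by rewrite /rate; field; rewrite !gt_eqF.
  apply: ler_wpM2l.
    by rewrite !mulr_ge0 ?invr_ge0 ?mulr_ge0 ?exprn_ge0 ?(ltW c0).
  by rewrite lef_pV2 ?posrE ?mulr_gt0.
rewrite -lee_fin (le_trans H1)//.
rewrite /levy_exponent -integrable_EFin_Rintegral; last exact: integrable_cosB1.
apply: ge0_le_integral => //.
- by move=> y _; rewrite lee_fin; apply: sumr_ge0 => j _; rewrite mulr_ge0.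
- apply/measurable_EFinP; apply: measurable_sum => j.
  by apply: measurable_funM => //; apply: measurable_indic; exact: measurable_box.
- by apply/measurable_EFinP; exact: integrable_meas (integrable_cosB1 xi).
- by move=> y _; rewrite lee_fin.
Qed.

End levy_exponent_bounds.

(* The structure inference for [Measure_isSigmaFinite] fails on a variable
   measure; it succeeds on this alias. *)
Definition measure_alias d (T : measurableType d) (R : realType)
  (nu : {measure set T -> \bar R}) : set T -> \bar R := nu.

HB.instance Definition _ d (T : measurableType d) (R : realType)
  (nu : {measure set T -> \bar R}) := Measure.copy (measure_alias nu) nu.

Definition sigma_finite_pack d (T : measurableType d) (R : realType)
    (nu : {measure set T -> \bar R}) (H : sigma_finite setT nu) :
    {sigma_finite_measure set T -> \bar R} :=
  HB.pack (measure_alias nu) (Measure_isSigmaFinite.Build _ _ _ (measure_alias nu) H).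

(** * Sigma-finiteness of the Lévy measure *)

Section sigma_finite_levy.
Variables (R : realType) (d : nat) (beta : R) (nu : {measure set 'rV[R]_d -> \bar R}).
Hypotheses (hbeta : 1 < beta) (hnu : symmetric_levy_measure nu)
  (hnu1 : comparable_density nu [set x | 0 < enorm x < 1] (levy_profile beta)).

(** The origin is null and the mass outside a ball of radius 2^-k is at most the integral of
    [trunc_sqr k]. Fubini against [nu] rests on this. *)
Lemma levy_sigma_finite : sigma_finite setT nu.
Proof.
pose F k : set 'rV[R]_d := [set y | 1 <= 4 ^+ k * dotv y y].
have mF k : measurable (F k).
  rewrite -[X in measurable X]setTI (_ : F k = (fun y : 'rV[R]_d => 4 ^+ k * dotv y y) @^-1` `[1, +oo[%classic).
    have : measurable_fun setT (fun y : 'rV[R]_d => 4 ^+ k * dotv y y).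
      apply: measurable_funM => //.
      by apply: measurable_sum => i; apply: measurable_funM; exact: measurable_fun_coord.
    exact.
  by apply/seteqP; split => x /=; rewrite in_itv/= andbT.
have m0 : measurable [set 0 : 'rV[R]_d].
  rewrite [X in measurable X](_ : _ = cube (0 : 'rV[R]_d) 0); first exact: measurable_cube.
  apply/seteqP; split => [y -> i|y y0]; first by rewrite mxE subrr normr0.
  by apply/rowP => i; rewrite mxE; apply/eqP; have := y0 i; rewrite mxE subr0 normr_le0.
exists (fun k => [set 0] `|` F k).
  apply/esym; rewrite -subTset => y _.
  have [->|y0] := eqVneq y 0; first by exists 0%N => //; left.
  have d0 : 0 < dotv y y by rewrite -enorm_sqr exprn_gt0// enorm_gt0.
  have [k kd] : exists k, (dotv y y)^-1 <= 4 ^+ k.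
    exists (Num.bound (dotv y y)^-1).
    have := archi_boundP (ltW (_ : 0 < (dotv y y)^-1)); rewrite invr_gt0 => /(_ d0)/ltW/le_trans; apply.
    by rewrite -natrX ler_nat ltnW// ltn_expl.
  by exists k => //; right; rewrite /F/=; rewrite -ler_pdivrMr// div1r.
move=> k; split; first exact: measurableU.
have [n0 _ _] := hnu.
apply: le_lt_trans (measureU2 _ _ _) _ => //; rewrite [X in (X + _)%E]n0 add0e.
have [C C0 H] := nu_trunc_sqr hbeta hnu hnu1.
apply: (@le_lt_trans _ _ (C * rate (beta - 1) k)%:E); last by rewrite ltry.
apply: le_trans (H k); rewrite -[leLHS]mul1e -integral_cst//.
apply: (@le_trans _ _ (\int[nu]_(y in F k) (trunc_sqr k y)%:E)%E).
  apply: ge0_le_integral => //.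
  - by apply/measurable_EFinP; apply: measurable_funTS; exact: measurable_trunc_sqr.
  - by move=> y Fy; rewrite lee_fin le_min lexx.
apply: ge0_subset_integral => //.
- by apply/measurable_EFinP; exact: measurable_trunc_sqr.
- by move=> y _; rewrite lee_fin trunc_sqr_ge0.
Qed.

Definition levy_sf : {sigma_finite_measure set 'rV[R]_d -> \bar R} :=
  sigma_finite_pack levy_sigma_finite.

End sigma_finite_levy.

(** * The exponent against the kernel: moments and the generator *)

Section levy_fourier.
Variables (R : realType) (d : nat) (beta : R) (nu : {measure set 'rV[R]_d -> \bar R}).
Hypotheses (hbeta : 1 < beta) (hnu : symmetric_levy_measure nu)
  (hnu1 : comparable_density nu [set x | 0 < enorm x < 1] (levy_profile beta)).
Local Notation p := (beta - 1).
Local Notation lam := (@lebesgue_rV R d).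
Local Notation Phi := (levy_exponent nu).
Local Notation nus := (levy_sf hbeta hnu hnu1).
Implicit Types (xi x y v : 'rV[R]_d).

Let p0 : 0 < p. Proof. by rewrite subr_gt0. Qed.

Lemma measurable_cosB1 : measurable_fun setT (fun z : 'rV[R]_d * 'rV[R]_d => 1 - cos (dotv z.1 z.2)).
Proof.
apply: measurable_funB => //; apply: (measurableT_comp (@measurable_cos R)).
exact: measurable_dotv2.
Qed.

Lemma levy_exponentE xi : (\int[nus]_y (1 - cos (dotv xi y))%:E = (Phi xi)%:E)%E.
Proof. by apply: integrable_EFin_Rintegral; exact: (integrable_cosB1 hbeta hnu hnu1). Qed.

Lemma measurable_levy_exponent : measurable_fun setT Phi.
Proof.
apply/measurable_EFinP.
rewrite (_ : EFin \o Phi = fun xi => (\int[nus]_y (1 - cos (dotv xi y))%:E)%E); last first.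
  by apply/funext => xi; rewrite levy_exponentE.
apply: (@measurable_fun_fubini_tonelli_F _ _ _ _ _ nus (fun z : 'rV[R]_d * 'rV[R]_d => (1 - cos (dotv z.1 z.2))%:E)).
  by apply/measurable_EFinP; exact: measurable_cosB1.
by move=> z; rewrite lee_fin cosB1_ge0.
Qed.

Lemma integrable_jacksonPhi e : 0 < e ->
  lam.-integrable setT (EFin \o (fun xi => jackson e xi * Phi xi)).
Proof.
move=> e0; have [C C0 H] := levy_exponent_le hbeta hnu hnu1.
have [ik _] := @integrable_jackson_mom_bound R d e e0.
apply: (integrable_le _ (integrableZ_R (C * rate p 0 * (1 + e ^- 2)) ik)).
  apply: measurable_funM; last exact: measurable_levy_exponent.
  exact: integrable_meas (@integrable_jackson R d e e0).
move=> xi; have k0 := jackson_ge0 xi (ltW e0); have d0 := dotv_ge0 xi.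
have P0 : 0 <= Phi xi by exact: levy_exponent_ge0.
rewrite ger0_norm ?mulr_ge0// mulrC mulrA.
apply: ler_wpM2r => //; apply: (le_trans (H 0%N xi)).
rewrite expr0 invr1 mul1r -[leRHS]mulrA; apply: ler_wpM2l.
  by apply: mulr_ge0; apply: ltW => //; exact: rate_gt0.
have e2 : 0 < e ^+ 2 by rewrite exprn_gt0.
have -> : (1 + e ^- 2) * (1 + e ^+ 2 * dotv xi xi) = 1 + dotv xi xi + (e ^- 2 + e ^+ 2 * dotv xi xi).
  by field; rewrite gt_eqF.
by rewrite lerDl addr_ge0 ?invr_ge0 ?mulr_ge0// ltW.
Qed.

(** For a <= 1 and e = a 2^-m, 1 + 4^-m |xi|^2 <= a^-2 (1 + e^2 |xi|^2), and the right-hand weight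
    has kernel integral independent of e. *)
Lemma Rintegral_jacksonPhi_le : exists2 C : R, 0 < C & forall m (a : R), 0 < a <= 1 ->
  \int[lam]_xi (jackson (a * 2^-1 ^+ m) xi * Phi xi) <= C * a ^- 2 * rate p m.
Proof.
have [C C0 H] := levy_exponent_le hbeta hnu hnu1.
exists (C * (jackson_mom_bound R d + 1)).
  by rewrite mulr_gt0// ltr_wpDl// jackson_mom_bound_ge0.
move=> m a /andP[a0 a1]; have e0 : 0 < a * 2^-1 ^+ m by rewrite mulr_gt0// exp2V_gt0.
have [ik Ek] := @integrable_jackson_mom_bound R d _ e0.
have c0 : 0 <= C * a ^- 2 * rate p m.
  apply: mulr_ge0; last exact: ltW (rate_gt0 _ _).
  by rewrite mulr_ge0 ?invr_ge0 ?exprn_ge0 ?(ltW C0) ?(ltW a0).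
apply: (@le_trans _ _ (\int[lam]_xi (C * a ^- 2 * rate p m *
    ((1 + (a * 2^-1 ^+ m) ^+ 2 * dotv xi xi) * jackson (a * 2^-1 ^+ m) xi)))).
  apply: le_Rintegral => //; [exact: integrable_jacksonPhi|exact: integrableZ_R|].
  move=> xi _; rewrite mulrC mulrA ler_wpM2r ?jackson_ge0 ?(ltW e0)//.
  apply: (le_trans (H m xi)).
  have -> : C * a ^- 2 * rate p m * (1 + (a * 2^-1 ^+ m) ^+ 2 * dotv xi xi) =
    C * rate p m * (a ^- 2 + 4 ^- m * dotv xi xi).
    have -> : 4 ^- m = (2^-1 ^+ m) ^+ 2 :> R.
      by rewrite -exprVn -exprM mulnC exprM; congr (_ ^+ _); field.
    by field; rewrite gt_eqF.
  apply: ler_wpM2l; first by apply: mulr_ge0; apply: ltW => //; exact: rate_gt0.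
  rewrite lerD2r.
  by rewrite invf_ge1 ?exprn_gt0// exprn_ile1// ltW.
rewrite RintegralZl// Ek.
have -> : C * (jackson_mom_bound R d + 1) * a ^- 2 * rate p m = C * a ^- 2 * rate p m * (jackson_mom_bound R d + 1) by ring.
by rewrite ler_wpM2l// lerDl.
Qed.

(** Minus this integral is the generator applied to the bump at v, written with symmetric second
    differences. Unfolding the exponent and exchanging the integrals turns 2 cos a cos b = cos (a +
    b) + cos (a - b) into translates of the bump. *)
Lemma Rintegral_jacksonPhi_cos e v : 0 < e ->
  nu.-integrable setT (EFin \o (fun y => bump e v - 2^-1 * (bump e (v + y) + bump e (v - y)))) /\
  \int[lam]_xi (jackson e xi * Phi xi * cos (dotv xi v)) =
  \int[nu]_y (bump e v - 2^-1 * (bump e (v + y) + bump e (v - y))).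
Proof.
move=> e0.
pose f xi y : R := jackson e xi * cos (dotv xi v) * (1 - cos (dotv xi y)).
have mK := integrable_meas (@integrable_jackson R d e e0).
have mKc : measurable_fun setT (fun xi => jackson e xi * cos (dotv xi v)).
  apply: measurable_funM => //; apply: (measurableT_comp (@measurable_cos R)).
  exact: measurable_dotv.
have mf : measurable_fun setT (fun z : 'rV[R]_d * 'rV[R]_d => f z.1 z.2).
  apply: measurable_funM; last exact: measurable_cosB1.
  exact: (measurableT_comp mKc measurable_fst).
have icos y : lam.-integrable setT (EFin \o (fun xi => jackson e xi * cos (dotv xi y))).
  apply: (integrableM_bounded (@integrable_jackson R d e e0)) (fun x => cos_max _).
  by apply: (measurableT_comp (@measurable_cos R)); exact: measurable_dotv.
have fE xi y : f xi y = jackson e xi * cos (dotv xi v)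
    - 2^-1 * (jackson e xi * cos (dotv xi (v + y)) + jackson e xi * cos (dotv xi (v - y))).
  by rewrite /f !dotvDr dotvNr cosB cosD; field.
have i1 xi : nus.-integrable setT (EFin \o f xi).
  by apply: integrableZ_R; exact: (integrable_cosB1 hbeta hnu hnu1).
have i2 y : lam.-integrable setT (EFin \o f ^~ y).
  apply: eq_integrable (integrableB_R (icos v) (integrableZ_R 2^-1 (integrableD_R (icos (v + y)) (icos (v - y))))) => //.
  by move=> xi _ /=; rewrite fE.
(* Bounding the factor cos (xi . v) by 1 and integrating in y first leaves [jackson e xi * Phi xi],
   which is integrable. *)
have ip : (lam \x nus)%E.-integrable setT (EFin \o (fun z => f z.1 z.2)).
  apply/integrable12ltyP; first exact/measurable_EFinP.
  apply: (@le_lt_trans _ _ (\int[lam]_xi (jackson e xi * Phi xi)%:E)%E); last first.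
    by rewrite (integrable_EFin_Rintegral (integrable_jacksonPhi e0)) ltry.
  apply: ge0_le_integral => //.
  - by move=> xi _; apply: integral_ge0.
  - apply: (@measurable_fun_fubini_tonelli_F _ _ _ _ _ nus (fun z : 'rV[R]_d * 'rV[R]_d => `|(f z.1 z.2)%:E|%E)) => //.
    by apply: measurableT_comp => //; exact/measurable_EFinP.
  - exact: measurable_int (integrable_jacksonPhi e0).
  move=> xi _ /=.
  apply: (@le_trans _ _ (\int[nus]_y (jackson e xi * (1 - cos (dotv xi y)))%:E)%E); last first.
    have ic := integrable_cosB1 hbeta hnu hnu1 xi.
    by rewrite (integrable_EFin_Rintegral (integrableZ_R (jackson e xi) ic)) RintegralZl.
  apply: ge0_le_integral => //.
  - exact: measurable_int (integrable_norm (i1 xi)).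
  - apply/measurable_EFinP; apply: measurable_funM => //.
    exact: integrable_meas (integrable_cosB1 hbeta hnu hnu1 xi).
  move=> y _; rewrite lee_fin /f normrM (ger0_norm (cosB1_ge0 _)) ler_wpM2r ?cosB1_ge0//.
  by rewrite normrM (ger0_norm (jackson_ge0 _ (ltW e0))) ler_piMr ?jackson_ge0 ?(ltW e0)// cos_max.
have int_f y : \int[lam]_xi f xi y = bump e v - 2^-1 * (bump e (v + y) + bump e (v - y)).
  under eq_Rintegral do rewrite fE.
  rewrite (RintegralB measurableT (icos v) (integrableZ_R 2^-1 (integrableD_R (icos (v + y)) (icos (v - y))))).
  rewrite (RintegralZl _ measurableT (integrableD_R (icos (v + y)) (icos (v - y)))).
  by rewrite (RintegralD measurableT (icos (v + y)) (icos (v - y))) !Rintegral_jackson_cos.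
split.
  have mG := measurable_fubini_G ip.
  have {}mG : measurable_fun setT (EFin \o (fun y => bump e v - 2^-1 * (bump e (v + y) + bump e (v - y)))).
    apply: eq_measurable_fun mG => y _.
    by rewrite /fubini_G/= (integrable_EFin_Rintegral (i2 y)) int_f.
  apply/integrableP; split; first exact: mG.
  have mf' : measurable_fun setT (EFin \o (fun z : 'rV[R]_d * 'rV[R]_d => f z.1 z.2)).
    exact/measurable_EFinP.
  apply: le_lt_trans ((integrable21ltyP lam nus mf').1 ip).
  apply: ge0_le_integral => //.
  - by apply: measurableT_comp => //; exact: mG.
  - apply: (@measurable_fun_fubini_tonelli_G _ _ _ _ _ lam (fun z : 'rV[R]_d * 'rV[R]_d => `|(f z.1 z.2)%:E|%E)) => //.
    exact: measurableT_comp.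
  move=> y _; rewrite [X in `|X|%E](_ : _ = (\int[lam]_xi (f xi y)%:E)%E); last first.
    by rewrite (integrable_EFin_Rintegral (i2 y)) int_f.
  by apply: le_abse_integral => //; exact: measurable_int (i2 y).
have := RFubini ip i1 i2.
have -> : \int[lam]_xi \int[nus]_y f xi y = \int[lam]_xi (jackson e xi * Phi xi * cos (dotv xi v)).
  apply: eq_Rintegral => xi _; rewrite /f RintegralZl//; last exact: (integrable_cosB1 hbeta hnu hnu1).
  by rewrite mulrAC.
by move=> ->; apply: eq_Rintegral => y _; exact: int_f.
Qed.

End levy_fourier.

(** * Fourier inversion against the semigroup *)

Section semigroup.
Local Open Scope complex_scope.
Variables (R : realType) (d : nat) (beta : R) (nu : {measure set 'rV[R]_d -> \bar R}).
Hypotheses (hbeta : 1 < beta) (hnu : symmetric_levy_measure nu)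
  (hnu1 : comparable_density nu [set x | 0 < enorm x < 1] (levy_profile beta)).
Variables (P : R -> probability 'rV[R]_d R) (hP : levy_semigroup nu P).
Local Notation lam := (@lebesgue_rV R d).
Local Notation Phi := (levy_exponent nu).
Implicit Types (xi x y v : 'rV[R]_d).

Lemma char_cos t xi : 0 <= t -> \int[P t]_y cos (dotv xi y) = expR (- (t * Phi xi)).
Proof. by move=> t0; have [_ /(_ t xi t0)] := hP; rewrite /char_fun => -[]. Qed.

Lemma char_sin t xi : 0 <= t -> \int[P t]_y sin (dotv xi y) = 0.
Proof. by move=> t0; have [_ /(_ t xi t0)] := hP; rewrite /char_fun => -[]. Qed.

Lemma prob_integrable_bd t (f : 'rV[R]_d -> R) (C : R) : measurable_fun setT f ->
  (forall y, `|f y| <= C) -> (P t).-integrable setT (EFin \o f).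
Proof.
move=> mf fC; apply: measurable_bounded_integrable => //.
  by rewrite (le_lt_trans (probability_le1 _ _)) ?ltry.
by exists C; split; [exact: num_real|move=> M CM y _ /=; rewrite (le_trans (fC y))// ltW].
Qed.

(** The weight is arbitrary because two are used: [jackson e] gives the mean of the bump, and its
    product with the exponent the mean of the generator. The sine part drops out since the
    characteristic function is real. *)
Lemma fourier_swap t x (W : 'rV[R]_d -> R) : 0 <= t -> lam.-integrable setT (EFin \o W) ->
  (P t).-integrable setT (EFin \o (fun y => \int[lam]_xi (W xi * cos (dotv xi (x - y))))) /\
  \int[P t]_y \int[lam]_xi (W xi * cos (dotv xi (x - y))) =
  \int[lam]_xi (W xi * cos (dotv xi x) * expR (- (t * Phi xi))).
Proof.
move=> t0 iW; have mW := integrable_meas iW.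
pose f y xi := W xi * cos (dotv xi (x - y)).
have mc (g : 'rV[R]_d -> R) : measurable_fun setT g -> measurable_fun setT (fun y => cos (g y)).
  exact: (measurableT_comp (@measurable_cos R)).
have ms (g : 'rV[R]_d -> R) : measurable_fun setT g -> measurable_fun setT (fun y => sin (g y)).
  exact: (measurableT_comp (@measurable_sin R)).
have mdr xi : measurable_fun setT (fun y => dotv xi y).
  rewrite (_ : (fun y => dotv xi y) = fun y => dotv y xi); first exact: measurable_dotv.
  by apply/funext => y; rewrite dotvC.
have i1 y : lam.-integrable setT (EFin \o f y).
  apply: (integrableM_bounded iW) (fun x => cos_max _).
  by apply: mc; exact: measurable_dotv.
have ic xi := prob_integrable_bd t (mc _ (mdr xi)) (fun y => cos_max _).
have is_ xi := prob_integrable_bd t (ms _ (mdr xi)) (fun y => sin_max _).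
have fE y xi : f y xi = W xi * cos (dotv xi x) * cos (dotv xi y)
    + W xi * sin (dotv xi x) * sin (dotv xi y).
  by rewrite /f dotvDr dotvNr cosB; ring.
have i2 xi : (P t).-integrable setT (EFin \o f ^~ xi).
  apply: eq_integrable (integrableD_R (integrableZ_R (W xi * cos (dotv xi x)) (ic xi))
     (integrableZ_R (W xi * sin (dotv xi x)) (is_ xi))) => //.
  by move=> y _ /=; rewrite fE.
have i0 : (P t).-integrable setT (EFin \o (fun _ : 'rV[R]_d => 1 : R)).
  by apply: (@prob_integrable_bd _ _ (1)) => // y; rewrite normr1.
have ip : (P t \x lam)%E.-integrable setT (EFin \o (fun z => f z.1 z.2)).
  apply: (integrable_le _ (integrable_prodM i0 (integrable_norm iW))).
    apply: measurable_funM; first exact: (measurableT_comp mW measurable_snd).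
    apply: (measurableT_comp (@measurable_cos R)).
    rewrite (_ : (fun z : 'rV[R]_d * 'rV[R]_d => _) = (fun z => dotv z.2 x - dotv z.1 z.2)); last first.
      by apply/funext => z; rewrite dotvDr dotvNr (dotvC z.1).
    apply: measurable_funB; last exact: measurable_dotv2.
    by apply: (measurableT_comp (measurable_dotv x)); exact: measurable_snd.
  by move=> z; rewrite mul1r /f normrM ler_piMr// cos_max.
split.
  apply: eq_integrable (integrable_fubini_F ip) => // y _.
  by rewrite /fubini_F/= (integrable_EFin_Rintegral (i1 y)).
rewrite [LHS](RFubini ip i1 i2); apply: eq_Rintegral => xi _.
under eq_Rintegral do rewrite fE.
rewrite (RintegralD measurableT (integrableZ_R _ (ic xi)) (integrableZ_R _ (is_ xi))).
rewrite (RintegralZl _ measurableT (ic xi)) (RintegralZl _ measurableT (is_ xi)).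
by rewrite char_cos// char_sin// mulr0 addr0.
Qed.

Lemma Rintegral_bump t x e : 0 <= t -> 0 < e ->
  \int[P t]_y bump e (x - y) = \int[lam]_xi (jackson e xi * cos (dotv xi x) * expR (- (t * Phi xi))).
Proof.
move=> t0 e0; have [_ <-] := fourier_swap x t0 (@integrable_jackson R d e e0).
by apply: eq_Rintegral => y _; rewrite Rintegral_jackson_cos.
Qed.

Lemma measurable_bumpB e x : measurable_fun setT (fun y => bump e (x - y)).
Proof.
apply: (measurableT_comp (measurable_bump e)).
apply: measurable_fun_mx => i j.
under eq_fun do rewrite !mxE.
by apply: measurable_funB => //; exact: measurable_fun_coord.
Qed.

Lemma integrable_bumpB t e x : (P t).-integrable setT (EFin \o (fun y => bump e (x - y))).
Proof.
apply: (@prob_integrable_bd _ _ (bspline 0 ^+ d)); first exact: measurable_bumpB.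
by move=> y; rewrite ger0_norm ?bump_ge0// bump_le.
Qed.

Lemma Rintegral_bump_le t e x : 0 < e ->
  \int[P t]_y bump e (x - y) <= bspline 0 ^+ d * fine (P t (cube x (2 * e))).
Proof.
move=> e0.
have mc := measurable_cube x (2 * e).
have ii : (P t).-integrable setT (EFin \o (fun y => bspline 0 ^+ d * (\1_(cube x (2 * e)) y : R))).
  apply: integrableZ_R; apply: (@prob_integrable_bd _ _ (1)); first exact: measurable_indic.
  by move=> y; rewrite indicE; case: (_ \in _); rewrite ?normr1 ?normr0.
have -> : bspline 0 ^+ d * fine (P t (cube x (2 * e))) =
    \int[P t]_y (bspline 0 ^+ d * (\1_(cube x (2 * e)) y : R)).
  rewrite RintegralZl//; last first.
    apply: (@prob_integrable_bd _ _ (1)); first exact: measurable_indic.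
    by move=> y; rewrite indicE; case: (_ \in _); rewrite ?normr1 ?normr0.
  by rewrite /Rintegral integral_indic// setIT.
apply: le_Rintegral => //; first exact: integrable_bumpB.
move=> y _; rewrite indicE; have [yc|/negP yc] := boolP (y \in _).
  by rewrite mulr1 bump_le.
have [i yi] : exists i, 2 * e < `|y 0 i - x 0 i|.
  apply/not_existsP => H; apply: yc; rewrite inE => i.
  by rewrite leNgt; apply/negP; exact: H.
by rewrite (@bump_eq0 _ _ _ _ i)// ?mulr0// !mxE distrC ltW.
Qed.

Lemma fine_prob t A : measurable A -> (fine (P t A))%:E = P t A.
Proof. by move=> mA; rewrite fineK// fin_num_measure. Qed.

(** By exp (-u) >= 1 - u, the mean of the bump centred at 0 is at least its maximum minus t times
    the integral of [jackson e xi * Phi xi]; it is also at most the maximum times the probability of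
    the supporting cube. *)
Lemma tail_prob : exists2 C : R, 0 < C & forall t m (a : R), 0 <= t -> 0 < a <= 1 ->
  1 - fine (P t (cube 0 (2 * (a * 2^-1 ^+ m)))) <= C * a ^- 2 * (t * rate (beta - 1) m).
Proof.
have [C C0 H] := Rintegral_jacksonPhi_le hbeta hnu hnu1.
have B0 : 0 < bspline 0 ^+ d :> R by rewrite exprn_gt0// bspline0_gt0.
exists (C / bspline 0 ^+ d); first by rewrite divr_gt0.
move=> t m a t0 a01; set e := a * 2^-1 ^+ m.
have e0 : 0 < e by rewrite mulr_gt0 ?exp2V_gt0//; case/andP: a01.
have h1 := Rintegral_bump_le t 0 e0; rewrite Rintegral_bump// in h1.
have ik := @integrable_jackson R d e e0.
have iKP := integrable_jacksonPhi hbeta hnu hnu1 e0.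
have h2 : bspline 0 ^+ d - t * \int[lam]_xi (jackson e xi * Phi xi) <=
   \int[lam]_xi (jackson e xi * cos (dotv xi 0) * expR (- (t * Phi xi))).
  rewrite -(@Rintegral_jackson R d e e0) -RintegralZl// -RintegralB//; last exact: integrableZ_R.
  apply: le_Rintegral => //.
  - by apply: integrableB_R => //; exact: integrableZ_R.
  - apply: (integrable_le _ ik).
      apply: measurable_funM.
        apply: measurable_funM; first exact: integrable_meas ik.
        by apply: (measurableT_comp (@measurable_cos R)); exact: measurable_dotv.
      apply: measurableT_comp => //; apply: measurableT_comp => //.
      by apply: measurable_funM => //; exact: (measurable_levy_exponent hbeta hnu hnu1).
    move=> xi; rewrite !normrM (ger0_norm (jackson_ge0 _ (ltW e0))) -mulrA ler_piMr ?jackson_ge0 ?(ltW e0)//.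
    rewrite mulr_ile1// ?cos_max// ger0_norm ?expR_ge0// expR_le1 oppr_le0 mulr_ge0//.
    exact: levy_exponent_ge0.
  move=> xi _; rewrite [dotv xi 0](_ : _ = 0); last first.
    by rewrite /dotv big1// => i _; rewrite mxE mulr0.
  rewrite cos0 mulr1 (_ : _ - _ = jackson e xi * (1 - t * Phi xi)); last by ring.
  by rewrite ler_wpM2l ?jackson_ge0 ?(ltW e0)// (le_trans _ (expR_ge1Dx _)).
have h3 := ler_wpM2l t0 (H m a a01).
rewrite -/e in h3.
have h4 := le_trans h2 h1.
rewrite -(ler_pM2l B0) mulrBr mulr1.
have -> : bspline 0 ^+ d * (C / bspline 0 ^+ d * a ^- 2 * (t * rate (beta - 1) m)) = t * (C * a ^- 2 * rate (beta - 1) m).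
  by field; rewrite !gt_eqF//; case/andP: a01.
lra.
Qed.

Lemma measurable_addv : measurable_fun setT (fun z : 'rV[R]_d * 'rV[R]_d => z.1 + z.2).
Proof.
apply: measurable_fun_mx => i j.
under eq_fun do rewrite !mxE.
apply: measurable_funD.
  by apply: (measurableT_comp (f := fun v : 'rV[R]_d => v i j)) measurable_fst; exact: measurable_fun_coord.
by apply: (measurableT_comp (f := fun v : 'rV[R]_d => v i j)) measurable_snd; exact: measurable_fun_coord.
Qed.

Lemma semigroup_ge s t (A K : set 'rV[R]_d) (c : R) : 0 <= s -> 0 <= t -> measurable A -> measurable K ->
  0 <= c -> (forall y, K y -> (c%:E <= P t [set z | A (y + z)%R])%E) ->
  (c%:E * P s K <= P (s + t) A)%E.
Proof.
move=> s0 t0 mA mK c0 H; have [[_ Pst _] _] := hP.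
rewrite (Pst _ _ s0 t0 _ mA) -integral_cst//.
have mS : measurable [set z : 'rV[R]_d * 'rV[R]_d | A (z.1 + z.2)].
  rewrite -[X in measurable X]setTI; exact: measurable_addv.
rewrite /product_measure1/=; set S := [set z | _] in mS *.
apply: (@le_trans _ _ (\int[P s]_(y in K) (P t (xsection S y)))%E).
  apply: ge0_le_integral => //.
    by apply: measurable_funTS; exact: measurable_fun_xsection.
  move=> y Ky; apply: (le_trans (H y Ky)); rewrite le_eqVlt; apply/orP; left; apply/eqP.
  congr (P t _); apply/seteqP; split => z; first by move=> Az; apply/xsectionP.
  by move=> /xsectionP.
apply: ge0_subset_integral => //.
exact: measurable_fun_xsection.
Qed.

Variables (p : R -> 'rV[R]_d -> R) (hp : continuous_densities P p).

Lemma measurable_density t : 0 < t -> measurable_fun setT (p t).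
Proof.
move=> t0; have [cp _ _] := hp t0.
apply: (measurability _ (measurable_realfun.RGenOpens.measurableE R)).
move=> _ [_ [a [b ->]] <-].
rewrite setTI; apply: sub_sigma_algebra.
by apply: open_comp => [M _|]; [exact: cp|exact: interval_open].
Qed.

Lemma density_ge t A (c : R) : 0 < t -> measurable A -> 0 <= c ->
  (forall y, A y -> c <= p t y) -> (c%:E * lam A <= P t A)%E.
Proof.
move=> t0 mA c0 H; have [_ p0 PE] := hp t0.
rewrite PE// -integral_cst//; apply: ge0_le_integral => //.
by apply/measurable_EFinP; apply: measurable_funTS; exact: measurable_density.

Qed.

Lemma density_le t A (c : R) : 0 < t -> measurable A -> 0 <= c ->
  (forall y, A y -> p t y <= c) -> (P t A <= c%:E * lam A)%E.
Proof.
move=> t0 mA c0 H; have [_ p0 PE] := hp t0.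
rewrite PE// -integral_cst//; apply: ge0_le_integral => //.
- by move=> y _; rewrite lee_fin.
- by apply/measurable_EFinP; apply: measurable_funTS; exact: measurable_density.
Qed.

Lemma density_near t x (c : R) : 0 < t -> p t x < c ->
  exists2 r : R, 0 < r & forall y, cube x r y -> p t y <= c.
Proof.
move=> t0 pc; have [cp _ _] := hp t0.
have /nbhs_ballP[r /= r0 Hr] : nbhs x (p t @^-1` [set u | u < c]).
  by apply: cp; exact: open_nbhs_nbhs.
exists (r / 2); first by rewrite divr_gt0.
move=> y yx; apply: ltW; apply: Hr; split => // i j.
by rewrite ord1 /ball/= distrC (le_lt_trans (yx j))// gtr_pMr// invf_lt1// ltr1n.
Qed.

(** Were p t x < c, continuity would keep [p t] below the midpoint of the two on a small cube,
    against the assumed average there. Bounds on [P t] thus pass to the density. *)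
Lemma density_avg t x (c r0 : R) : 0 < t -> 0 < r0 ->
  (forall r : R, 0 < r <= r0 -> ((c * (2 * r) ^+ d)%:E <= P t (cube x r))%E) -> c <= p t x.
Proof.
move=> t0 r00 H; rewrite leNgt; apply/negP => pc.
pose c' := (p t x + c) / 2.
have [_ p0 _] := hp t0; have px0 := p0 x.
have pc' : p t x < c' by rewrite /c'; lra.
have c'c : c' < c by rewrite /c'; lra.
have [r r1 Hr] := density_near t0 pc'.
pose r2 := Num.min r r0.
have r20 : 0 < r2 by rewrite lt_min r1 r00.
have rr : 0 < r2 <= r0 by rewrite r20 ge_min lexx orbT.
have sub y : cube x r2 y -> p t y <= c'.
  move=> yx; apply: Hr => i; rewrite (le_trans (yx i))// ge_min lexx//.
have := le_trans (H _ rr) (density_le t0 (measurable_cube x r2) (_ : 0 <= c') sub).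
rewrite lebesgue_cube ?(ltW r20)// => /(_ (le_trans px0 (ltW pc'))).
rewrite -EFinM lee_fin ler_pM2r; last by rewrite exprn_gt0// mulr_gt0.
by rewrite leNgt c'c.
Qed.

(** One Chapman-Kolmogorov step: after time s in K, the remaining displacement to x falls where
    [p t] is at least c. The margin rho / 2 leaves room for the small cubes of [density_avg]. *)
Lemma density_comb s t x z0 (rho c : R) K : 0 <= s -> 0 < t -> 0 < rho -> 0 <= c ->
  measurable K -> (forall z, cube z0 rho z -> c <= p t z) ->
  (forall y, K y -> cube z0 (rho / 2) (x - y)) ->
  c * fine (P s K) <= p (s + t) x.
Proof.
move=> s0 t0 rho0 c0 mK pc KB.
apply: (@density_avg _ _ _ (rho / 2)); [by rewrite ltr_wpDl|by rewrite divr_gt0|].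
move=> r /andP[r0 rr]; have r00 := ltW r0.
rewrite mulrAC EFinM fine_prob//.
apply: semigroup_ge => //; first exact: ltW.
- exact: measurable_cube.
- by rewrite mulr_ge0// exprn_ge0// mulr_ge0.
move=> y Ky.
have -> : [set z | cube x r (y + z)] = cube (x - y) r.
  by apply/seteqP; split => z zi i; have := zi i; rewrite !mxE opprB addrCA addrA.
rewrite EFinM -(@lebesgue_cube R d (x - y))//.
apply: density_ge => //; first exact: measurable_cube.
move=> z zi; apply: pc => i.
have := zi i; have := KB y Ky i; move: ((x - y) 0 i) => u h1 h2.
by rewrite -(subrK u (z 0 i)) -addrA (le_trans (ler_normD _ _))// (le_trans (lerD h2 h1)); lra.
Qed.

End semigroup.

(** * The near-diagonal bound *)

Section near_diagonal.
Variables (R : realType) (d : nat) (beta : R) (nu : {measure set 'rV[R]_d -> \bar R}).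
Hypotheses (hd : (0 < d)%N) (hbeta : 1 < beta) (hnu : symmetric_levy_measure nu)
  (hnu1 : comparable_density nu [set x | 0 < enorm x < 1] (levy_profile beta)).
Variables (P : R -> probability 'rV[R]_d R) (hP : levy_semigroup nu P).
Variables (p : R -> 'rV[R]_d -> R) (hp : continuous_densities P p).
Local Notation lam := (@lebesgue_rV R d).
Local Notation Phi := (levy_exponent nu).
Local Notation rate := (rate (beta - 1)).
Implicit Types (xi x y v : 'rV[R]_d).

Let p0 : 0 < beta - 1. Proof. by rewrite subr_gt0. Qed.

Definition outer_annulus k : set 'rV[R]_d := [set xi | 2 ^+ k <= enorm xi < 2 ^+ k.+1].

Lemma measurable_outer_annulus k : measurable (outer_annulus k).
Proof.
rewrite -[X in measurable X]setTI.
rewrite (_ : outer_annulus k = @enorm R d @^-1` `[2 ^+ k, 2 ^+ k.+1[%classic); last first.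
  by apply/seteqP; split => x /=; rewrite in_itv.
exact: measurable_enorm.
Qed.

Lemma outer_annulus_cover m xi : 2 ^+ m <= enorm xi ->
  exists j, outer_annulus (m + j) xi.
Proof.
move=> mxi.
have ex : exists j, enorm xi < 2 ^+ (m + j).+1.
  exists (Num.bound (enorm xi)).
  apply: (lt_le_trans (archi_boundP (enorm_ge0 xi))).
  rewrite -natrX ler_nat ltnW// (leq_trans (ltn_expl _ (ltnSn 1)))//.
  by rewrite leq_exp2l// ltnW// ltnS leq_addl.
case: (ex_minnP ex) => -[|j] j1 jmin; first by exists 0%N; move: j1; rewrite /outer_annulus/= addn0 mxi.
exists j.+1; rewrite /outer_annulus/= j1 andbT leNgt; apply/negP => h.
by have := jmin j; rewrite -addnS h ltnn => /(_ isT).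
Qed.

Lemma lebesgue_outer_annulus k : (lam (outer_annulus k) <= ((4 * 2 ^+ k) ^+ d)%:E)%E.
Proof.
have -> : 4 * 2 ^+ k = 2 * 2 ^+ k.+1 :> R by rewrite exprS; ring.
rewrite -(@lebesgue_cube R d 0); last by rewrite exprn_ge0.
apply: le_measure; rewrite ?inE; [exact: measurable_outer_annulus|exact: measurable_cube|].
move=> x /andP[_ x2] i; rewrite mxE subr0 (le_trans _ (ltW x2))//.
exact: coord_le_enorm.
Qed.

Lemma expRN_le_pow (u : R) n : 0 < u -> expR (- u) <= (n.+1)`!%:R / u ^+ n.+1.
Proof.
move=> u0; rewrite expRN -[leRHS]invrK lef_pV2 ?posrE ?expR_gt0 ?invr_gt0 ?divr_gt0 ?exprn_gt0 ?ltr0n ?fact_gt0//.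
rewrite invf_div; apply: le_trans (expR_ge1Dxn n (ltW u0)).
by rewrite lerDr.
Qed.

Lemma sum_exp2V n : \sum_(0 <= j < n) (2^-1 : R) ^+ j <= 2.
Proof.
suff : \sum_(0 <= j < n) (2^-1 : R) ^+ j + 2 * 2^-1 ^+ n = 2.
  by have := exp2V_gt0 R n; lra.
elim: n => [|n IH]; first by rewrite big_geq// expr0 add0r mulr1.
by rewrite big_nat_recr//= -[RHS]IH exprS; field.
Qed.

Definition outer r : set 'rV[R]_d := [set xi | r <= enorm xi].

Lemma measurable_outer r : measurable (outer r).
Proof.
rewrite -[X in measurable X]setTI (_ : outer r = @enorm R d @^-1` `[r, +oo[%classic).
  exact: measurable_enorm.
by apply/seteqP; split => x /=; rewrite in_itv/= andbT.
Qed.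

Lemma measurable_expPhi t : measurable_fun setT (fun xi => expR (- (t * Phi xi))).
Proof.
apply: measurableT_comp => //; apply: measurableT_comp => //.
by apply: measurable_funM => //; exact: (measurable_levy_exponent hbeta hnu hnu1).
Qed.

Lemma expPhi_le1 t xi : 0 <= t -> expR (- (t * Phi xi)) <= 1.
Proof. by move=> t0; rewrite expR_le1 oppr_le0 mulr_ge0// levy_exponent_ge0. Qed.

(** At |xi| ~ 2^(m+A+j) the exponent times t is at least l 2^(A+j). Bounding exp (-u) by (d+1)! /
    u^(d+1), d powers compensate the volume of the annulus relative to 2^(md), and the last one sums
    over j and leaves 2^-A. *)
Lemma outer_tail (a : R) : 0 < a -> exists2 S : R, 0 < S & forall (t : R) m A, 0 <= t -> a <= t * rate m ->
  (\int[lam]_xi (\1_(outer (2 ^+ (m + A))) xi * expR (- (t * Phi xi)))%:E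
    <= (S * 2^-1 ^+ A * (2 ^+ m) ^+ d)%:E)%E.
Proof.
move=> a0.
have [c2 c20 H2] := levy_exponent_ge hd hbeta hnu hnu1.
have [c3 c30 H3] := rate_growth p0.
pose l := a * c2 * c3; have l0 : 0 < l by rewrite !mulr_gt0.
pose D := d.+1`!%:R / l ^+ d.+1.
have D0 : 0 < D by rewrite divr_gt0 ?exprn_gt0 ?ltr0n ?fact_gt0.
exists (4 ^+ d * D * 2).
  by apply: mulr_gt0 => //; apply: mulr_gt0 => //; exact: exprn_gt0.
move=> t m A t0 atw.
pose w j : R := expR (- (l * 2 ^+ (A + j))).
have Hexp j xi : outer_annulus (m + A + j) xi -> expR (- (t * Phi xi)) <= w j.
  move=> /H2 h; rewrite ler_expR lerN2.
  apply: (le_trans _ (ler_wpM2l t0 h)).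
  have h3 := H3 m (A + j)%N; rewrite addnA in h3.
  have u0 : 0 <= c2 * c3 * 2 ^+ (A + j) by rewrite !mulr_ge0 ?exprn_ge0// ltW.
  have -> : l * 2 ^+ (A + j) = c2 * c3 * 2 ^+ (A + j) * a by rewrite /l; ring.
  apply: (le_trans (ler_wpM2l u0 atw)).
  have -> : c2 * c3 * 2 ^+ (A + j) * (t * rate m) = t * (c2 * (c3 * 2 ^+ (A + j) * rate m)) by ring.
  by rewrite ler_wpM2l// ler_pM2l.
have w0 j : 0 <= w j by exact: expR_ge0.
have mt j : measurable_fun setT (fun xi : 'rV[R]_d => (w j)%:E * (\1_(outer_annulus (m + A + j)) xi)%:E)%E.
  apply: emeasurable_funM => //; apply/measurable_EFinP.
  by apply: measurable_indic; exact: measurable_outer_annulus.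
have t1 j xi : (0 <= (w j)%:E * (\1_(outer_annulus (m + A + j)) xi)%:E)%E.
  by rewrite mule_ge0// lee_fin.
apply: (@le_trans _ _ (\int[lam]_xi (\sum_(0 <= j <oo) (w j)%:E * (\1_(outer_annulus (m + A + j)) xi)%:E))%E).
  apply: ge0_le_integral => //.
  - apply/measurable_EFinP; apply: measurable_funM; last exact: measurable_expPhi.
    by apply: measurable_indic; exact: measurable_outer.
  - by apply: ge0_emeasurable_sum => // k y _ _.
  move=> xi _; rewrite indicE; have [|] := boolP (xi \in _); last first.
    by rewrite mul0r => _; apply: nneseries_ge0.
  rewrite inE mul1r => /outer_annulus_cover[j xj].
  apply: (@le_trans _ _ (w j)%:E); first by rewrite lee_fin Hexp.
  apply: le_trans (nneseries_lim_ge j.+1 (fun i _ _ => t1 i xi)).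
  by rewrite big_nat_recr//= indicE mem_set// mule1 leeDr// sume_ge0.
rewrite integral_nneseries//.
apply: lime_le; first by apply: is_cvg_nneseries => k _ _; exact: integral_ge0.
apply: nearW => n.
apply: (@le_trans _ _ (\sum_(0 <= j < n) (4 ^+ d * D * 2^-1 ^+ A * (2 ^+ m) ^+ d * 2^-1 ^+ j)%:E)%E); last first.
  rewrite sumEFin lee_fin -mulr_sumr.
  have -> : 4 ^+ d * D * 2 * 2^-1 ^+ A * (2 ^+ m) ^+ d = 4 ^+ d * D * 2^-1 ^+ A * (2 ^+ m) ^+ d * 2 by ring.
  rewrite ler_wpM2l ?sum_exp2V//.
  apply: mulr_ge0; last by rewrite !exprn_ge0.
  apply: mulr_ge0; last by rewrite ltW// exp2V_gt0.
  by apply: mulr_ge0; [exact: exprn_ge0|exact: ltW].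
apply: lee_sum => j _.
rewrite ge0_integralZl; [|by []|by apply/measurable_EFinP; apply: measurable_indic; exact: measurable_outer_annulus|by move=> y _; rewrite lee_fin|by rewrite lee_fin].
rewrite integral_indic//; last exact: measurable_outer_annulus.
have wE : (0 <= (w j)%:E)%E by rewrite lee_fin.
rewrite setIT; apply: (le_trans (lee_wpmul2l wE (lebesgue_outer_annulus _))).
rewrite -EFinM lee_fin.
have u0 : 0 < l * 2 ^+ (A + j) by rewrite mulr_gt0// exprn_gt0.
apply: (@le_trans _ _ (d.+1`!%:R / (l * 2 ^+ (A + j)) ^+ d.+1 * (4 * 2 ^+ (m + A + j)) ^+ d)).
  by rewrite ler_wpM2r ?exprn_ge0 ?mulr_ge0 ?exprn_ge0// expRN_le_pow.
rewrite le_eqVlt; apply/orP; left; apply/eqP.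
have -> : 4 ^+ d * D * 2^-1 ^+ A * (2 ^+ m) ^+ d * 2^-1 ^+ j =
    4 ^+ d * D * (2 ^+ m) ^+ d / 2 ^+ (A + j).
  by rewrite exprD !exprVn; field; rewrite !expf_neq0.
rewrite -addnA (exprD 2 m); set u := 2 ^+ (A + j) in u0 *; set v := 2 ^+ m.
have un : u != 0 by rewrite expf_neq0.
have ud : u ^+ d != 0 by rewrite expf_neq0.
have ln0 : l ^+ d.+1 != 0 by rewrite expf_neq0// gt_eqF.
rewrite /D (exprMn d.+1 l u) (exprMn d 4) (exprMn d v) (exprSr u); move: (u ^+ d) (l ^+ d.+1) ud ln0 => ud ld ud0 ld0.
by field; rewrite un ud0 ld0.
Qed.

(** The cube of radius r = 2 e shrinks while m is fixed. For e <= 2^-m the kernel is of order e^d on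
    the frequencies that matter and at most (e/4)^d elsewhere, so e^d factors out of main term and
    tail alike. *)
Lemma near_diagonal (a b : R) : 0 < a -> 0 < b -> exists2 cc : R * R, 0 < cc.1 /\ 0 < cc.2 &
  forall (t : R) m x, 0 < t -> a <= t * rate m <= b -> (forall i, `|x 0 i| <= cc.2 * 2^-1 ^+ m) ->
  cc.1 * (2 ^+ m) ^+ d <= p t x.
Proof.
move=> a0 b0.
have [S S0 HS] := outer_tail a0.
have [C C0 HC] := levy_exponent_le hbeta hnu hnu1.
(* The factors come from the box Q below: the kernel bound (e/16)^d times the volume (2^m/2)^d, the
   cosine bound 1/2, and the exponent bound with |xi|^2 <= d 4^m and t rate m <= b. *)
pose c1 : R := (32^-1) ^+ d * 2^-1 * expR (- (b * C * (1 + d%:R))).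
have c10 : 0 < c1 by rewrite !mulr_gt0 ?expR_gt0 ?exprn_gt0 ?invr_gt0.
pose sd : R := Num.sqrt d%:R.
have sd0 : 0 < sd by rewrite sqrtr_gt0 ltr0n.
(* The first condition places Q inside |xi| < 2^(m+A); the second makes the tail at most half of the
   main term. *)
have [A HA1 HA2] : exists2 A, sd < 2 ^+ A & S * 2^-1 ^+ A <= c1 / 2.
  exists (Num.bound (sd + 2 * S / c1)).
    apply: (@lt_trans _ _ (Num.bound (sd + 2 * S / c1))%:R).
      apply: le_lt_trans (archi_boundP _); first by rewrite lerDl divr_ge0 ?mulr_ge0 ?(ltW S0) ?(ltW c10).
      by rewrite addr_ge0 ?(ltW sd0)// divr_ge0 ?mulr_ge0 ?(ltW S0) ?(ltW c10).
    by rewrite -natrX ltr_nat ltn_expl.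
  set N := Num.bound _.
  have h : 2 * S / c1 <= 2 ^+ N.
    apply: (@le_trans _ _ N%:R); last by rewrite -natrX ler_nat ltnW// ltn_expl.
    apply: ltW; apply: le_lt_trans (archi_boundP _); first by rewrite lerDr ltW.
    by rewrite addr_ge0 ?(ltW sd0)// divr_ge0 ?mulr_ge0 ?(ltW S0) ?(ltW c10).
  rewrite exprVn ler_pdivrMr ?exprn_gt0//.
  by move: h; rewrite ler_pdivrMr//; lra.
pose B0 : R := bspline 0 ^+ d; have B00 : 0 < B0 by rewrite exprn_gt0// bspline0_gt0.
(* B0 is the maximum of the bump and (4 e)^d the volume of the cube. The second constant ensures |xi
   . x| <= 1 for |xi| < 2^(m+A). *)
exists (c1 / 2 / B0 / 4 ^+ d, (2 ^+ A * sd)^-1).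
  split; rewrite /=.
    by apply: divr_gt0; [apply: divr_gt0 => //; apply: divr_gt0|exact: exprn_gt0].
  by rewrite invr_gt0; apply: mulr_gt0 => //; exact: exprn_gt0.
move=> t m x t0 /andP[atw twb] xm /=.
have t00 := ltW t0.
have r00 : 0 < 2 * 2^-1 ^+ m :> R by rewrite mulr_gt0// exp2V_gt0.
apply: (density_avg hp t0 r00).
move=> r /andP[r0 rr].
pose e := r / 2; have e0 : 0 < e by rewrite divr_gt0.
have re : r = 2 * e by rewrite /e mulrC divfK.
have em : e <= 2^-1 ^+ m by rewrite /e ler_pdivrMr// mulrC.
have h1 := @Rintegral_bump_le _ _ P t e x e0.
rewrite (Rintegral_bump hP) // in h1.
(* All coordinates are positive on Q, as [jackson_ge] excludes zeros. *)
pose Q : set 'rV[R]_d := box (const_mx (2 ^+ m / 2)) (const_mx (2 ^+ m)).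
have mQ : measurable Q by exact: measurable_box.
have lQ : lam Q = ((2 ^+ m / 2) ^+ d)%:E.
  rewrite /Q /box lebesgue_rV_box; last by move=> i; rewrite !mxE; have : 0 < 2 ^+ m :> R := exprn_gt0 _ (ltr0n _ 2); lra.
  congr EFin; rewrite -[d in RHS]card_ord -prodr_const; apply: eq_bigr => i _.
  by rewrite !mxE; field.
pose I xi := jackson e xi * cos (dotv xi x) * expR (- (t * Phi xi)).
pose T xi := (\1_(outer (2 ^+ (m + A))) xi * expR (- (t * Phi xi)) : R).
have ik := @integrable_jackson R d e e0.
have iI : lam.-integrable setT (EFin \o I).
  apply: (integrable_le _ ik).
    apply: measurable_funM; last exact: measurable_expPhi.
    apply: measurable_funM; first exact: integrable_meas ik.
    by apply: (measurableT_comp (@measurable_cos R)); exact: measurable_dotv.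
  move=> xi; rewrite !normrM (ger0_norm (jackson_ge0 _ (ltW e0))) -mulrA ler_piMr ?jackson_ge0 ?(ltW e0)//.
  by rewrite mulr_ile1// ?cos_max// ger0_norm ?expR_ge0// expPhi_le1.
have iT : lam.-integrable setT (EFin \o T).
  apply: ge0_integrable.
  - apply: measurable_funM; last exact: measurable_expPhi.
    by apply: measurable_indic; exact: measurable_outer.
  - by move=> xi; rewrite mulr_ge0 ?expR_ge0.
  - by apply: (le_lt_trans (HS t m A t00 atw)); rewrite ltry.
have iQ1 : (\int[lam]_xi (\1_Q xi)%:E = lam Q)%E by rewrite integral_indic// setIT.
have iQ : lam.-integrable setT (EFin \o (fun xi => \1_Q xi : R)).
  apply: ge0_integrable => //; first exact: measurable_indic.
  by rewrite iQ1 lQ ltry.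
pose g : R := (e / 16) ^+ d * (2^-1 * expR (- (b * C * (1 + d%:R)))).
(* Beyond 2^(m+A) the cosine is only known to be >= -1, and T compensates; below, the cosine is at
   least 1/2, so I is nonnegative, and on Q it is at least g. *)
have pw xi : g * \1_Q xi <= I xi + (e / 4) ^+ d * T xi.
  have k0 := jackson_ge0 xi (ltW e0); have ex0 := expR_ge0 (- (t * Phi xi)).
  have [xo|xo] := leP (2 ^+ (m + A)) (enorm xi).
    have -> : \1_Q xi = 0 :> R.
      rewrite indicE memNset// => xQ.
      have : enorm xi <= sd * 2 ^+ m.
        apply: enorm_le_sup; first by rewrite exprn_ge0.
        move=> i; have := xQ i; rewrite !mxE in_itv/= => /andP[q1 q2].
        by rewrite ger0_norm//; apply: le_trans q1; rewrite divr_ge0// exprn_ge0.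
      rewrite leNgt => /negP; apply; apply: lt_le_trans xo.
      by rewrite exprD mulrC ltr_pM2l// exprn_gt0.
    rewrite mulr0 /T indicE mem_set// mul1r /I.
    have k4 := jackson_le xi (ltW e0).
    have cN : -1 <= cos (dotv xi x) by exact: cos_geN1.
    rewrite -mulrDl mulr_ge0//.
    have : - jackson e xi <= jackson e xi * cos (dotv xi x) by rewrite -mulrN1 ler_wpM2l.
    by lra.
  have T0 : 0 <= (e / 4) ^+ d * T xi.
    apply: mulr_ge0; first by rewrite exprn_ge0// divr_ge0// ltW.
    by apply: mulr_ge0 => //; rewrite indicE.
  have cx : 2^-1 <= cos (dotv xi x).
    have d1 : `|dotv xi x| <= 1.
      apply: (le_trans (dotv_le _ _)).
      have exm : enorm x <= sd * ((2 ^+ A * sd)^-1 * 2^-1 ^+ m).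
        by apply: enorm_le_sup => //; rewrite mulr_ge0 ?invr_ge0 ?mulr_ge0 ?exprn_ge0 ?(ltW sd0)// ltW// exp2V_gt0.
      apply: (@le_trans _ _ (2 ^+ (m + A) * (sd * ((2 ^+ A * sd)^-1 * 2^-1 ^+ m)))).
        by rewrite ler_pM ?enorm_ge0// ltW.
      rewrite exprD exprVn le_eqVlt; apply/orP; left; apply/eqP.
      by field; rewrite !gt_eqF ?exprn_gt0.
    have := cosB1_le (dotv xi x).
    have : dotv xi x ^+ 2 <= 1 by rewrite -real_normK ?num_real// expr_le1.
    by lra.
  have I0 : 0 <= I xi by rewrite !mulr_ge0//; apply: le_trans cx; rewrite invr_ge0.
  rewrite indicE; have [|_] := boolP (xi \in _); last by rewrite mulr0 addr_ge0.
  rewrite inE mulr1 => xQ; apply: (@le_trans _ _ (I xi)); last by rewrite lerDl.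
  have xi1 i : 0 < `|xi 0 i| <= 2 ^+ m.
    have := xQ i; rewrite !mxE in_itv/= => /andP[q1 q2].
    have q0 : 0 < xi 0 i by apply: lt_le_trans q1; rewrite divr_gt0// exprn_gt0.
    by rewrite gtr0_norm// q0.
  rewrite /I -[jackson e xi * _ * _]mulrA; apply: ler_pM.
  - by rewrite exprn_ge0// divr_ge0// ltW.
  - by rewrite mulr_ge0 ?invr_ge0 ?expR_ge0.
  - apply: jackson_ge => // i; have /andP[-> h] /= := xi1 i.
    apply: (le_trans h); rewrite -[leLHS]invrK lef_pV2 ?posrE ?invr_gt0 ?exprn_gt0//.
    by rewrite -exprVn.
  - apply: ler_pM; rewrite ?invr_ge0 ?expR_ge0//.
    rewrite ler_expR lerN2.
    apply: (le_trans (ler_wpM2l t00 (HC m xi))).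
    have dx : 4 ^- m * dotv xi xi <= d%:R.
      rewrite mulrC ler_pdivrMr ?exprn_gt0// -enorm_sqr.
      have -> : d%:R * 4 ^+ m = (sd * 2 ^+ m) ^+ 2 :> R.
        rewrite exprMn sqr_sqrtr// -exprM mulnC exprM; congr (_ * _ ^+ _).
        by rewrite expr2; lra.
      rewrite ler_pXn2r ?nnegrE ?enorm_ge0 ?mulr_ge0 ?exprn_ge0 ?(ltW sd0)//.
      by apply: enorm_le_sup; rewrite ?exprn_ge0// => i; have /andP[] := xi1 i.
    have -> : t * (C * rate m * (1 + 4 ^- m * dotv xi xi)) = (t * rate m) * C * (1 + 4 ^- m * dotv xi xi) by ring.
    apply: ler_pM; last by rewrite lerD2l.
    - by rewrite mulr_ge0 ?(ltW C0)// (le_trans (ltW a0)).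
    - by rewrite addr_ge0// mulr_ge0 ?dotv_ge0// invr_ge0 exprn_ge0.
    - by rewrite ler_wpM2r// ltW.
have h2 : g * (2 ^+ m / 2) ^+ d <= \int[lam]_xi I xi + (e / 4) ^+ d * (S * 2^-1 ^+ A * (2 ^+ m) ^+ d).
  have -> : g * (2 ^+ m / 2) ^+ d = \int[lam]_xi (g * (\1_Q xi : R)).
    by rewrite RintegralZl// /Rintegral iQ1 lQ.
  apply: (@le_trans _ _ (\int[lam]_xi (I xi + (e / 4) ^+ d * T xi))).
    apply: le_Rintegral => //; first exact: integrableZ_R.
      by apply: integrableD_R => //; exact: integrableZ_R.
  rewrite (RintegralD measurableT iI (integrableZ_R _ iT)) RintegralZl// lerD2l.
  rewrite ler_wpM2l//; first by rewrite exprn_ge0// divr_ge0// ltW.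
  by rewrite -lee_fin -(integrable_EFin_Rintegral iT) HS.
have mc := measurable_cube x r.
rewrite -(fine_prob P t mc) lee_fin -(ler_pM2l B00) re.
apply: le_trans h1; rewrite -/(\int[lam]_xi I xi) in h2 *.
set J := \int[lam]_xi I xi in h2 *.
have e4 : (e / 4) ^+ d <= e ^+ d.
  by apply: lerXn2r; rewrite ?nnegrE; lra.
have m0 : 0 < (2 ^+ m) ^+ d :> R by rewrite !exprn_gt0.
have h3 : (e / 4) ^+ d * (S * 2^-1 ^+ A * (2 ^+ m) ^+ d) <= e ^+ d * (c1 / 2 * (2 ^+ m) ^+ d).
  apply: ler_pM => //; last by rewrite ler_pM2r.
    by rewrite exprn_ge0// divr_ge0// ltW.
  apply: mulr_ge0; last exact: ltW.
  by apply: mulr_ge0; [exact: ltW|rewrite ltW// exp2V_gt0].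
have gE : g * (2 ^+ m / 2) ^+ d = e ^+ d * (c1 * (2 ^+ m) ^+ d).
  rewrite /g /c1 !exprMn !exprVn.
  have -> : (32 : R) ^+ d = 16 ^+ d * 2 ^+ d by rewrite -exprMn; congr (_ ^+ _); lra.
  by field; rewrite !expf_neq0.
have -> : B0 * (c1 / 2 / B0 / 4 ^+ d * (2 ^+ m) ^+ d * (2 * (2 * e)) ^+ d) =
    e ^+ d * (c1 / 2 * (2 ^+ m) ^+ d).
  have -> : 2 * (2 * e) = 4 * e by ring.
  have F (B c f y M : R) : B != 0 -> f != 0 -> B * (c / 2 / B / f * M * (f * y)) = y * (c / 2 * M).
    by move=> B1 f0; field; rewrite B1 f0.
  by rewrite exprMn F// ?gt_eqF// exprn_gt0.
rewrite gE in h2.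
have -> : e ^+ d * (c1 / 2 * (2 ^+ m) ^+ d) = e ^+ d * (c1 * (2 ^+ m) ^+ d) - e ^+ d * (c1 / 2 * (2 ^+ m) ^+ d) by field.
lra.
Qed.

End near_diagonal.

(** * Chaining *)

Section chaining.
Variables (R : realType) (d : nat) (beta : R) (nu : {measure set 'rV[R]_d -> \bar R}).
Hypotheses (hd : (0 < d)%N) (hbeta : 1 < beta) (hnu : symmetric_levy_measure nu)
  (hnu1 : comparable_density nu [set x | 0 < enorm x < 1] (levy_profile beta)).
Variables (P : R -> probability 'rV[R]_d R) (hP : levy_semigroup nu P).
Variables (p : R -> 'rV[R]_d -> R) (hp : continuous_densities P p).
Local Notation lam := (@lebesgue_rV R d).
Local Notation rate := (rate (beta - 1)).
Local Notation logpow := (logpow (beta - 1)).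
Implicit Types (xi x y v : 'rV[R]_d).

Let p0 : 0 < beta - 1. Proof. by rewrite subr_gt0. Qed.

(** From a point within r of k x, the displacement to (k + 1) x is within r of x. Assuming the step
    bound for all such u keeps the errors from accumulating. *)
Lemma cube_chain (tau q r : R) x : 0 <= tau -> 0 <= q -> 0 <= r ->
  (forall u, cube x r u -> (q%:E <= P tau (cube u r))%E) ->
  forall k, q ^+ k <= fine (P (k%:R * tau) (cube (k%:R *: x) r)).
Proof.
move=> tau0 q0 r0 H; elim=> [|k IH].
  have [[P0 _ _] _] := hP.
  rewrite mul0r scale0r P0; last exact: measurable_cube.
  by rewrite diracE mem_set// => i; rewrite subrr normr0.
have mk n := measurable_cube (n%:R *: x) r.
rewrite -lee_fin fine_prob// -natr1 mulrDl mul1r exprSr mulrC EFinM.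
apply: (@le_trans _ _ (q%:E * P (k%:R * tau) (cube (k%:R *: x) r))%E).
  have qE : (0 <= q%:E)%E by rewrite lee_fin.
  by apply: lee_wpmul2l => //; rewrite -fine_prob// lee_fin.
rewrite natr1.
apply: (semigroup_ge hP) => //; first by rewrite mulr_ge0.
move=> y yk; apply: (le_trans (H (k.+1%:R *: x - y) _)).
  move=> i; have := yk i; rewrite !mxE -natr1 => h.
  by rewrite distrC (_ : _ - _ = y 0 i - k%:R * x 0 i)//; ring.
rewrite le_eqVlt; apply/orP; left; apply/eqP; congr (P tau _).
apply/seteqP; split => z zi i; have := zi i; rewrite !mxE opprB addrCA addrA//.
Qed.

(** Lets J be chosen against a constant that itself depends on J, as the loss in [rate_lower]
    does. *)
Lemma powR_absorb (K : R) : 0 < K -> exists J, K * (J.+2%:R `^ (beta - 1)) <= 2 ^+ J.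
Proof.
move=> K0; have [C C0 HC] := powR_le_exp2 p0.
have q2 : 0 < 2 `^ (beta - 1) :> R by rewrite powR_gt0.
have [i Mi] : exists i, K * 2 `^ (beta - 1) * C <= 2 ^+ i.
  have M0 : 0 <= K * 2 `^ (beta - 1) * C by rewrite !mulr_ge0// ltW.
  move: (_ * C) M0 => M M0.
  exists (Num.bound M); have := archi_boundP M0; move: (Num.bound M) => n Mn.
  by apply: (le_trans (ltW Mn)); rewrite -natrX ler_nat ltnW// ltn_expl.
(* With J = 2 i, J + 2 = 2 (i + 1): one factor 2^i absorbs the constants and the other the power of
   i + 1. *)
exists (i + i)%N.
have -> : (i + i).+2%:R = 2 * i.+1%:R :> R by rewrite -natrM; congr _%:R; lia.
rewrite powRM// exprD mulrA.
have h1 := ler_wpM2l (ltW (mulr_gt0 K0 q2)) (HC i); apply: (le_trans h1).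
by rewrite mulrA ler_wpM2r// exprn_ge0.
Qed.

Lemma rate_exp4 m j : rate (m + j) <= 4 ^+ j * rate m.
Proof.
elim: j => [|j IH]; first by rewrite addn0 mul1r.
rewrite addnS (le_trans (rate_double _ (ltW p0)))// exprS -mulrA ler_pM2l//.
Qed.

(** In this range m + j + 1 <= (J + 2)(m + 1), so the logarithmic factor loses only a constant and
    the rate grows like the full 4^j. *)
Lemma rate_lower J m j : (j <= m + J)%N -> 4 ^+ j * rate m <= J.+2%:R `^ (beta - 1) * rate (m + j).
Proof.
move=> jm.
have h : logpow (m + j) <= J.+2%:R `^ (beta - 1) * logpow m.
  rewrite /logpow -powRM// ge0_ler_powR ?nnegrE ?(ltW p0)// -natrM ler_nat; clear -jm; nia.

have -> : 4 ^+ j * rate m = 4 ^+ (m + j) / logpow m by rewrite !rateE exprD; ring.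
have -> : J.+2%:R `^ (beta - 1) * rate (m + j) =
    4 ^+ (m + j) * (J.+2%:R `^ (beta - 1) / logpow (m + j)) by rewrite !rateE; ring.
rewrite ler_wpM2l ?exprn_ge0// ler_pdivlMr ?logpow_gt0// mulrC ler_pdivrMr ?logpow_gt0//.
Qed.

(** About t [rate (m + j)] ~ 4^j steps of length 2^-(m+j) cover a distance 2^(j-m). The least j for
    which this reaches |x| gives 4^j of order at most 1 + 4^m |x|^2, and each step costs a factor
    q. *)
Lemma chaining : exists2 cc : R * R, 0 < cc.1 /\ 0 < cc.2 &
  forall (t : R) m x, 1 <= t * rate m <= 4 -> enorm x < 1 ->
  cc.1 * (2 ^+ m) ^+ d * expR (- (cc.2 * (enorm x ^+ 2 * 4 ^+ m))) <= p t x.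
Proof.
have [cg cg0 Hg] := rate_growth p0.
(* The step time tau satisfies tau [rate (m + j)] = N / n with N < n <= 1 + N and N >= cg, hence
   lies between cg / (1 + cg) and 1. *)
have a0 : 0 < cg / (1 + cg) by rewrite divr_gt0// addr_gt0.
have [[c1 c0] /= [c10 c00] HN] := near_diagonal hd hbeta hnu hnu1 hP hp a0 ltr01.
have [J HJ] : exists J, 2 / c0 * (J.+2%:R `^ (beta - 1)) <= 2 ^+ J.
  by apply: powR_absorb; rewrite divr_gt0.
set rho : R := J.+2%:R `^ (beta - 1) in HJ.
have rho0 : 0 < rho by rewrite powR_gt0.
pose c2 := c0 / (2 * rho).
have c20 : 0 < c2 by rewrite divr_gt0// mulr_gt0.
have HJ2 : 1 <= c2 * 2 ^+ J.
  move: HJ; rewrite mulrAC ler_pdivrMr// => HJ.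
  by rewrite /c2 mulrAC ler_pdivlMr ?mulr_gt0// mul1r [leRHS]mulrC.
(* The second entry is the near-diagonal bound times the volume of a cube of radius r = c0 2^-(m+j)
   / 4; the first makes L positive. *)
pose q := Num.min (2^-1) (c1 * (c0 / 2) ^+ d).
have q0 : 0 < q.
  by rewrite lt_min invr_gt0 ltr0n mulr_gt0// exprn_gt0// divr_gt0.
have q1 : q <= 2^-1 by rewrite ge_min lexx.
have q2 : q <= c1 * (c0 / 2) ^+ d by rewrite ge_min lexx orbT.
pose L := - ln q.
have L0 : 0 < L by rewrite oppr_gt0 ln_lt0// q0/=; lra.
have qE n : q ^+ n = expR (- (n%:R * L)).
  by rewrite /L mulrN opprK expRM_natl lnK.
(* Minimality of j gives c2 2^(j-1) < |x| 2^m; squared, this reads 4^j <= K |x|^2 4^m. *)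
pose K := 4 / c2 ^+ 2.
have K0 : 0 < K by rewrite divr_gt0// exprn_gt0.
(* The number k of steps is at most N <= 4 4^j <= 4 (1 + K |x|^2 4^m), and 4 is rounded up to 5. *)
exists (c1 * expR (- (5 * L)), 5 * K * L) => /=.
  by split; [rewrite mulr_gt0// expR_gt0|apply: mulr_gt0 => //; apply: mulr_gt0].
move=> t m x /andP[tw1 tw4] x1.
have t0 : 0 < t.
  rewrite ltNge; apply/negP => t0.
  have := ler_wpM2r (ltW (rate_gt0 (beta - 1) m)) t0; rewrite mul0r; lra.
(* [|x| < 1] is what bounds [j - m], hence [4^j rate m / rate (m + j)]. *)
have [j jJ Hj] : exists2 j, (j <= m + J)%N & enorm x * 2 ^+ m <= c2 * 2 ^+ j /\
    (4 ^+ j <= 1 + K * (enorm x ^+ 2 * 4 ^+ m)).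
  have mJ : enorm x * 2 ^+ m <= c2 * 2 ^+ (m + J).
    rewrite exprD mulrCA mulrC ler_wpM2l ?exprn_ge0// (le_trans (ltW x1))//.
  have ex : exists j, enorm x * 2 ^+ m <= c2 * 2 ^+ j by exists (m + J)%N.
  case: (ex_minnP ex) => j j1 jmin; exists j; first exact: jmin.
  split => //; case: j j1 jmin => [|j] j1 jmin.
    rewrite expr0 lerDl; apply: mulr_ge0; first exact: ltW.
    by rewrite mulr_ge0 ?exprn_ge0// enorm_ge0.
  have jx : c2 * 2 ^+ j < enorm x * 2 ^+ m.
    by rewrite ltNge; apply/negP => /jmin; rewrite ltnn.
  have E4 k : (4 : R) ^+ k = (2 ^+ k) ^+ 2.
    by rewrite -exprM mulnC exprM; congr (_ ^+ _); rewrite expr2; lra.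
  have h : (c2 * 2 ^+ j) ^+ 2 <= (enorm x * 2 ^+ m) ^+ 2.
    apply: lerXn2r; rewrite ?nnegrE ?(ltW jx)//.
      by apply: mulr_ge0; [exact: ltW|exact: exprn_ge0].
    by rewrite mulr_ge0 ?enorm_ge0 ?exprn_ge0.
  rewrite (exprMn 2 c2) (exprMn 2 (enorm x)) -(E4 j) -(E4 m) in h.
  have -> : (4 : R) ^+ j.+1 = K * (c2 ^+ 2 * 4 ^+ j).
    by rewrite /K exprS; field; rewrite gt_eqF.
  apply: (@le_trans _ _ (K * (enorm x ^+ 2 * 4 ^+ m))).
    by apply: ler_wpM2l => //; exact: ltW.
  by rewrite lerDr.
have [Hj1 Hj2] := Hj.
pose N := t * rate (m + j).
have N0 : 0 < N by apply: mulr_gt0 => //; exact: rate_gt0.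
(* Of the n steps, k are taken with the measures [P tau]; the last one uses the density, through
   [density_comb]. *)
pose k := Num.truncn N; pose n := k.+1.
have nN : N < n%:R by exact: truncnS_gt.
have Nn : n%:R <= 1 + N by rewrite /n -natr1 addrC lerD2l truncn_le// ltW.
have n0 : 0 < n%:R :> R by rewrite ltr0n.
pose tau := t / n%:R.
have tau0 : 0 < tau by rewrite divr_gt0.
have tauw : cg / (1 + cg) <= tau * rate (m + j) <= 1.
  have -> : tau * rate (m + j) = N / n%:R by rewrite /tau /N mulrAC.
  rewrite ler_pdivlMr// [X in _ && X]ler_pdivrMr// mul1r (ltW nN) andbT.
  have cgN : cg <= N.
    have h := Hg m j.
    have h2 := ler_wpM2l (ltW t0) h; apply: le_trans h2.
    have -> : t * (cg * 2 ^+ j * rate m) = (cg * (t * rate m)) * 2 ^+ j by ring.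
    have h3 : cg <= cg * (t * rate m) by rewrite ler_peMr// ltW.
    apply: (le_trans h3); rewrite ler_peMr ?exprn_ege1 ?ler1n//.
    by apply: mulr_ge0; [exact: ltW|exact: le_trans tw1].
  rewrite mulrAC ler_pdivrMr ?addr_gt0//.
  by apply: (le_trans (ler_wpM2l (ltW cg0) Nn)); rewrite !mulrDr !mulr1 (mulrC N) lerD2r.
(* A quarter of the near-diagonal radius: a mean step is at most 2 r in each coordinate, and
   deviations up to 2 r are allowed around it. *)
pose r := c0 * 2^-1 ^+ (m + j) / 4.
have e0 := exp2V_gt0 R (m + j).
have r0 : 0 < r by rewrite divr_gt0// mulr_gt0.
have r4 : c0 * 2^-1 ^+ (m + j) = 4 * r by rewrite [4 * r]mulrC divfK.
pose y := n%:R^-1 *: x.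
have yr i : `|y 0 i| <= 2 * r.
  rewrite mxE normrM ger0_norm ?invr_ge0 ?(ltW n0)//.
  rewrite mulrC ler_pdivrMr//; apply: (le_trans (coord_le_enorm x i)).
  apply: (@le_trans _ _ (2 * r * N)); last by rewrite ler_pM2l ?mulr_gt0// ltW.
  have h1 : 4 ^+ j <= rho * N.
    have h := ler_wpM2l (ltW t0) (rate_lower jJ).
    have -> : rho * N = t * (rho * rate (m + j)) by rewrite /N; ring.
    by apply: le_trans h; rewrite mulrCA ler_peMr// exprn_ge0.
  have h2 : enorm x <= c2 * 2 ^+ j * 2^-1 ^+ m.
    by rewrite exprVn ler_pdivlMr ?exprn_gt0.
  apply: (le_trans h2).
  have -> : 2 * r * N = c2 * 2^-1 ^+ (m + j) * (rho * N).
    have F (u a b rh : R) : rh != 0 -> 2 * (a * u / 4) * b = a / (2 * rh) * u * (rh * b).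
      by move=> rh0; field.
    by apply: F; rewrite gt_eqF.
  apply: (@le_trans _ _ (c2 * 2^-1 ^+ (m + j) * 4 ^+ j)).
    have E4 : (4 : R) ^+ j = 2 ^+ j * 2 ^+ j by rewrite -exprMn; congr (_ ^+ _); lra.
    rewrite E4 exprD [2^-1 ^+ j]exprVn le_eqVlt; apply/orP; left; apply/eqP.
    have F (u v c : R) : v != 0 -> c * v * u = c * (u * v^-1) * (v * v) by move=> v0; field.
    by apply: F; rewrite expf_neq0.
  by rewrite ler_pM2l// mulr_gt0.
have HN2 z : cube y (2 * r) z -> c1 * (2 ^+ (m + j)) ^+ d <= p tau z.
  move=> zy; apply: HN => // i; rewrite r4.
  have := zy i; have := yr i => h1 h2.
  rewrite -(subrK (y 0 i) (z 0 i)) (le_trans (ler_normD _ _))// (le_trans (lerD h2 h1))//; lra.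
have c10' : 0 <= c1 * (2 ^+ (m + j)) ^+ d by apply: mulr_ge0; [exact: ltW|rewrite !exprn_ge0].
have step u : cube y r u -> (q%:E <= P tau (cube u r))%E.
  move=> uy.
  have H z : cube u r z -> c1 * (2 ^+ (m + j)) ^+ d <= p tau z.
    move=> zu; apply: HN2 => i.
    have := zu i; have := uy i => h1 h2.
    rewrite -(subrK (u 0 i) (z 0 i)) -addrA (le_trans (ler_normD _ _))// (le_trans (lerD h2 h1))//; lra.
  apply: le_trans (density_ge hp tau0 (measurable_cube u r) c10' H).
  rewrite lebesgue_cube ?(ltW r0)// -EFinM lee_fin (le_trans q2)// -mulrA -exprMn.
  rewrite /r exprVn le_eqVlt; apply/orP; left; apply/eqP; congr (_ * _ ^+ _).
  have F (v c : R) : v != 0 -> c / 2 = v * (2 * (c / v / 4)) by move=> v0; field.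
  by apply: F; rewrite expf_neq0.
have hc := cube_chain (ltW tau0) (ltW q0) (ltW r0) step k.
have kt : k%:R * tau + tau = t.
  by rewrite -{2}(mul1r tau) -mulrDl natr1 /tau mulrC divfK// gt_eqF.
have K1 z : cube (k%:R *: y) r z -> cube y (2 * r / 2) (x - z).
  move=> zk i; have := zk i; rewrite mulrAC divff// mul1r.
  have -> : x = k%:R *: y + y.
    by rewrite -{2}(scale1r y) -scalerDl natr1 /y scalerA divff ?gt_eqF// scale1r.
  by rewrite !mxE distrC => h; rewrite addrAC addrK.
have k0 : 0 <= k%:R * tau by rewrite mulr_ge0// ltW.
have r20 : 0 < 2 * r by rewrite mulr_gt0.
rewrite -kt.
apply: le_trans (density_comb hP hp k0 tau0 r20 c10' (measurable_cube _ r) HN2 K1).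
apply: (@le_trans _ _ (c1 * (2 ^+ (m + j)) ^+ d * q ^+ k)); last by rewrite ler_wpM2l.
have m0 : 0 < (2 ^+ m) ^+ d :> R by rewrite !exprn_gt0.
apply: (@le_trans _ _ (c1 * (2 ^+ m) ^+ d * q ^+ k)); last first.
  rewrite ler_wpM2r ?exprn_ge0 ?(ltW q0)// ler_pM2l// lerXn2r ?nnegrE ?exprn_ge0//.
  by rewrite ler_eXn2l ?ltr1n// leq_addr.
set X := enorm x ^+ 2 * 4 ^+ m in Hj2 *.
have -> : c1 * expR (- (5 * L)) * (2 ^+ m) ^+ d * expR (- (5 * K * L * X)) =
   c1 * (2 ^+ m) ^+ d * (expR (- (5 * L)) * expR (- (5 * K * L * X))) by ring.
rewrite ler_pM2l ?mulr_gt0// -expRD qE ler_expR -opprD lerN2.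
have kN : k%:R <= N by rewrite truncn_le// ltW.
have J0 : 0 <= 4 ^+ j :> R by exact: exprn_ge0.
have N4 : N <= 4 * 4 ^+ j.
  have h := ler_wpM2l (ltW t0) (rate_exp4 m j).
  have h2 := ler_wpM2r J0 tw4; apply: le_trans h2; apply: (le_trans h).
  by rewrite mulrCA [leRHS]mulrC.
have -> : 5 * L + 5 * K * L * X = 5 * (1 + K * X) * L by ring.
rewrite ler_pM2r//; apply: (le_trans (le_trans kN N4)).
by move: Hj2 J0; clear; move: (4 ^+ j) (K * X) => f g; lra.
Qed.

End chaining.

(** * One big jump *)

Section jump_increment.
Variables (R : realType) (d : nat) (beta : R) (nu : {measure set 'rV[R]_d -> \bar R}).
Hypotheses (hd : (0 < d)%N) (hbeta : 1 < beta) (hnu : symmetric_levy_measure nu)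
  (hnu1 : comparable_density nu [set x | 0 < enorm x < 1] (levy_profile beta)).
Variables (P : R -> probability 'rV[R]_d R) (hP : levy_semigroup nu P).
Local Notation lam := (@lebesgue_rV R d).
Local Notation Phi := (levy_exponent nu).
Implicit Types (xi x y v : 'rV[R]_d).

(** The generator applied to the bump, in Fourier form; [Rintegral_jacksonPhi_cos] gives its form as
    an integral over jumps. *)
Definition bump_rate e v := - \int[lam]_xi (jackson e xi * Phi xi * cos (dotv xi v)).

Let uu e x (s : R) xi := jackson e xi * cos (dotv xi x) * expR (- (s * Phi xi)).

Let integrable_uu e x s : 0 < e -> 0 <= s -> lam.-integrable setT (EFin \o uu e x s).
Proof.
move=> e0 s0; have ik := @integrable_jackson R d e e0.
apply: (integrable_le _ ik).
  apply: measurable_funM; last exact: (measurable_expPhi hbeta hnu hnu1).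
  apply: measurable_funM; first exact: integrable_meas ik.
  by apply: (measurableT_comp (@measurable_cos R)); exact: measurable_dotv.
move=> xi; rewrite !normrM (ger0_norm (jackson_ge0 _ (ltW e0))) -mulrA ler_piMr ?jackson_ge0 ?(ltW e0)//.
by rewrite mulr_ile1// ?cos_max// ger0_norm ?expR_ge0// expPhi_le1.
Qed.

Let derive_uu (e : R) x (s : R) xi : is_derive s (1 : R) (uu e x ^~ xi) (- (Phi xi * uu e x s xi)).
Proof.
rewrite /uu; apply: is_derive_eq; rewrite /GRing.scale/=; ring.
Qed.

(** In Fourier form the time derivative is dominated by [jackson e xi * Phi xi] uniformly in s > 0,
    which permits differentiation under the integral. *)
Lemma bump_increment e x (tau : R) : 0 < e -> 0 < tau ->
  exists2 s : R, 0 < s < tau &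
    \int[P tau]_y bump e (x - y) - bump e x = tau * \int[P s]_y bump_rate e (x - y).
Proof.
move=> e0 tau0.
pose u s := \int[lam]_xi uu e x s xi.
pose I := \int[lam]_xi (jackson e xi * Phi xi).
have iG := integrable_jacksonPhi hbeta hnu hnu1 e0.
have G0 xi : 0 <= jackson e xi * Phi xi by rewrite mulr_ge0 ?jackson_ge0 ?levy_exponent_ge0 ?ltW.
have I0 : 0 <= I by apply: Rintegral_ge0.
have uE s : 0 <= s -> \int[P s]_y bump e (x - y) = u s.
  by move=> s0; rewrite (Rintegral_bump hP).
have u0 : bump e x = u 0.
  rewrite -Rintegral_jackson_cos//; apply: eq_Rintegral => xi _.
  by rewrite /uu mul0r oppr0 expR0 mulr1.
pose du s := \int[lam]_xi (- (Phi xi * uu e x s xi)).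
have du1 s xi : partial1of2 (uu e x) s xi = - (Phi xi * uu e x s xi).
  by rewrite partial1of2E; apply: derive_val.
have dru (s : R) : 0 < s -> is_derive s (1 : R) u (du s).
  move=> s0.
  have sI : [set` `]0, (s + 1)[] s by rewrite /= in_itv/= s0/= ltrDl.
  have h1 z : [set` `]0, (s + 1)[] z -> lam.-integrable setT (EFin \o uu e x z).
    by rewrite /= in_itv/= => /andP[z0 _]; apply: integrable_uu => //; exact: ltW.
  have h2 z xi : [set` `]0, (s + 1)[] z -> setT xi -> derivable (uu e x ^~ xi) z 1.
    by move=> _ _; apply: ex_derive.
  have h3 z xi : [set` `]0, (s + 1)[] z -> setT xi -> `|partial1of2 (uu e x) z xi| <= jackson e xi * Phi xi.
    rewrite /= in_itv/= => /andP[z0 _] _; rewrite du1 normrN normrM ger0_norm ?levy_exponent_ge0//.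
    rewrite mulrC ler_wpM2r ?levy_exponent_ge0// /uu !normrM (ger0_norm (jackson_ge0 _ (ltW e0))).
    rewrite -mulrA ler_piMr ?jackson_ge0 ?(ltW e0)//.
    by rewrite mulr_ile1// ?cos_max// ger0_norm ?expR_ge0// expPhi_le1// ltW.
  apply: DeriveDef; first exact: (derivable_under_integral measurableT sI h1 h2 G0 iG h3).
  rewrite -derive1E (differentiation_under_integral measurableT sI h1 h2 G0 iG h3).
  by apply: eq_Rintegral => xi _; exact: du1.
(* The domination needs exp (-s Phi) <= 1, hence s >= 0, so at 0 only right continuity is shown,
   from 1 - exp (-u) <= u; the mean value theorem asks for no more there. *)
have cu0 : u s @[s --> 0^'+] --> u 0.
  apply/cvgrPdist_le => r r0; near=> s.
  have s0 : 0 < s by [].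
  have -> : u 0 - u s = \int[lam]_xi (uu e x 0 xi - uu e x s xi).
    by rewrite RintegralB//; apply: integrable_uu => //; exact: ltW.
  apply: (@le_trans _ _ (\int[lam]_xi (s * (jackson e xi * Phi xi)))).
    apply: (le_trans (le_normr_Rintegral _ _)) => //.
      by apply: integrableB_R; apply: integrable_uu => //; exact: ltW.
    apply: le_Rintegral => //.
    - apply: integrable_norm.
      by apply: integrableB_R; apply: integrable_uu => //; exact: ltW.
    - exact: integrableZ_R.
    move=> xi _; rewrite /uu mul0r oppr0 expR0 -mulrBr normrM normrM (ger0_norm (jackson_ge0 _ (ltW e0))).
    rewrite -mulrA [leRHS]mulrCA ler_wpM2l ?jackson_ge0 ?(ltW e0)//.
    have := expR_ge1Dx (- (s * Phi xi)); have := expPhi_le1 nu xi (ltW s0).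
    move=> h1 h2; rewrite -[leRHS]mul1r ler_pM ?cos_max// ger0_norm; lra.
  rewrite RintegralZl// -/I.
  apply: (@le_trans _ _ (s * (I + 1))); first by rewrite ler_wpM2l ?(ltW s0)// lerDl.
  rewrite -ler_pdivlMr ?ltr_wpDl//.
  near: s; apply: nbhs_right_le; rewrite divr_gt0// ltr_wpDl//.
have cts (s : R) : 0 < s -> {for s, continuous u}.
  move=> s0; have [du' _] := dru s s0.
  by apply: differentiable_continuous; apply/derivable1_diffP.
have [s sI] : exists2 c, c \in `]0, tau[ & u tau - u 0 = du c * (tau - 0).
  apply: (MVT tau0) => [s|].
    by rewrite in_itv/= => /andP[s0 _]; exact: dru.
  apply/continuous_within_itvP; first exact: tau0.
  split; [|exact: cu0|].
    by move=> s; rewrite in_itv/= => /andP[s0 _]; exact: cts.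
  by apply: cvg_at_left_filter; exact: cts.
rewrite subr0 => h; move: sI; rewrite in_itv/= => sI; exists s => //.
have s0 : 0 < s by case/andP: sI.
rewrite uE ?(ltW tau0)// u0 h mulrC; congr (_ * _).
rewrite /bump_rate.
have [iB H] := fourier_swap hP x (ltW s0) iG.
under [RHS]eq_Rintegral => y _ do rewrite -mulN1r.
rewrite RintegralZl// H mulN1r /du.
have iD : lam.-integrable setT (EFin \o (fun xi => jackson e xi * Phi xi * cos (dotv xi x) * expR (- (s * Phi xi)))).
  apply: (@integrableM_bounded _ _ _ _ _ _ 1).
  - apply: (integrableM_bounded iG) (fun x => cos_max _).
    by apply: (measurableT_comp (@measurable_cos R)); exact: measurable_dotv.
  - exact: (measurable_expPhi hbeta hnu hnu1).
  - by move=> xi; rewrite ger0_norm ?expR_ge0// expPhi_le1// ltW.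
rewrite -mulN1r -RintegralZl//; apply: eq_Rintegral => xi _; rewrite /uu; ring.
Unshelve. all: by end_near. Qed.

End jump_increment.

Section jump.
Variables (R : realType) (d : nat) (beta : R) (nu : {measure set 'rV[R]_d -> \bar R}).
Hypotheses (hd : (0 < d)%N) (hbeta : 1 < beta) (hnu : symmetric_levy_measure nu)
  (hnu1 : comparable_density nu [set x | 0 < enorm x < 1] (levy_profile beta)).
Local Notation lam := (@lebesgue_rV R d).
Local Notation Phi := (levy_exponent nu).
Local Notation rate := (rate (beta - 1)).
Local Notation bump_rate := (bump_rate nu).
Implicit Types (xi x y v : 'rV[R]_d).

Let p0 : 0 < beta - 1. Proof. by rewrite subr_gt0. Qed.

Lemma bump_rate_ge e v : 0 < e -> - (\int[lam]_xi (jackson e xi * Phi xi)) <= bump_rate e v.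
Proof.
move=> e0; rewrite lerN2; have iG := integrable_jacksonPhi hbeta hnu hnu1 e0.
apply: le_Rintegral => //.
  apply: (integrableM_bounded iG) (fun x => cos_max _).
  by apply: (measurableT_comp (@measurable_cos R)); exact: measurable_dotv.
move=> xi _; rewrite ler_piMr ?cos_le1//.
by rewrite mulr_ge0 ?jackson_ge0 ?levy_exponent_ge0 ?ltW.
Qed.

(** At a zero of the bump the second difference keeps only the gains from landing on it, so
    discarding the jumps outside A is allowed. Taking A empty gives nonnegativity. *)
Lemma bump_rate_ge_nu e v A : 0 < e -> bump e v = 0 -> measurable A ->
  (forall y i, A y -> `|v 0 i - y 0 i| <= e) ->
  ((2^-1 * (bspline 0 / 4) ^+ d)%:E * nu A <= (bump_rate e v)%:E)%E.
Proof.
move=> e0 Fv mA HA; have [ig E] := Rintegral_jacksonPhi_cos hbeta hnu hnu1 v e0.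
rewrite /bump_rate E Fv -mulN1r -(RintegralZl _ measurableT) -?Fv//.
have ig' := integrableZ_R (-1) ig.
rewrite -(integrable_EFin_Rintegral ig') Fv -integral_cst//.
have h0 y : 0 <= -1 * (0 - 2^-1 * (bump e (v + y) + bump e (v - y))).
  by rewrite sub0r mulrNN mul1r mulr_ge0 ?invr_ge0// addr_ge0 ?bump_ge0.
have mg := integrable_meas ig'; rewrite Fv in mg.
apply: (@le_trans _ _ (\int[nu]_(y in A) (-1 * (0 - 2^-1 * (bump e (v + y) + bump e (v - y))))%:E)%E).
  apply: ge0_le_integral => //.
  - by move=> y _; rewrite lee_fin mulr_ge0 ?invr_ge0// exprn_ge0// divr_ge0// bspline_ge0.
  - by apply/measurable_EFinP; exact: measurable_funTS.
  move=> y Ay; rewrite lee_fin sub0r mulrNN mul1r ler_pM2l ?invr_gt0//.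
  apply: (@le_trans _ _ (bump e (v - y))); last by rewrite lerDr bump_ge0.
  by apply: bump_ge => // i; rewrite !mxE; exact: HA.
apply: ge0_subset_integral => //.
- by apply/measurable_EFinP.
- by move=> y _; rewrite lee_fin.
Qed.

(** As u < 1, 2 / w <= 4 / u <= (2 / u)^2, so the logarithm at most doubles. *)
Lemma ln_ratio_le (u w : R) : 0 < u < 1 -> u / 2 <= w -> w <= u -> 0 < w ->
  (2 `^ (- beta)) * ln (2 / u) `^ (- beta) <= ln (2 / w) `^ (- beta).
Proof.
move=> /andP[u0 u1] uw wu w0.
have b0 : 0 <= beta := ltW (lt_trans ltr01 hbeta).
have l1 : 0 < ln (2 / u) by rewrite ln_gt0// ltr_pdivlMr//; lra.
have l2 : 0 < ln (2 / w) by rewrite ln_gt0// ltr_pdivlMr//; lra.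
rewrite -powRM ?(ltW l1)// !powRN lef_pV2 ?posrE ?powR_gt0 ?mulr_gt0//.
apply: ge0_ler_powR; rewrite ?nnegrE ?(ltW l2) ?mulr_ge0 ?(ltW l1)//.
have -> : 2 * ln (2 / u) = ln ((2 / u) ^+ 2).
  by rewrite expr2 [RHS]lnM ?posrE ?divr_gt0//; ring.
rewrite ler_ln ?posrE ?divr_gt0 ?exprn_gt0 ?divr_gt0//.
rewrite ler_pdivrMr// expr_div_n mulrAC ler_pdivlMr ?exprn_gt0//.
nra.
Qed.

(** The cube is centred at [x0] moved a distance e / 2 towards the origin and has Euclidean radius
    at most e / 2. It therefore stays in |y| <= |x0|, inside the unit ball where the density is
    known, and in |y| >= |x0| / 2. *)
Lemma nu_cube_ge : exists2 c : R, 0 < c & forall x0 e, 0 < enorm x0 < 1 -> 0 < e <= enorm x0 / 2 ->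
  exists A, [/\ measurable A, (forall y i, A y -> `|x0 0 i - y 0 i| <= e) &
   ((c * levy_profile beta x0 * e ^+ d)%:E <= nu A)%E].
Proof.
have [[c C] [/= c0 C0] H] := nu_density_bounds hnu1.
have dn0 : 0 < d%:R :> R by rewrite ltr0n.
have b2 : 0 < 2 `^ (- beta) :> R by rewrite powR_gt0.
have di : 0 < (d%:R^-1 : R) ^+ d by rewrite exprn_gt0// invr_gt0.
exists (c * 2 `^ (- beta) * d%:R^-1 ^+ d); first by rewrite mulr_gt0// mulr_gt0.
move=> x0 e /andP[x00 x01] /andP[e0 ex].
pose s := e / (2 * enorm x0).
have sx : s * enorm x0 = e / 2 by rewrite /s; field; rewrite gt_eqF.
have s0 : 0 < s by rewrite divr_gt0// mulr_gt0.
have s1 : 0 <= 1 - s.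
  by rewrite subr_ge0 ler_pdivrMr ?mulr_gt0// mul1r; lra.
pose r := e / (2 * d%:R).
have r0 : 0 < r by rewrite divr_gt0// mulr_gt0.
have re : r <= e / 2.
  by rewrite /r invfM mulrA ler_piMr ?divr_ge0 ?(ltW e0)// invf_le1// ler1n.
pose A := cube ((1 - s) *: x0) r.
have dr : Num.sqrt d%:R * r <= e / 2.
  have sd : Num.sqrt d%:R <= d%:R :> R.
    by rewrite -[leRHS]ger0_norm ?(ltW dn0)// -sqrtr_sqr ler_sqrt ?exprn_ge0 ?(ltW dn0)// expr2 ler_peMr ?(ltW dn0)// ler1n.
  apply: (le_trans (ler_wpM2r (ltW r0) sd)); rewrite le_eqVlt; apply/orP; left; apply/eqP.
  by rewrite /r; field; rewrite gt_eqF.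
have Ab y : A y -> enorm x0 / 2 <= enorm y <= enorm x0.
  move=> Ay.
  have h : enorm (y - (1 - s) *: x0) <= e / 2.
    apply: le_trans dr; apply: enorm_le_sup; first exact: ltW.
    by move=> i; have := Ay i; rewrite !mxE.
  have e1 : enorm ((1 - s) *: x0) = enorm x0 - e / 2.
    by rewrite enormZ ger0_norm// mulrBl mul1r sx.
  have h1 := enormD y ((1 - s) *: x0 - y).
  have h2 := enormD ((1 - s) *: x0) (y - (1 - s) *: x0).
  rewrite addrC subrK e1 in h2.
  rewrite addrC subrK e1 -(enormN (_ - y)) opprB in h1.
  by apply/andP; split; lra.
exists A; split; first exact: measurable_cube.
  move=> y i Ay; have := Ay i; rewrite mxE => h.
  have -> : x0 0 i - y 0 i = ((1 - s) * x0 0 i - y 0 i) + s * x0 0 i by ring.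
  apply: (le_trans (ler_normD _ _)); rewrite distrC normrM (gtr0_norm s0).
  have h3 : s * `|x0 0 i| <= e / 2 by rewrite -sx ler_pM2l// coord_le_enorm.
  apply: (le_trans (lerD h h3)); lra.
pose M := 2 `^ (- beta) * levy_profile beta x0.
have M0 : 0 <= M by rewrite mulr_ge0 ?(ltW b2)// levy_profile_ge0.
have AD : A `<=` [set x | 0 < enorm x < 1].
  by move=> y /Ab/andP[h1 h2] /=; apply/andP; split; lra.
have [_ HA] := H A M (measurable_cube _ _) AD M0.
apply: le_trans (HA _).
  rewrite lebesgue_cube ?(ltW r0)// -EFinM lee_fin le_eqVlt; apply/orP; left; apply/eqP.
  have -> : 2 * r = d%:R^-1 * e by rewrite /r; field; rewrite gt_eqF.
  by rewrite exprMn /M; ring.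
move=> y /Ab/andP[h1 h2]; rewrite /M /levy_profile mulrCA.
have y0 : 0 < enorm y by lra.
apply: ler_pM.
- by rewrite invr_ge0 exprn_ge0// ltW.
- by rewrite mulr_ge0 ?powR_ge0.
- by rewrite lef_pV2 ?posrE ?exprn_gt0// lerXn2r// nnegrE ltW.
- by apply: ln_ratio_le => //; rewrite x00.
Qed.

End jump.

Section jump_lower_bound.
Variables (R : realType) (d : nat) (beta : R) (nu : {measure set 'rV[R]_d -> \bar R}).
Hypotheses (hd : (0 < d)%N) (hbeta : 1 < beta) (hnu : symmetric_levy_measure nu)
  (hnu1 : comparable_density nu [set x | 0 < enorm x < 1] (levy_profile beta)).
Variables (P : R -> probability 'rV[R]_d R) (hP : levy_semigroup nu P).
Variables (p : R -> 'rV[R]_d -> R) (hp : continuous_densities P p).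
Local Notation lam := (@lebesgue_rV R d).
Local Notation Phi := (levy_exponent nu).
Local Notation rate := (rate (beta - 1)).
Local Notation bump_rate := (bump_rate nu).
Implicit Types (xi x y v : 'rV[R]_d).

Let p0 : 0 < beta - 1. Proof. by rewrite subr_gt0. Qed.

(** The negative part of the generator is controlled by the probability of K at the mean value time
    s, the increment of the bump by that at tau. A weighted sum of the two is bounded below, so the
    larger one serves. *)
Lemma jump_probability (kappa : R) : 0 < kappa -> 8 * Num.sqrt d%:R * kappa <= 1 ->
  exists2 c : R, 0 < c & forall (t : R) m x0, 0 < t -> t * rate m <= 4 ->
    2^-1 ^+ m <= enorm x0 -> enorm x0 < 1 ->
  exists2 s : R, 0 <= s <= t / 2 &
    c * (t * levy_profile beta x0) * (kappa * 2^-1 ^+ m) ^+ d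
      <= fine (P s (cube x0 (2 * (kappa * 2^-1 ^+ m)))).
Proof.
move=> k0 ksd.
have sd1 : 1 <= Num.sqrt d%:R :> R.
  by rewrite -[leLHS]sqrtr1 ler_sqrt// ler1n.
have k1 : kappa <= 8^-1.
  have : kappa <= Num.sqrt d%:R * kappa by rewrite ler_peMl// ltW.
  by move: ksd; rewrite -mulrA; lra.
have [C C0 HC] := Rintegral_jacksonPhi_le hbeta hnu hnu1.
have [Ct Ct0 HCt] := tail_prob hbeta hnu hnu1 hP.
have [cn cn0 Hcn] := nu_cube_ge hd hbeta hnu1.
pose C' := C * kappa ^- 2.
have C'0 : 0 < C' by rewrite mulr_gt0// invr_gt0 exprn_gt0.
pose a2 := kappa / 8; have a20 : 0 < a2 by rewrite divr_gt0.
(* The first entry gives tau <= t / 2; the second, with t [rate m] <= 4, makes the tail bound of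
   [tail_prob] at most 1/2. *)
pose eta := Num.min (2^-1) (a2 ^+ 2 / (8 * Ct)).
have eta0 : 0 < eta.
  by rewrite lt_min invr_gt0 ltr0n/= divr_gt0 ?exprn_gt0 ?mulr_gt0.
have eta1 : eta <= 2^-1 by rewrite ge_min lexx.
have eta2 : eta <= a2 ^+ 2 / (8 * Ct) by rewrite ge_min lexx orbT.
pose B0 : R := bspline 0 ^+ d; have B00 : 0 < B0 by rewrite exprn_gt0// bspline0_gt0.
pose B4 : R := 2^-1 * (bspline 0 / 4) ^+ d.
have B40 : 0 < B4 by rewrite mulr_gt0 ?invr_gt0// exprn_gt0// divr_gt0// bspline0_gt0.
(* The sum of the two weights in [main]; the 4 is the bound on t [rate m]. *)
pose D := B0 + 4 * eta * C'.
have D0 : 0 < D by apply: addr_gt0 => //; apply: mulr_gt0 => //; apply: mulr_gt0.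
pose k := eta / 2 * (B4 * cn * 2^-1 ^+ d) / D.
have hd2 := exp2V_gt0 R d.
have k00 : 0 < k.
  apply: divr_gt0 => //; apply: mulr_gt0; first by apply: divr_gt0.
  by apply: mulr_gt0 => //; apply: mulr_gt0.
exists k => // t m x0 t0 tw mx x1.
have m0 := exp2V_gt0 R m.
set eps := kappa * 2^-1 ^+ m.
have e0 : 0 < eps by rewrite mulr_gt0.
have em : eps <= 2^-1 ^+ m by rewrite /eps ler_piMl ?(ltW m0)//; lra.
have x0g : 0 < enorm x0 by exact: lt_le_trans mx.
have l0 : 0 <= levy_profile beta x0 by exact: levy_profile_ge0.
(* Since |x0| >= 2^-m >= 8 sqrt d eps, some coordinate is large. It separates K from Q, whose
   half-sides are 2 eps and eps / 4, and makes the bump vanish at time 0. *)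
have [i xi] : exists i, 4 * eps <= `|x0 0 i|.
  apply/not_existsP => H.
  have : enorm x0 <= Num.sqrt d%:R * (4 * eps).
    apply: enorm_le_sup; first by rewrite mulr_ge0// ltW.
    by move=> i; rewrite ltW// ltNge; apply/negP; exact: H.
  apply/negP; rewrite -ltNge; apply: lt_le_trans mx.
  have -> : Num.sqrt d%:R * (4 * eps) = (8 * Num.sqrt d%:R * kappa) * (2^-1 ^+ m / 2).
    by rewrite /eps; field.
  have h : 0 <= 2^-1 ^+ m / 2 :> R by rewrite divr_ge0// ltW.
  apply: (le_lt_trans (ler_wpM2r h ksd)); lra.
have eh : 0 < eps / 2 <= enorm x0 / 2.
  by rewrite divr_gt0//= ler_pM2r ?invr_gt0// (le_trans em).
have x01 : 0 < enorm x0 < 1 by rewrite x0g.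
(* Jumps within eps / 2 of [x0], started from a point of Q within eps / 4 of the origin, land within
   eps of [x0]. *)
have [A [mA HA nuA]] := Hcn x0 (eps / 2) x01 eh.
pose g := B4 * (cn * levy_profile beta x0 * (eps / 2) ^+ d).
have g0 : 0 <= g.
  apply: mulr_ge0; first exact: ltW.
  apply: mulr_ge0; first by apply: mulr_ge0 => //; exact: ltW.
  by rewrite exprn_ge0// ltW//; case/andP: eh.
pose Q := cube (0 : 'rV[R]_d) (2 * (a2 * 2^-1 ^+ m)).
have Qe : 2 * (a2 * 2^-1 ^+ m) = eps / 4 by rewrite /a2 /eps; field.
pose K := cube x0 (2 * eps).
have mQ : measurable Q by exact: measurable_cube.
have mK : measurable K by exact: measurable_cube.
have QK y : Q y -> K y -> False.
  move=> Qy Ky; have := Qy i; have := Ky i; rewrite mxE subr0 Qe => h1 h2.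
  have : `|x0 0 i| <= `|y 0 i| + `|y 0 i - x0 0 i|.
    by rewrite -{1}(subKr (y 0 i) (x0 0 i)) ler_normB.
  by move: xi h1 h2 e0; move: (eps) `|_| `|_| `|_| => a b c f; lra.
have in1 (B : set 'rV[R]_d) y : B y -> \1_B y = 1 :> R by move=> By; rewrite indicE mem_set.
have in0 (B : set 'rV[R]_d) y : ~ B y -> \1_B y = 0 :> R by move=> By; rewrite indicE memNset.
(* On K the crude bound by cos <= 1; off K the bump vanishes, so the generator is nonnegative, and
   on Q it collects the jumps from A. *)
have pw y : g * \1_Q y - C' * rate m * \1_K y <= bump_rate eps (x0 - y).
  have [yK|yK] := pselect (K y).
    rewrite (in1 K)// mulr1 in0; last by move=> /QK.
    rewrite mulr0 sub0r; apply: le_trans (bump_rate_ge hbeta hnu hnu1 _ e0).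
    rewrite lerN2; apply: HC; rewrite k0/=; lra.
  rewrite (in0 K)// mulr0 subr0.
  have Fv : bump eps (x0 - y) = 0.
    have [j yj] : exists j, 2 * eps < `|y 0 j - x0 0 j|.
      apply/not_existsP => H; apply: yK => j.
      by rewrite leNgt; apply/negP; exact: H.
    by apply: (@bump_eq0 _ _ _ _ j) => //; rewrite !mxE distrC ltW.
  have [Qy|Qy] := pselect (Q y); last first.
    rewrite in0// mulr0; have := bump_rate_ge_nu hbeta hnu hnu1 (A := set0) e0 Fv measurable0 (fun _ _ => False_ind _).
    by rewrite measure0 mule0 lee_fin.
  rewrite in1// mulr1.
  have HA2 z j : A z -> `|(x0 - y) 0 j - z 0 j| <= eps.
    move=> Az; have := HA z j Az; have := Qy j; rewrite !mxE subr0 Qe => h1 h2.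
    rewrite addrAC; apply: (le_trans (ler_normB _ _)); apply: (le_trans (lerD h2 h1)); lra.
  have := bump_rate_ge_nu hbeta hnu hnu1 e0 Fv mA HA2; rewrite -lee_fin; apply: le_trans.
  rewrite EFinM; apply: lee_wpmul2l => //; rewrite lee_fin; exact: ltW.
pose tau := eta * t.
have tau0 : 0 < tau by rewrite mulr_gt0.
have tau2 : tau <= t / 2 by rewrite /tau mulrC ler_pM2l.
have [s /andP[s0 st] Hs] := bump_increment hbeta hnu hnu1 hP x0 e0 tau0.
have Fx0 : bump eps x0 = 0.
  apply: (@bump_eq0 _ _ _ _ i) => //; apply: le_trans xi; lra.
rewrite Fx0 subr0 in Hs.
have uK : \int[P tau]_y bump eps (x0 - y) <= B0 * fine (P tau K) by exact: Rintegral_bump_le.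
have PQ : 2^-1 <= fine (P s Q).
  have a21 : 0 < a2 <= 1 by rewrite a20/= /a2; lra.
  have h := HCt s m a2 (ltW s0) a21; rewrite -/Q in h.
  have h2 : s * rate m <= 4 * eta.
    apply: (@le_trans _ _ (tau * rate m)).
      by rewrite ler_wpM2r ?(ltW (rate_gt0 _ _))// ltW.
    by rewrite /tau -mulrA mulrC ler_wpM2r// ltW.
  have h3 : Ct * a2 ^- 2 * (s * rate m) <= 2^-1.
    have c0 : 0 <= Ct * a2 ^- 2 by rewrite mulr_ge0 ?invr_ge0 ?exprn_ge0 ?(ltW a20)// ltW.
    apply: (le_trans (ler_wpM2l c0 h2)).
    apply: (@le_trans _ _ (Ct * a2 ^- 2 * (4 * (a2 ^+ 2 / (8 * Ct))))).
      by rewrite ler_wpM2l// ler_pM2l.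
    rewrite le_eqVlt; apply/orP; left; apply/eqP.
    have F (a c : R) : a != 0 -> c != 0 -> c * a ^- 2 * (4 * (a ^+ 2 / (8 * c))) = 2^-1.
      by move=> *; field; apply/andP.
    by apply: F; rewrite gt_eqF.
  lra.
have ind (A' : set 'rV[R]_d) : measurable A' -> (P s).-integrable setT (EFin \o (\1_A' : 'rV[R]_d -> R)).
  move=> mA'; apply: (prob_integrable_bd _ _ (C := 1)); first exact: measurable_indic.
  by move=> y; rewrite indicE; case: (_ \in _); rewrite ?normr1 ?normr0.
have Rind (A' : set 'rV[R]_d) : measurable A' -> \int[P s]_y (\1_A' y : R) = fine (P s A').
  by move=> mA'; rewrite /Rintegral integral_indic// setIT.
have [iG _] := fourier_swap hP x0 (ltW s0) (integrable_jacksonPhi hbeta hnu hnu1 e0).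
have h1 : g * fine (P s Q) - C' * rate m * fine (P s K) <= \int[P s]_y bump_rate eps (x0 - y).
  rewrite -!Rind// -!RintegralZl//; [|exact: ind..].
  rewrite -RintegralB//; [|by apply: integrableZ_R; exact: ind..].
  apply: le_Rintegral => //.
    by apply: integrableB_R; apply: integrableZ_R; exact: ind.
  apply: eq_integrable (integrableZ_R (-1) iG) => // y _.
  by rewrite /= mulN1r.
have PK0 r : 0 <= fine (P r K) by rewrite fine_ge0.
have main : eta * t * (g / 2) <= B0 * fine (P tau K) + 4 * eta * C' * fine (P s K).
  have h2 := ler_wpM2l (ltW tau0) h1; rewrite -Hs in h2.
  have h3 := le_trans h2 uK.
  have h4 : g / 2 <= g * fine (P s Q) by rewrite ler_wpM2l.
  have h5 := ler_wpM2l (ltW tau0) h4.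
  have h6 : tau * (C' * rate m * fine (P s K)) <= 4 * eta * C' * fine (P s K).
    rewrite mulrA ler_wpM2r// /tau.
    have -> : eta * t * (C' * rate m) = t * rate m * (eta * C') by ring.
    have -> : 4 * eta * C' = 4 * (eta * C') by ring.
    by rewrite ler_wpM2r// ltW// mulr_gt0.
  move: h3 h5 h6; rewrite mulrBr -/tau; lra.
have goalE r : D * fine (P r K) >= eta * t * (g / 2) ->
    k * (t * levy_profile beta x0) * eps ^+ d <= fine (P r K).
  move=> h; rewrite -(ler_pM2l D0); apply: le_trans h.
  rewrite le_eqVlt; apply/orP; left; apply/eqP; rewrite /k /g.
  have -> : (eps / 2) ^+ d = eps ^+ d * 2^-1 ^+ d by rewrite -exprMn.
  have F (D' e' b c u t' l v : R) : D' != 0 ->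
    D' * (e' / 2 * (b * c * u) / D' * (t' * l) * v) = e' * t' * (b * (c * l * (v * u)) / 2).
    by move=> ?; field.
  by apply: F; rewrite gt_eqF.
have [h|h] := leP (fine (P tau K)) (fine (P s K)).
  exists s; first by rewrite (ltW s0)/= (le_trans (ltW st)).
  apply: goalE; apply: (le_trans main); rewrite /D (mulrDl B0); apply: lerD => //.
  by apply: ler_wpM2l => //; exact: ltW.
exists tau; first by rewrite (ltW tau0).
apply: goalE; apply: (le_trans main); rewrite /D (mulrDl B0); apply: lerD => //.
apply: ler_wpM2l; last exact: ltW.
by apply: mulr_ge0; [apply: mulr_ge0 => //|]; exact: ltW.
Qed.

(** As s <= t / 2, (t - s) [rate m] stays in [1/2, 4]. The density 2^(md) at time t - s cancels the
    volume factor 2^(-md) of the jump probability. *)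
Lemma jump_lower : exists2 c : R, 0 < c & forall (t : R) m x0, 0 < t -> 1 <= t * rate m <= 4 ->
    2^-1 ^+ m <= enorm x0 -> enorm x0 < 1 ->
  c * (t * levy_profile beta x0) <= p t x0.
Proof.
have h2 : 0 < 2^-1 :> R by rewrite invr_gt0.
have h4 : 0 < 4 :> R by [].
have [[c1 c0] /= [c10 c00] HN] := near_diagonal hd hbeta hnu hnu1 hP hp h2 h4.
have sd0 : 0 < Num.sqrt d%:R :> R by rewrite sqrtr_gt0 ltr0n.
(* The first summand gives kappa <= c0 / 4, so that 2 eps fits in half the near-diagonal radius; the
   second is the condition of [jump_probability]. *)
pose kappa := (4 / c0 + 8 * Num.sqrt d%:R)^-1.
have k0 : 0 < kappa by rewrite invr_gt0 addr_gt0 ?divr_gt0 ?mulr_gt0.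
have k1 : 8 * Num.sqrt d%:R * kappa <= 1.
  by rewrite ler_pdivrMr ?addr_gt0 ?divr_gt0 ?mulr_gt0// mul1r lerDr divr_ge0// ltW.
have k2 : kappa <= c0 / 4.
  rewrite -[leRHS]invrK invf_div lef_pV2 ?posrE ?addr_gt0 ?divr_gt0 ?mulr_gt0//.
  by rewrite lerDl mulr_ge0 ?(ltW sd0).
have [c cp H] := jump_probability k0 k1.
have kd : 0 < kappa ^+ d by rewrite exprn_gt0.
exists (c1 * c * kappa ^+ d); first by apply: mulr_gt0 => //; apply: mulr_gt0.
move=> t m x0 t0 /andP[tw1 tw4] mx x1.
have [s /andP[s0 st] Hs] := H t m x0 t0 tw4 mx x1.
have m0 := exp2V_gt0 R m.
have w0 := rate_gt0 (beta - 1) m.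
have ts : s + (t - s) = t by rewrite addrC subrK.
have ts0 : 0 < t - s by lra.
have tsw : 2^-1 <= (t - s) * rate m <= 4.
  apply/andP; split.
    apply: (@le_trans _ _ (t / 2 * rate m)); last by rewrite ler_wpM2r ?(ltW w0)//; lra.
    by rewrite mulrAC; lra.
  by apply: le_trans tw4; rewrite ler_wpM2r ?(ltW w0)//; lra.
set eps := kappa * 2^-1 ^+ m in Hs.
pose rho := c0 * 2^-1 ^+ m.
have rho0 : 0 < rho by rewrite mulr_gt0.
have er : 2 * eps <= rho / 2.
  by rewrite /eps /rho; have := ler_wpM2r (ltW m0) k2; lra.
have c1m : 0 <= c1 * (2 ^+ m) ^+ d by apply: mulr_ge0; [exact: ltW|rewrite !exprn_ge0].
have HN2 z : cube 0 rho z -> c1 * (2 ^+ m) ^+ d <= p (t - s) z.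
  by move=> zr; apply: HN => // i; have := zr i; rewrite mxE subr0.
have HK y : cube x0 (2 * eps) y -> cube 0 (rho / 2) (x0 - y).
  by move=> yk i; have := yk i; rewrite !mxE subr0 distrC => h; exact: le_trans er.
rewrite -{2}ts.
apply: le_trans (density_comb hP hp s0 ts0 rho0 c1m (measurable_cube _ _) HN2 HK).
apply: le_trans (ler_wpM2l c1m Hs).
rewrite le_eqVlt; apply/orP; left; apply/eqP.
rewrite /eps exprMn exprVn -exprVn -[((2^-1) ^+ m) ^+ d]exprM.
have : (2 ^+ m) ^+ d * 2^-1 ^+ (m * d) = 1 :> R.
  by rewrite -exprM -exprMn divff// expr1n.
move: ((2 ^+ m) ^+ d) (2^-1 ^+ (m * d)) => a b ab.
transitivity (c1 * c * kappa ^+ d * (t * levy_profile beta x0) * (a * b)); first by rewrite ab mulr1.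
by ring.
Qed.

End jump_lower_bound.

(** * Time scale, space scale and conclusion *)

Section scale.
Variables (R : realType) (d : nat) (beta : R) (nu : {measure set 'rV[R]_d -> \bar R}).
Hypotheses (hd : (0 < d)%N) (hbeta : 1 < beta) (hnu : symmetric_levy_measure nu)
  (hnu1 : comparable_density nu [set x | 0 < enorm x < 1] (levy_profile beta)).
Local Notation Phi := (levy_exponent nu).
Local Notation rate := (rate (beta - 1)).
Local Notation logpow := (logpow (beta - 1)).
Implicit Types (xi x y v : 'rV[R]_d).

Let p0 : 0 < beta - 1. Proof. by rewrite subr_gt0. Qed.

Lemma exp2_above (u : R) : exists n, u <= 2 ^+ n.
Proof.
have [u0|u0] := leP u 0.
  by exists 0%N; rewrite expr0 (le_trans u0).
exists (Num.bound u); have := archi_boundP (ltW u0); move: (Num.bound u) => n un.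
by apply: (le_trans (ltW un)); rewrite -natrX ler_nat ltnW// ltn_expl.
Qed.

(** The least m with t [rate m] >= 1 works: it is positive because [rate 0] = 1 and t < 1, and one
    step multiplies the rate by at most 4. *)
Lemma dyadic_time (t : R) : 0 < t < 1 -> exists m, 1 <= t * rate m <= 4.
Proof.
move=> /andP[t0 t1]; have [c c0 H] := rate_growth p0.
have ex : exists m, 1 <= t * rate m.
  have [n hn] := exp2_above (t * c)^-1; exists n.
  have tc : 0 < t * c by rewrite mulr_gt0.
  have h := ler_wpM2l (ltW t0) (H 0%N n); rewrite add0n rate0 mulr1 in h.
  apply: le_trans h; rewrite mulrA -ler_pdivrMl// mulr1//.
case: (ex_minnP ex) => -[|m] m1 mmin; first by move: m1; rewrite rate0 mulr1; lra.
exists m.+1; rewrite m1/=.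
have h : t * rate m < 1 by rewrite ltNge; apply/negP => /mmin; rewrite ltnn.
apply: (le_trans (ler_wpM2l (ltW t0) (rate_double m (ltW p0)))).
by rewrite mulrCA; lra.
Qed.

(** From 1 / t <= [rate m] <= 4^m follows ln (2 / t) <= 2 (m + 1), so the logarithm cancels
    [logpow m] in the rate and leaves 4^m, which is raised to the power d / 2. *)
Lemma diagonal_size : exists2 C : R, 0 < C & forall (t : R) m, 0 < t < 1 -> 1 <= t * rate m ->
  t `^ (- (d%:R / 2)) * ln (2 / t) `^ (d%:R * (beta - 1) / 2) <= C * (2 ^+ m) ^+ d.
Proof.
exists ((2 `^ (beta - 1)) `^ (d%:R / 2)); first by rewrite !powR_gt0.
move=> t m /andP[t0 t1] tw.
have l0 : 0 < ln (2 / t) by rewrite ln_gt0// ltr_pdivlMr//; lra.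
have tw' : t^-1 <= rate m by rewrite -div1r ler_pdivrMr// mulrC.
have d2 : 0 <= d%:R / 2 :> R by rewrite divr_ge0.
have l2 : ln 2 <= 1 :> R by rewrite -[2]/(1 + 1); apply: le_ln1Dx; lra.
have lm : ln (2 / t) <= 2 * m.+1%:R.
  have h : 2 / t <= 4 ^+ m.+1.
    have := le_trans tw' (rate_le4 m (ltW p0)); rewrite exprS.
    by have : 0 <= 4 ^+ m :> R by [exact: exprn_ge0]; lra.
  apply: (@le_trans _ _ (ln (4 ^+ m.+1))); first by rewrite ler_ln ?posrE ?divr_gt0 ?exprn_gt0.
  rewrite lnXn// [leRHS]mulr_natr ler_wMn2r//.
  have -> : 4 = 2 ^+ 2 :> R by rewrite expr2; lra.
  by rewrite lnXn// mulr2n; lra.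
have -> : d%:R * (beta - 1) / 2 = (beta - 1) * (d%:R / 2) by ring.
have -> : - (d%:R / 2) = (-1) * (d%:R / 2) :> R by rewrite mulN1r.
have it : 0 <= t^-1 by rewrite invr_ge0 ltW.
have split_pow (u : R) : t `^ (-1 * u) * ln (2 / t) `^ ((beta - 1) * u) =
    (t^-1 * ln (2 / t) `^ (beta - 1)) `^ u.
  by rewrite (powRrM t) (powRrM (ln _)) powR_inv1 ?(ltW t0)// powRM// powR_ge0.
rewrite split_pow.
have m0 : 0 < 2 ^+ m :> R by rewrite exprn_gt0.
have -> : (2 ^+ m) ^+ d = (4 ^+ m) `^ (d%:R / 2) :> R.
  have -> : (4 : R) ^+ m = (2 ^+ m) `^ 2.
    rewrite powR_mulrn ?(ltW m0)// -exprM mulnC exprM; congr (_ ^+ _); rewrite expr2; lra.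
  by rewrite -powRrM mulrC divfK// powR_mulrn// ltW.
rewrite -powRM ?powR_ge0 ?exprn_ge0//.
apply: ge0_ler_powR => //; rewrite ?nnegrE.
- by rewrite mulr_ge0 ?invr_ge0 ?powR_ge0 ?(ltW t0).
- by rewrite mulr_ge0 ?powR_ge0 ?exprn_ge0.
apply: (@le_trans _ _ (rate m * (2 `^ (beta - 1) * logpow m))).
  apply: ler_pM => //; first exact: powR_ge0.
  rewrite logpowE -powRM//; apply: ge0_ler_powR; rewrite ?nnegrE ?(ltW p0) ?(ltW l0)//.
by rewrite !rateE mulrCA divfK// gt_eqF// logpow_gt0.
Qed.

Definition axis_vector (r : R) : 'rV[R]_d := r *: delta_mx 0 (Ordinal hd).

Lemma enorm_axis_vector r : 0 <= r -> enorm (axis_vector r) = r.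
Proof.
move=> r0; rewrite enormZ ger0_norm// /enorm /dotv (bigD1 (Ordinal hd))//= big1 ?addr0.
  by rewrite mxE !eqxx mul1r sqrtr1 mulr1.
by move=> i ii; rewrite mxE (negbTE ii) andbF mul0r.
Qed.

Lemma Psi_bounds : exists2 cC : R * R, 0 < cC.1 /\ 0 < cC.2 &
  (forall k r, 2 ^+ k <= r < 2 ^+ k.+1 -> cC.1 * rate k <= Psi nu r) /\
  (forall k r, 0 < r <= 2 ^+ k -> Psi nu r <= cC.2 * rate k).
Proof.
have [c c0 Hc] := levy_exponent_ge hd hbeta hnu hnu1.
have [C C0 HC] := levy_exponent_le hbeta hnu hnu1.
have E4 k : (4 : R) ^+ k = (2 ^+ k) ^+ 2.
  by rewrite -exprM mulnC exprM; congr (_ ^+ _); rewrite expr2; lra.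
have ub k r : 0 <= r <= 2 ^+ k ->
    ubound [set Phi xi | xi in [set xi | enorm xi <= r]] (C * 2 * rate k).
  move=> /andP[r0 rk] _ [xi /= xir <-]; apply: (le_trans (HC k xi)).
  have -> : C * 2 * rate k = C * rate k * 2 by ring.
  rewrite ler_pM2l; last by apply: mulr_gt0 => //; exact: rate_gt0.
  rewrite -[leRHS]/(1 + 1) lerD2l mulrC ler_pdivrMr ?exprn_gt0// mul1r -enorm_sqr E4.
  by rewrite lerXn2r// ?nnegrE ?enorm_ge0 ?exprn_ge0// (le_trans xir).
exists (c, C * 2) => /=; first by rewrite c0 mulr_gt0.
split=> k r.
  move=> /andP[rk rk1]; have r0 : 0 <= r by apply: le_trans rk; exact: exprn_ge0.
  apply: (@le_trans _ _ (Phi (axis_vector r))); first by apply: Hc; rewrite enorm_axis_vector// rk.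
  apply: ub_le_sup; last by exists (axis_vector r) => //=; rewrite enorm_axis_vector.
  by exists (C * 2 * rate k.+1); apply: ub; rewrite r0/= ltW.
move=> /andP[r0 rk]; apply: ge_sup; last by apply: ub; rewrite (ltW r0).
by exists (Phi 0); exists 0 => //=; rewrite -(scale0r (0 : 'rV[R]_d)) enormZ normr0 mul0r ltW.
Qed.

Lemma Psi_inv_bounds : exists2 CJ : R * nat, 0 < CJ.1 & forall (t : R) m, 0 < t -> 1 <= t * rate m <= 4 ->
  Psi_inv nu (1 / t) = 0 (* no r with [Psi r = 1 / t], as [sup set0 = 0] *) \/
  (0 <= Psi_inv nu (1 / t) <= CJ.1 * 2 ^+ m /\
   ((CJ.2 <= m)%N -> 2 ^+ m <= 2 ^+ CJ.2 * Psi_inv nu (1 / t))).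
Proof.
have [[c C] /= [c0 C0] [Hc HC]] := Psi_bounds.
have [cg cg0 Hg] := rate_growth p0.
(* A root r >= 2^(m+j) would give c cg 2^j [rate m] <= 1 / t <= [rate m]; thus 2^j1 bounds 2^j. *)
have [j1 Hj1] := exp2_above (c * cg)^-1.
(* The extra 1 makes the final contradiction strict. *)
have [j0 Hj0] := exp2_above (4 * C / cg + 1).
exists (2 * 2 ^+ j1, j0) => /=; first by rewrite mulr_gt0// exprn_gt0.
move=> t m t0 /andP[tw1 tw4].
have w1 : 1 / t <= rate m by rewrite ler_pdivrMr// mulrC.
have w4 : rate m <= 4 * (1 / t) by rewrite mulrA mulr1 ler_pdivlMr// mulrC.
have m0 : 0 < 2 ^+ m :> R by rewrite exprn_gt0.
rewrite /Psi_inv; set S := [set r | _].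
have [S0|/set0P[r0 Sr0]] := eqVneq S set0; first by left; rewrite S0 sup0.
right.
have up r : S r -> r <= 2 * 2 ^+ j1 * 2 ^+ m.
  move=> [rpos Pr].
  have J1 : 1 <= 2 ^+ j1 :> R by rewrite exprn_ege1 ?ler1n.
  have [r1|r1] := leP (2 ^+ m) r; last first.
    apply: (le_trans (ltW r1)); rewrite ler_peMl ?(ltW m0)//; lra.
  have ex : exists j, r < 2 ^+ (m + j).+1.
    have [n hn] := exp2_above r; exists n; apply: (le_lt_trans hn).
    by rewrite ltr_eXn2l ?ltr1n// ltnS leq_addl.
  case: (ex_minnP ex) => j rj jmin.
  have rj' : 2 ^+ (m + j) <= r.
    case: j rj jmin => [|j] rj jmin; first by rewrite addn0.
    by rewrite leNgt; apply/negP => h; have := jmin j; rewrite -addnS h ltnn => /(_ isT).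
  have h : c * rate (m + j) <= 1 / t by rewrite -Pr; apply: Hc; rewrite rj'.
  have h2 := le_trans (le_trans (ler_wpM2l (ltW c0) (Hg m j)) h) w1.
  have w0 := rate_gt0 (beta - 1) m.
  have h3 : 2 ^+ j <= (c * cg)^-1.
    rewrite -[leRHS]mul1r ler_pdivlMr ?mulr_gt0//.
    rewrite -(ler_pM2r w0) mul1r; apply: le_trans h2.
    by rewrite le_eqVlt; apply/orP; left; apply/eqP; ring.
  apply: (le_trans (ltW rj)); rewrite exprS exprD.
  rewrite -mulrA ler_pM2l// mulrC ler_wpM2r ?(ltW m0)//; exact: le_trans Hj1.
have hub : has_ubound S by exists (2 * 2 ^+ j1 * 2 ^+ m).
have ler : r0 <= sup S by exact: ub_le_sup.
have [r0pos Pr0] := Sr0.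
split.
  rewrite (le_trans (ltW r0pos))//=; apply: ge_sup => //; by exists r0.
(* For a lower bound on the supremum a single root [r0] suffices. The condition j0 <= m keeps the
   level m - j0 a genuine difference. *)
move=> jm; apply: (@le_trans _ _ (2 ^+ j0 * r0)); last by rewrite ler_wpM2l// exprn_ge0.
rewrite leNgt; apply/negP => h.
have rm : r0 <= 2 ^+ (m - j0).
  rewrite -(ler_pM2l (exprn_gt0 j0 (ltr0n R 2))) -exprD subnKC//; exact: ltW.
have P1 : Psi nu r0 <= C * rate (m - j0) by apply: HC; rewrite r0pos.
have h1 := Hg (m - j0)%N j0; rewrite subnK// in h1.
have w0 := rate_gt0 (beta - 1) (m - j0).
rewrite Pr0 in P1.
have : cg * 2 ^+ j0 * rate (m - j0) <= 4 * C * rate (m - j0).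
  by apply: (le_trans h1); apply: (le_trans w4); lra.
rewrite ler_pM2r// -ler_pdivlMl// => h5.
have : 4 * C / cg + 1 <= 4 * C / cg by apply: (le_trans Hj0); rewrite [4 * C / cg]mulrC.
by lra.
Qed.

End scale.

(** * Comparison of h(t) with the dyadic scale, and assembly of the bounds *)

Section off_diagonal.
Variables (R : realType) (d : nat) (beta : R) (nu : {measure set 'rV[R]_d -> \bar R}).
Hypotheses (hd : (0 < d)%N) (hbeta : 1 < beta) (hnu : symmetric_levy_measure nu)
  (hnu1 : comparable_density nu [set x | 0 < enorm x < 1] (levy_profile beta)).
Local Notation rate := (rate (beta - 1)).
Implicit Types (x : 'rV[R]_d).

(** The prefactor uses the upper bound on [Psi_inv] and the exponent its lower bound. For m < J the
    latter is missing, but then |x|^2 4^m <= 4^J, which the factor exp (c 4^J) of the constant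
    absorbs. *)
Lemma hscale_gaussian_le (c : R) : 0 < c -> exists2 c7C : R * R, 0 < c7C.1 /\ 0 < c7C.2 &
  forall (t : R) m x, 0 < t -> 1 <= t * rate m <= 4 -> enorm x < 1 ->
  (hscale nu t ^+ d)^-1 * expR (- (c7C.1 * (enorm x / hscale nu t) ^+ 2)) <=
    c7C.2 * ((2 ^+ m) ^+ d * expR (- (c * (enorm x ^+ 2 * 4 ^+ m)))).
Proof.
move=> c0; have [[C J] /= C0 H] := Psi_inv_bounds hd hbeta hnu hnu1.
have J0 : 0 < 4 ^+ J :> R by rewrite exprn_gt0.
exists (c * 4 ^+ J, C ^+ d * expR (c * 4 ^+ J)) => /=.
  by rewrite !mulr_gt0// ?expR_gt0// exprn_gt0.
move=> t m x t0 tw x1.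
have E4 k : (4 : R) ^+ k = (2 ^+ k) ^+ 2.
  by rewrite -exprM mulnC exprM; congr (_ ^+ _); rewrite expr2; lra.
have M0 : 0 <= (2 ^+ m) ^+ d :> R by rewrite !exprn_ge0.
rewrite /hscale; have := H t m t0 tw; set q := Psi_inv _ _.
rewrite div1r -exprVn invrK => -[->|[/andP[q0 qC] qm]].
  (* Without a root of Psi the convention gives q = 0, and the left side vanishes as d > 0. *)
  rewrite expr0n gtn_eqF// mul0r; apply: mulr_ge0.
    by rewrite mulr_ge0 ?expR_ge0// exprn_ge0// ltW.
  by rewrite mulr_ge0 ?expR_ge0.
have -> : C ^+ d * expR (c * 4 ^+ J) * ((2 ^+ m) ^+ d * expR (- (c * (enorm x ^+ 2 * 4 ^+ m))))
  = (C * 2 ^+ m) ^+ d * expR (c * 4 ^+ J - c * (enorm x ^+ 2 * 4 ^+ m)).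
  by rewrite expRD exprMn; ring.
have ex0 := enorm_ge0 x.
have ex2 : enorm x ^+ 2 <= 1 by rewrite expr_le1// ltW.
apply: ler_pM; rewrite ?exprn_ge0 ?expR_ge0//.
  by rewrite lerXn2r// nnegrE// (le_trans q0).
rewrite ler_expR.
have -> : c * 4 ^+ J * (enorm x * q) ^+ 2 = c * (enorm x ^+ 2 * (4 ^+ J * q ^+ 2)).
  by rewrite exprMn; ring.
have e2 : 0 <= enorm x ^+ 2 by rewrite exprn_ge0.
have [Jm|Jm] := leqP J m.
  have h : 4 ^+ m <= 4 ^+ J * q ^+ 2.
    rewrite !E4 -exprMn lerXn2r// ?nnegrE ?exprn_ge0 ?mulr_ge0 ?exprn_ge0//.
    exact: qm.
  have h2 := ler_wpM2l (ltW c0) (ler_wpM2l e2 h).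
  have : 0 <= c * 4 ^+ J by rewrite mulr_ge0 ?(ltW c0)// ltW.
  move: h2; lra.
have h : enorm x ^+ 2 * 4 ^+ m <= 4 ^+ J.
  apply: (@le_trans _ _ (4 ^+ m)); first by rewrite ler_piMl// exprn_ge0.
  by rewrite ler_eXn2l ?ltr1n// ltnW.
have h2 := ler_wpM2l (ltW c0) h.
have : 0 <= c * (enorm x ^+ 2 * (4 ^+ J * q ^+ 2)).
  by rewrite mulr_ge0 ?(ltW c0)// mulr_ge0// mulr_ge0 ?exprn_ge0.
by move: h2; lra.
Qed.

Variables (P : R -> probability 'rV[R]_d R) (hP : levy_semigroup nu P).
Variables (p : R -> 'rV[R]_d -> R) (hp : continuous_densities P p).

(** The alternatives are |x| < 2^-m, where the Gaussian factor of [chaining] is at least exp (-c2),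
    and |x| >= 2^-m, where both terms of the second entry are bounded separately. The disjunction
    replaces the minimum with its infinite value at x = 0. *)
Lemma density_lower_bound : exists2 cc : R * R, 0 < cc.1 /\ 0 < cc.2 &
  forall t x, 0 < t < 1 -> enorm x < 1 ->
  cc.2 * (t `^ (- (d%:R / 2)) * ln (2 / t) `^ (d%:R * (beta - 1) / 2)) <= p t x \/
  x != 0 /\
  cc.2 * (t / (enorm x ^+ (d + 2) * ln (2 / enorm x) `^ beta)
    + (hscale nu t ^+ d)^-1 * expR (- (cc.1 * (enorm x / hscale nu t) ^+ 2))) <= p t x.
Proof.
have [[c1 c2] /= [c10 c20] Hc] := chaining hd hbeta hnu hnu1 hP hp.
have [cj cj0 Hj] := jump_lower hd hbeta hnu hnu1 hP hp.
have [[c7 C] /= [c70 C0] Hh] := hscale_gaussian_le c20.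
have [CT CT0 HT] := diagonal_size d hbeta.
(* a belongs to the first alternative; in b the two summands are the constants by which the jump
   term and the Gaussian term are dominated by [p t x]. *)
pose a := c1 * expR (- c2) / CT; pose b := (cj^-1 + C / c1)^-1.
have a0 : 0 < a by rewrite divr_gt0// mulr_gt0// expR_gt0.
have b0 : 0 < b by rewrite invr_gt0 addr_gt0 ?invr_gt0 ?divr_gt0.
exists (c7, Num.min a b) => /=; first by rewrite lt_min a0 b0.
move=> t x t01 x1; have /andP[t0 t1] := t01.
have [m tw] := dyadic_time hbeta t01; have /andP[tw1 tw4] := tw.
have m0 := exp2V_gt0 R m.
have c := Hc t m x tw x1.
have [xm|xm] := leP (2^-1 ^+ m) (enorm x); [right|left].
  have x0 : 0 < enorm x by exact: lt_le_trans xm.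
  split; first by apply/eqP => x00; move: x0; rewrite x00 -(scale0r (0 : 'rV[R]_d)) enormZ normr0 mul0r ltxx.
  have j := Hj t m x t0 tw xm x1.
  have h := Hh t m x t0 tw x1.
  have -> : t / (enorm x ^+ (d + 2) * ln (2 / enorm x) `^ beta) = t * levy_profile beta x.
    by rewrite /levy_profile invfM powRN.
  set T := (_ ^+ d)^-1 * _ in h *.
  have pT : T <= C / c1 * p t x.
    apply: (le_trans h); rewrite -mulrA ler_pM2l// ler_pdivlMl// (mulrA c1); exact: c.
  have pL : t * levy_profile beta x <= cj^-1 * p t x by rewrite ler_pdivlMl.
  have px : 0 <= p t x by have [_ + _] := hp t0; exact.
  have K0 : 0 < cj^-1 + C / c1 by rewrite addr_gt0 ?invr_gt0 ?divr_gt0.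
  have h1 : t * levy_profile beta x + T <= (cj^-1 + C / c1) * p t x.
    by rewrite mulrDl lerD.
  have ab0 : 0 <= Num.min a b by rewrite le_min (ltW a0) (ltW b0).
  apply: (le_trans (ler_wpM2l ab0 h1)).
  have h2 : Num.min a b <= b by rewrite ge_min lexx orbT.
  apply: (@le_trans _ _ (b * ((cj^-1 + C / c1) * p t x))).
    by rewrite ler_wpM2r// mulr_ge0// ltW.
  by rewrite mulrA /b mulVf ?mul1r// gt_eqF.
have T1 := HT t m t01 tw1.
have ab0 : 0 <= Num.min a b by rewrite le_min (ltW a0) (ltW b0).
apply: (le_trans (ler_wpM2l ab0 T1)).
have M0 : 0 <= (2 ^+ m) ^+ d :> R by rewrite !exprn_ge0.
apply: (@le_trans _ _ (a * (CT * (2 ^+ m) ^+ d))).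
  apply: ler_wpM2r; first by rewrite mulr_ge0// ltW.
  by rewrite ge_min lexx.
apply: le_trans c.
rewrite mulrA /a divfK ?gt_eqF// mulrAC ler_wpM2l//; first by rewrite mulr_ge0// ltW.
rewrite ler_expR lerN2 -[leRHS]mulr1 ler_pM2l//.
have E4 k : (4 : R) ^+ k = (2 ^+ k) ^+ 2.
  by rewrite -exprM mulnC exprM; congr (_ ^+ _); rewrite expr2; lra.
rewrite E4 -exprMn expr_le1// ?mulr_ge0 ?enorm_ge0 ?exprn_ge0//.
by move: (ltW xm); rewrite exprVn -ler_pdivlMr ?exprn_gt0// div1r.
Qed.

End off_diagonal.

Theorem mainTheorem5 (R : realType) (d : nat) (hd : (0 < d)%N)
    (beta : R) (hbeta : 1 < beta)
    (nu : {measure set 'rV[R]_d -> \bar R})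
    (hnu : symmetric_levy_measure nu)
    (hnu1 : comparable_density nu
      [set x | 0 < enorm x < 1] (levy_profile beta))
    (P : R -> probability 'rV[R]_d R) (hP : levy_semigroup nu P)
    (p : R -> 'rV[R]_d -> R) (hp : continuous_densities P p) :
  exists c7 c8 : R, [/\ 0 < c7, 0 < c8 &
    forall (t : R) (x : 'rV[R]_d), 0 < t < 1 -> enorm x < 1 ->
    (c8%:E *
      Order.min
        (t `^ (- (d%:R / 2)) * ln (2 / t) `^ (d%:R * (beta - 1) / 2))%:E
        (if (x == 0)%R then +oo else
          (t / (enorm x ^+ (d + 2) * ln (2 / enorm x) `^ beta)
           + (hscale nu t ^+ d)^-1
             * expR (- (c7 * (enorm x / hscale nu t) ^+ 2)))%:E)
     <= (p t x)%:E)%E].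
Proof.
have [[c7 c8] /= [c70 c80] H] := density_lower_bound hd hbeta hnu hnu1 hP hp.
exists c7, c8; split=> // t x t01 x1.
have c8E : (0 <= c8%:E)%E by rewrite lee_fin ltW.
have [h|[x0 h]] := H t x t01 x1; rewrite -lee_fin EFinM in h; apply: le_trans h.
  by apply: lee_wpmul2l => //; rewrite ge_min lexx.
by rewrite (negbTE x0); apply: lee_wpmul2l => //; rewrite ge_min lexx orbT.
Qed.
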